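(* Consider Activated Random Walks on $\mathbb{Z}^d$ for any $d\geqslant1$, with sleep rate $\lambda\in(0,\infty)$ and a directed jump distribution $p(\cdot)$, meaning that for some $\boldsymbol{v}\in\mathbb{R}^d$ one has $p(y)=0$ for every $y$ with $\boldsymbol{v}\cdot y\leqslant0$. Then $\zeta_c\leqslant\frac{\lambda}{1+\lambda}$.
   Context: Activated Random Walk (ARW) on $\mathbb{Z}^d$. Fix $d\geqslant1$, a sleep rate $0<\lambda<\infty$ and a jump distribution $p(\cdot)$, i.e. a probability distribution on $\mathbb{Z}^d$ supported on the nearest neighbors $\{\pm e_1,\dots,\pm e_d\}$ of the origin $\boldsymbol{0}$ and whose support generates the group $\mathbb{Z}^d$. Let $\mathbb{N}_0=\{0,1,2,\dots\}$ and $\mathbb{N}_{\mathfrak{s}}=\mathbb{N}_0\cup\{\mathfrak{s}\}$, ordered by $0<\mathfrak{s}<1<2<\cdots$, with $|\mathfrak{s}|=1$, $|n|=n$, $\mathfrak{s}+1=2$, $1\cdot\mathfrak{s}=\mathfrak{s}$ and $n\cdot\mathfrak{s}=n$ for $n\geqslant2$. A configuration is $\eta\in(\mathbb{N}_{\mathfrak{s}})^{\mathbb{Z}^d}$: site $x$ contains $\eta(x)$ active particles if $\eta(x)\in\mathbb{N}_0$ and one sleeping particle if $\eta(x)=\mathfrak{s}$. Evolution: at each site $x$ a clock rings at rate $(1+\lambda)\,\eta_t(x)\,\mathbf{1}_{\{\eta_t(x)\neq\mathfrak{s}\}}$. When it rings, with probability $\frac{\lambda}{1+\lambda}$ the value $\eta(x)$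 is replaced by $\eta(x)\cdot\mathfrak{s}$; otherwise, with probability $\frac{p(y-x)}{1+\lambda}$ for each $y$, $\eta(x)$ is replaced by $\eta(x)-1$ and $\eta(y)$ by $\eta(y)+1$. For a translation-ergodic distribution $\nu$ on $(\mathbb{N}_{\mathfrak{s}})^{\mathbb{Z}^d}$ with finite density $\int|\eta(\boldsymbol{0})|\nu(\mathrm{d}\eta)<\infty$ there is a process $(\eta_t)_{t\geqslant0}$ with these rates and $\eta_0\sim\nu$; its law $\mathbf{P}^{\nu}$ is characterized by $\mathbf{P}^{\nu}(\mathcal{A})=\lim_{V\uparrow\mathbb{Z}^d}\mathbf{P}^{\nu}_V(\mathcal{A})$ for every event $\mathcal{A}$ determined by $(\eta_s(x))_{x\in B,\,s\in[0,t]}$ with $B$ finite and $t<\infty$, where $\mathbf{P}^{\nu}_V$ is the law of the (finite) system started from $\eta_0\cdot\mathbf{1}_V$, $V$ finite. The system stays active if, for each site, there are arbitrarily large times at which the site has at least one active particle. It fixates if, for each site, there is a (random) time after which the site is always either vacant or occupied by exactly one sleeping particle. Critical density: given $d$, $p(\cdot)$, $\lambda$, the critical density $\zeta_c$ is the unique number such that, for every translation-ergodic distribution $\nu$ supported on $(\mathbb{N}_0)^{\mathbb{Z}^d}$ (all particles initially active) with finite density $\zeta$, $\mathbf{P}^\nu(\text{system stays active})$ equals $0$ if $\zeta<\zeta_c$ and $1$ if $\zeta>\zeta_c$ (existence of such a number is a known theorem). *)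

(* Defs.v *)
From HB Require Import structures.
From mathcomp Require Import all_boot all_order all_algebra.
From mathcomp Require Import all_classical all_reals all_analysis.
From mathcomp Require Import measurable_realfun.

Set Implicit Arguments.
Unset Strict Implicit.
Unset Printing Implicit Defensive.

Import Order.TTheory GRing.Theory Num.Theory.
Import numFieldNormedType.Exports.

Local Open Scope classical_set_scope.
Local Open Scope ring_scope.

(* Local states: [Act n] is n active particles, [Slp] one sleeping particle. *)
Inductive occ := Act of nat | Slp.

HB.instance Definition _ := gen_eqMixin occ.
HB.instance Definition _ := gen_choiceMixin occ.
HB.instance Definition _ := isPointed.Build occ (Act 0).

Definition occ_size (a : occ) : nat := if a is Act n then n else 1.

Definition occ_active (a : occ) : nat := if a is Act n then n else 0.

Definition occ_incr (a : occ) : occ := if a is Act n then Act n.+1 else Act 2.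

(* Only ever applied to a site with at least one active particle. *)
Definition occ_decr (a : occ) : occ := if a is Act n then Act n.-1 else Slp.

Definition occ_sleep (a : occ) : occ := if a is Act 1 then Slp else a.

Definition site (d : nat) := 'rV[int]_d.

Definition config (d : nat) := site d -> occ.

Definition config_cylinders (d : nat) : set (set (config d)) :=
  [set A | exists x a, A = [set eta | eta x = a]].

Definition config_space (d : nat) := g_sigma_algebraType (@config_cylinders d).

Definition shift d (z : site d) (eta : config d) : config d :=
  fun x => eta (x + z).

Definition restrict_to d (V : set (site d)) (eta : config d) : config d :=
  fun x => if x \in V then eta x else Act 0.

Definition set_site d (eta : config d) (x : site d) (a : occ) : config d :=
  fun y => if y == x then a else eta y.

Inductive instruction (d : nat) := Sleep | Jump of site d.
Arguments Sleep {d}.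

(* Effect on [eta] of a ring at [x] carrying the instruction [i]; [Jump z] moves
   one particle from [x] to [x + z]. *)
Definition topple d (eta : config d) (x : site d) (i : instruction d) : config d :=
  match i with
  | Sleep => set_site eta x (occ_sleep (eta x))
  | Jump z =>
      let eta' := set_site eta x (occ_decr (eta x)) in
      set_site eta' (x + z) (occ_incr (eta' (x + z)))
  end.

Fixpoint topple_seq d (eta : config d) (x : nat -> site d)
    (i : nat -> instruction d) (n : nat) : config d :=
  if n is m.+1 then topple (topple_seq eta x i m) (x m) (i m) else eta.

Section JumpDistribution.
Variables (R : realType) (d : nat).

Definition jump_distribution (p : site d -> R) : Prop :=
  [/\ forall y, 0 <= p y,
      (\esum_(y in [set: site d]) (p y)%:E = 1)%E,
      forall y, p y != 0 ->
        exists i : 'I_d, y = delta_mx 0 i \/ y = - delta_mx 0 i &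
      forall H : set (site d),
        H 0 -> (forall x y, H x -> H y -> H (x - y)) ->
        [set y | p y != 0] `<=` H -> H = setT].

Definition directed (p : site d -> R) : Prop :=
  exists v : 'rV[R]_d,
    forall y : site d, \sum_(i < d) v 0 i * (y 0 i)%:~R <= 0 -> p y = 0.

End JumpDistribution.

Section Paths.
Variables (R : realType) (d : nat).

(* Right-continuity with left limits on [0, +oo) for the product of the discrete
   topologies. *)
Definition cadlag (w : R -> config d) : Prop :=
  forall x : site d,
    (forall t, 0 <= t -> exists2 e, 0 < e &
       forall s, t <= s < t + e -> w s x = w t x) /\
    (forall t, 0 < t -> exists a, exists2 e, 0 < e &
       forall s, 0 <= s -> t - e < s < t -> w s x = a).

(* Time is indexed by all of R, but neither [cadlag] nor the sigma-algebra below
   looks at negative times. *)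
Record path := Path { traj :> R -> config d ; traj_cadlag : cadlag traj }.

HB.instance Definition _ := gen_eqMixin path.
HB.instance Definition _ := gen_choiceMixin path.

Lemma cadlag_cst : cadlag (fun _ _ => Act 0).
Proof.
move=> x; split=> [t _|t _]; first by exists 1.
by exists (Act 0), 1.
Qed.

HB.instance Definition _ := isPointed.Build path (Path cadlag_cst).

Definition path_cylinders (B : set (site d)) (I : set R) : set (set path) :=
  [set A | exists x s a, [/\ B x, I s & A = [set w : path | w s x = a]]].

Definition path_space :=
  g_sigma_algebraType (path_cylinders setT [set s | 0 <= s]).

(* Events determined by the states of the sites of [B] during [0, t]. *)
Definition local_event (B : set (site d)) (t : R) : set (set path) :=
  <<s path_cylinders B [set s | 0 <= s <= t] >>.

Definition stays_active : set path :=
  [set w | forall (x : site d) (T : R), exists t : R,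
     [/\ 0 <= t, T <= t & (1 <= occ_active (w t x))%N]].

End Paths.

Section Dynamics.
Variables (R : realType) (d : nat) (p : site d -> R) (lam : R).

Definition ring_rate (eta : config d) (x : site d) : R :=
  (1 + lam) * (occ_active (eta x))%:R.

(* A genuine sum for configurations with finitely many particles, the only ones
   for which it is used. *)
Definition total_rate (eta : config d) : R :=
  \sum_(x \in [set: site d]) ring_rate eta x.

Definition instruction_prob (i : instruction d) : R :=
  match i with
  | Sleep => lam / (1 + lam)
  | Jump z => p z / (1 + lam)
  end.

(* [P] is the law of the finite system started from eta_0 * 1_V, eta_0 ~ nu.
   [delay k] is the waiting time between the k-th and (k+1)-st ring, equal to
   +oo if there is no further ring; the ring ending it occurs at [ringer k] with
   instruction [instr k].  From a state eta the clocks of all sites race, so that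
   the next ring comes after an exponential time of parameter [total_rate eta],
   and independently is at x with probability ring_rate eta x / total_rate eta.
   If total_rate eta = 0, the formula gives probability 0 to a further ring. *)
Definition finite_ARW_law (nu : probability (config_space d) R)
    (V : set (site d)) (P : probability (path_space R d) R) : Prop :=
  exists (dO : measure_display) (O : measurableType dO) (Pr : probability O R)
    (init : O -> config_space d) (delay : nat -> O -> \bar R)
    (ringer : nat -> O -> site d) (instr : nat -> O -> instruction d)
    (eta : O -> path_space R d),
  let state (n : nat) (o : O) :=
    topple_seq (init o) (ringer^~ o) (instr^~ o) n in
  let ring_time (n : nat) (o : O) := (\sum_(k < n) delay k o)%E in
  [/\ [/\ measurable_fun setT init,
          forall k, measurable_fun setT (delay k),
          forall k x, measurable [set o | ringer k o = x],
          forall k i, measurable [set o | instr k o = i] &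
          measurable_fun setT eta],
      forall k o, (0 < delay k o)%E,
      forall (n : nat) (xi : config d) (u : nat -> R) (x : nat -> site d)
        (i : nat -> instruction d), (forall k, 0 <= u k) ->
        (Pr [set o | init o = xi /\ forall k, (k < n)%N ->
               [/\ (u k)%:E < delay k o < +oo, ringer k o = x k
                 & instr k o = i k]]
         = nu [set zeta | restrict_to V zeta = xi] *
           (\prod_(k < n)
              (expR (- (total_rate (topple_seq xi x i k) * u k)) *
               (ring_rate (topple_seq xi x i k) (x k) /
                total_rate (topple_seq xi x i k)) *
               instruction_prob (i k)))%:E)%E,
      {ae Pr, forall o, forall (n : nat) (t : R), 0 <= t ->
         (ring_time n o <= t%:E < ring_time n.+1 o)%E ->
         traj (eta o) t = state n o} &
      forall A, measurable A -> P A = Pr (eta @^-1` A)].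

(* [P] is the law of the process on Z^d with eta_0 ~ nu: the limit of the finite
   systems as V increases to Z^d, on all local events. *)
Definition ARW_law (nu : probability (config_space d) R)
    (P : probability (path_space R d) R) : Prop :=
  exists PV : set (site d) -> probability (path_space R d) R,
    (forall V, finite_set V -> finite_ARW_law nu V (PV V)) /\
    forall (B : set (site d)) (t : R) (A : set (path_space R d)),
      finite_set B -> local_event B t A ->
      forall V : nat -> set (site d),
        (forall n, finite_set (V n)) ->
        (forall m n, (m <= n)%N -> V m `<=` V n) ->
        \bigcup_n V n = setT ->
        PV (V n) A @[n --> \oo] --> P A.

Definition translation_ergodic (nu : probability (config_space d) R) : Prop :=
  (forall (z : site d) (A : set (config_space d)), measurable A ->
     nu (shift z @^-1` A) = nu A) /\
  (forall A : set (config_space d), measurable A ->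
     (forall z : site d, shift z @^-1` A = A) -> nu A = 0%E \/ nu A = 1%E).

Definition all_active (nu : probability (config_space d) R) : Prop :=
  nu [set eta | forall x, eta x <> Slp] = 1%E.

Definition density (nu : probability (config_space d) R) : \bar R :=
  (\int[nu]_eta ((occ_size (eta 0))%:R)%:E)%E.

Definition critical_density (zc : R) : Prop :=
  forall (nu : probability (config_space d) R) (zeta : R),
    translation_ergodic nu -> all_active nu -> density nu = zeta%:E ->
    exists2 P : probability (path_space R d) R, ARW_law nu P &
      (zeta < zc -> P (@stays_active R d) = 0%E) /\
      (zc < zeta -> P (@stays_active R d) = 1%E).

End Dynamics.

(* Main.v *)
Require Import Defs.
From mathcomp Require Import all_boot all_order all_algebra finmap.
From mathcomp Require Import all_classical all_reals all_analysis.
From mathcomp Require Import measurable_realfun.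
From mathcomp Require Import ring lra.
From HB Require Import structures.

(** If zc > q := lam / (1 + lam), pick a rational density k / m in (q, 1) below
    zc and start from a uniformly random translate of an m-periodic configuration
    with k active particles per period; by criticality the process then a.s. does
    not stay active.  This is refuted by a lower bound, uniform in the volume V,
    on the probability that a given finite set of sites is active after a given
    time.

    In a finite system, weigh an event at time t by exp (- th * t).  Since p is
    directed, a particle never returns to a site it has left, and what happens
    upstream of x is independent of the instructions used at x.  Hence each time
    the last particle at x is given an instruction, it either falls asleep or
    leaves, with odds lam : 1, and then nothing changes until the next arrival, so
    that the discounted time during which x holds a sleeping particle is at most
    q / th.  By mass balance, summed over the translates, the density in excess
    of q has to be carried by moving particles: some translate has on average at
    least b / th discounted jumps from z, with b independent of th and V.  The
    variance of this number is at most that of independent walkers that never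
    sleep, hence of order 1 / th: the jumps from z concentrate as th -> 0.

    The second moment method gives, with probability bounded below, of order
    1 / th discounted jumps from z.  Up to small errors, a proportion p (dir k) of
    these jumps go in direction k, and all arrivals at a site leave it again except
    for a number bounded in mean, which propagates the estimate from z to a finite
    set of sites downstream.  Jumps before time T, or after a large T',
    contribute too little, so that all these sites are active during [T, T']. *)

Set Implicit Arguments.
Unset Strict Implicit.
Unset Printing Implicit Defensive.

Import Order.TTheory GRing.Theory Num.Theory.
Import numFieldNormedType.Exports.

Local Open Scope classical_set_scope.
Local Open Scope ring_scope.

(** * Discounted Green functions of finite systems *)

(** The infinite process is known only through limits of finite systems on local events, so the
    final bounds may depend on the target sites, the time and the density, but not on [V].
    Discounting serves this: an exponentially weighted time integral obeys a one-step recursion at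
    each ring, so that moments become algebraic, and [th] replaces a time horizon. The recursions
    are cut at [N] rings; [N] may depend on [V], through the number of particles, and the cut costs
    a geometrically small error. With density below 1 a site carries at most one particle initially,
    so the mean number of discounted jumps from a site is at most [1 / th]. With thresholds [tau] of
    order [1 / th], a variance of order [1 / th] costs [1 / (th * tau ^+ 2)], of order [th]; bounded
    means and times before [T] cost a multiple of [1 / tau], again of order [th]. A small [th] thus
    pays for finitely many edges and targets. Periodic initial states make the density at each site
    exact once summed over the phases, and each phase restricted to [V] is an atom of probability at
    least the inverse of the period. *)

Section FiniteConfigurations.
Variables (R : realType) (d : nat).
Implicit Types (eta : config d) (x y z : site d).

Definition supp eta : set (site d) := [set y | eta y != Act 0].

Definition fin_config eta : Prop := finite_set (supp eta).

Definition num eta x : R := (occ_size (eta x))%:R.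
Definition act eta x : R := (occ_active (eta x))%:R.
Definition slp eta x : R := (eta x == Slp)%:R.

Definition nsum eta (g : site d -> R) : R :=
  \sum_(x <- fset_set (supp eta)) num eta x * g x.
Definition asum eta (g : site d -> R) : R :=
  \sum_(x <- fset_set (supp eta)) act eta x * g x.

Lemma num_split eta x : num eta x = act eta x + slp eta x.
Proof.
rewrite /num /act /slp; case: (eta x) => [n|] /=; last by rewrite eqxx add0r.
by case: eqP => // _; rewrite addr0.
Qed.

Lemma num_ge0 eta x : 0 <= num eta x. Proof. exact: ler0n. Qed.
Lemma act_ge0 eta x : 0 <= act eta x. Proof. exact: ler0n. Qed.
Lemma slp_ge0 eta x : 0 <= slp eta x. Proof. exact: ler0n. Qed.

Lemma act_le_num eta x : act eta x <= num eta x.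
Proof. by rewrite num_split lerDl slp_ge0. Qed.

Lemma sum_suppE eta (g : site d -> R) (S : seq (site d)) :
  fin_config eta -> uniq S -> (forall x, eta x != Act 0 -> x \in S) ->
  (forall x, eta x = Act 0 -> g x = 0) ->
  \sum_(x <- fset_set (supp eta)) g x = \sum_(x <- S) g x.
Proof.
move=> feta uS sS g0.
have -> : \sum_(x <- S) g x = \sum_(x <- [seq x <- S | eta x != Act 0]) g x.
  rewrite big_filter [LHS](bigID (fun x => eta x != Act 0)) /= [X in _ + X]big1 ?addr0//.
  by move=> x /negPn/eqP/g0.
apply: perm_big; apply: uniq_perm; rewrite ?filter_uniq ?fset_uniq//.
move=> x; rewrite in_fset_set// mem_filter; apply/idP/andP.
  by rewrite inE /supp /= => ex; split=> //; apply: sS.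
by case=> ex _; rewrite inE.
Qed.

Lemma asumE eta (S : seq (site d)) g :
  fin_config eta -> uniq S -> (forall x, eta x != Act 0 -> x \in S) ->
  asum eta g = \sum_(x <- S) act eta x * g x.
Proof.
move=> feta uS sS; apply: sum_suppE => // x ex.
by rewrite /act ex mul0r.
Qed.

Lemma nsumE eta (S : seq (site d)) g :
  fin_config eta -> uniq S -> (forall x, eta x != Act 0 -> x \in S) ->
  nsum eta g = \sum_(x <- S) num eta x * g x.
Proof.
move=> feta uS sS; apply: sum_suppE => // x ex.
by rewrite /num ex mul0r.
Qed.

Lemma eq_asum eta f g : (forall x, (0 < occ_active (eta x))%N -> f x = g x) ->
  asum eta f = asum eta g.
Proof.
move=> fg; apply: eq_bigr => x _; rewrite /act.
by case: (posnP (occ_active (eta x))) => [->|/fg->//]; rewrite !mul0r.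
Qed.

Lemma ler_asum eta f g : (forall x, (0 < occ_active (eta x))%N -> f x <= g x) ->
  asum eta f <= asum eta g.
Proof.
move=> fg; apply: ler_sum => x _; rewrite /act.
case: (posnP (occ_active (eta x))) => [->|/fg fgx]; first by rewrite !mul0r.
by rewrite ler_wpM2l// act_ge0.
Qed.

Lemma asumD eta f g : asum eta (fun x => f x + g x) = asum eta f + asum eta g.
Proof. by rewrite /asum -big_split; apply: eq_bigr => x _; rewrite mulrDr. Qed.

Lemma asumZ eta c f : asum eta (fun x => c * f x) = c * asum eta f.
Proof. by rewrite /asum mulr_sumr; apply: eq_bigr => x _; rewrite mulrCA. Qed.

Lemma asum_ge0 eta f : (forall x, (0 < occ_active (eta x))%N -> 0 <= f x) ->
  0 <= asum eta f.
Proof.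
move=> f0; have -> : 0 = asum eta (fun=> 0).
  by rewrite /asum big1// => x _; rewrite mulr0.
exact: ler_asum.
Qed.

Lemma asum_point eta x c : fin_config eta ->
  asum eta (fun y => c y * (y == x)%:R) = act eta x * c x.
Proof.
move=> feta; pose S := undup (x :: fset_set (supp eta)).
rewrite (@asumE _ S) ?undup_uniq//; last first.
  by move=> y ey; rewrite mem_undup inE in_fset_set// mem_set ?orbT.
rewrite (bigD1_seq x) ?undup_uniq ?mem_undup ?mem_head//= eqxx mulr1.
by rewrite big1 ?addr0// => y /negPf->; rewrite !mulr0.
Qed.

Lemma asum_le_nsum eta f : (forall x, 0 <= f x) -> asum eta f <= nsum eta f.
Proof. by move=> f0; apply: ler_sum => x _; rewrite ler_wpM2r ?act_le_num. Qed.

Lemma nsum_ge0 eta f : (forall x, 0 <= f x) -> 0 <= nsum eta f.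
Proof. by move=> f0; apply: sumr_ge0 => x _; rewrite mulr_ge0 ?num_ge0. Qed.

Lemma num_le_nsum eta x : fin_config eta -> num eta x <= nsum eta (fun=> 1).
Proof.
move=> feta; pose S := undup (x :: fset_set (supp eta)).
rewrite (@nsumE _ S) ?undup_uniq//; last first.
  by move=> y ey; rewrite mem_undup inE in_fset_set// mem_set ?orbT.
rewrite (bigD1_seq x) ?undup_uniq ?mem_undup ?mem_head//= mulr1 lerDl.
by apply: sumr_ge0 => y _; rewrite mulr1 num_ge0.
Qed.

Lemma fin_set_site eta x a : fin_config eta -> fin_config (set_site eta x a).
Proof.
move=> feta; apply: (@sub_finite_set _ _ (supp eta `|` [set x])); last first.
  by rewrite finite_setU.
move=> y; rewrite /supp /set_site /=.
by case: (y =P x) => [->|_ ey]; [right|left].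
Qed.

Lemma fin_topple eta x i : fin_config eta -> fin_config (topple eta x i).
Proof. by case: i => [|z] feta /=; do ?apply: fin_set_site. Qed.

Lemma set_siteE eta x a y : set_site eta x a y = if y == x then a else eta y.
Proof. by []. Qed.

Lemma nsum_set_site eta x a u : fin_config eta ->
  nsum (set_site eta x a) u = nsum eta u + ((occ_size a)%:R - num eta x) * u x.
Proof.
move=> feta; pose S := undup (x :: fset_set (supp eta)).
have sS y : eta y != Act 0 -> y \in S.
  by move=> ey; rewrite mem_undup inE in_fset_set// mem_set ?orbT.
rewrite !(@nsumE _ S) ?undup_uniq//; last 2 first.
- exact: fin_set_site.
- move=> y; rewrite set_siteE; case: (y =P x) => [->|_ /sS//].
  by rewrite mem_undup mem_head.
rewrite !(bigD1_seq x) ?undup_uniq ?mem_undup ?mem_head//=.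
rewrite {1}/num set_siteE eqxx mulrBl -addrA [RHS]addrC -!addrA.
rewrite addNr addr0 addrC; congr (_ + _).
by apply: eq_bigr => y /negPf yx; rewrite /num set_siteE yx.
Qed.

Lemma num_topple_jump eta x z y : z != 0 -> (0 < occ_active (eta x))%N ->
  num (topple eta x (Jump z)) y = num eta y - (y == x)%:R + (y == x + z)%:R.
Proof.
move=> z0 ax; rewrite /num /= !set_siteE.
have xz : (x + z == x) = false.
  by rewrite -[X in _ == X]addr0 (inj_eq (addrI x)) (negPf z0).
case: (y =P x + z) => [->|_]; rewrite ?xz ?subr0 ?addr0.
  by case: (eta (x + z)) => [k|] /=; rewrite -natr1.
case: (y =P x) => [->|_]; rewrite ?subr0//.
by case: (eta x) ax => [[|k]|] //= _; rewrite -natr1 addrK.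
Qed.

Lemma num_topple_sleep eta x y : num (topple eta x Sleep) y = num eta y.
Proof.
rewrite /num /= set_siteE; case: eqP => [->|//].
by case: (eta x) => [[|[|k]]|].
Qed.

Lemma nsum_topple_sleep eta x u : fin_config eta ->
  nsum (topple eta x Sleep) u = nsum eta u.
Proof.
move=> feta; rewrite /= nsum_set_site//.
by rewrite /num; case: (eta x) => [[|[|k]]|] /=; rewrite subrr mul0r addr0.
Qed.

Lemma nsum_topple_jump eta x z u : fin_config eta -> z != 0 ->
  (0 < occ_active (eta x))%N ->
  nsum (topple eta x (Jump z)) u = nsum eta u + u (x + z) - u x.
Proof.
move=> feta z0 ax /=.
have fs := fin_set_site x (occ_decr (eta x)) feta.
rewrite nsum_set_site// nsum_set_site//.
have xz : (x + z == x) = false.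
  by rewrite -[X in _ == X]addr0 (inj_eq (addrI x)) (negPf z0).
rewrite /num !set_siteE xz.
have -> : (occ_size (occ_decr (eta x)))%:R - (occ_size (eta x))%:R = -1 :> R.
  by case: (eta x) ax => [[|k]|] //= _; rewrite -natr1 opprD addrA subrr sub0r.
have -> : (occ_size (occ_incr (eta (x + z))))%:R - (occ_size (eta (x + z)))%:R = 1 :> R.
  by case: (eta (x + z)) => [k|] /=; rewrite -natr1 addrAC subrr add0r.
by rewrite mulN1r mul1r addrAC.
Qed.

End FiniteConfigurations.

(** * The generator of a finite system *)

Section Generator.
Variables (R : realType) (d : nat) (lam : R).
Variables (dir : 'I_d -> site d) (pd : 'I_d -> R).
Hypothesis lam_gt0 : 0 < lam.
Hypothesis pd_gt0 : forall i, 0 < pd i.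
Hypothesis pd_sum : \sum_i pd i = 1.
Hypothesis dir_neq0 : forall i, dir i != 0.
Implicit Types (eta : config d) (x y z : site d).

Let lam_ge0 : 0 <= lam := ltW lam_gt0.
Let pd_ge0 i : 0 <= pd i := ltW (pd_gt0 i).

Definition mix (f : instruction d -> R) : R :=
  lam * f Sleep + \sum_i pd i * f (Jump (dir i)).

Lemma mixD f g : mix (fun i => f i + g i) = mix f + mix g.
Proof.
rewrite /mix mulrDr addrACA -big_split /=; congr (_ + _).
by apply: eq_bigr => i _; rewrite mulrDr.
Qed.

Lemma mixZ c f : mix (fun i => c * f i) = c * mix f.
Proof.
rewrite /mix mulrDr mulrCA mulr_sumr; congr (_ + _).
by apply: eq_bigr => i _; rewrite mulrCA.
Qed.

Lemma mix_cst c : mix (fun=> c) = (1 + lam) * c.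
Proof. by rewrite /mix -mulr_suml pd_sum mulrDl addrC. Qed.

(** The gain part of the generator: each active particle receives a sleep instruction at rate [lam]
    and jumps at rate 1, and [f] is the value attached to the ring. The full generator subtracts
    [tot eta * F eta]. *)
Definition gen eta (f : site d -> instruction d -> R) : R :=
  asum eta (fun x => mix (f x)).

Definition tot eta : R := (1 + lam) * asum eta (fun=> 1).

Definition fair_instr (i : instruction d) : Prop :=
  i = Sleep \/ exists k, i = Jump (dir k).

Definition step_ok eta x (i : instruction d) : Prop :=
  (0 < occ_active (eta x))%N /\ fair_instr i.

Lemma eq_mix f g : (forall i, fair_instr i -> f i = g i) -> mix f = mix g.
Proof.
move=> fg; rewrite /mix fg; last by left.
by congr (_ + _); apply: eq_bigr => i _; rewrite fg//; right; exists i.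
Qed.

Lemma ler_mix f g : (forall i, fair_instr i -> f i <= g i) -> mix f <= mix g.
Proof.
move=> fg; rewrite /mix lerD// ?ler_wpM2l//; first by apply: fg; left.
by apply: ler_sum => i _; rewrite ler_wpM2l//; apply: fg; right; exists i.
Qed.

Lemma eq_gen eta f g : (forall x i, step_ok eta x i -> f x i = g x i) ->
  gen eta f = gen eta g.
Proof. by move=> fg; apply: eq_asum => x ax; apply: eq_mix => i ?; apply: fg. Qed.

Lemma ler_gen eta f g : (forall x i, step_ok eta x i -> f x i <= g x i) ->
  gen eta f <= gen eta g.
Proof. by move=> fg; apply: ler_asum => x ax; apply: ler_mix => i ?; apply: fg. Qed.

Lemma genD eta f g :
  gen eta (fun x i => f x i + g x i) = gen eta f + gen eta g.
Proof. by rewrite /gen -asumD; apply: eq_asum => x _; rewrite -mixD. Qed.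

Lemma genZ eta c f : gen eta (fun x i => c * f x i) = c * gen eta f.
Proof. by rewrite /gen -asumZ; apply: eq_asum => x _; rewrite mixZ. Qed.

Lemma gen_cst eta c : gen eta (fun _ _ => c) = tot eta * c.
Proof.
rewrite /gen /tot -mulrA [asum _ _ * _]mulrC mulrCA -!asumZ.
by apply: eq_asum => x _; rewrite mix_cst mulr1 mulrC.
Qed.

Lemma tot_ge0 eta : 0 <= tot eta.
Proof. by rewrite mulr_ge0 ?asum_ge0// addr_ge0. Qed.

Lemma gen_ge0 eta f : (forall x i, step_ok eta x i -> 0 <= f x i) ->
  0 <= gen eta f.
Proof. by move=> f0; rewrite -(mulr0 (tot eta)) -gen_cst ler_gen. Qed.

Lemma tot_le_mass eta : tot eta <= (1 + lam) * nsum eta (fun=> 1).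
Proof. by rewrite ler_wpM2l ?addr_ge0// asum_le_nsum. Qed.

(** Topplings conserve the mass, so [M] bounds the total rate along the whole evolution and keeps
    the discount per ring away from 1. *)
Definition admissible (M : R) eta : Prop :=
  fin_config eta /\ nsum eta (fun=> 1) <= M.

Lemma admissible_topple M eta x i :
  admissible M eta -> step_ok eta x i -> admissible M (topple eta x i).
Proof.
move=> [feta massM] [ax [->|[k ->]]]; split; do ?exact: fin_topple.
  by rewrite nsum_topple_sleep.
by rewrite nsum_topple_jump// addrK.
Qed.

(** * Resolvent recursions and Dynkin's formula *)

Section Discounted.
Variables th : R.
Hypothesis th_gt0 : 0 < th.

Lemma den_gt0 eta : 0 < tot eta + th.
Proof. by rewrite ltr_wpDl ?tot_ge0. Qed.

Lemma den_neq0 eta : tot eta + th != 0.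
Proof. by rewrite gt_eqF ?den_gt0. Qed.

(* [disc n F] is the expectation of [F] at the [n]-th ring, discounted by
   [exp (- th * t)] at the time [t] of this ring. *)
Fixpoint disc (n : nat) (F : config d -> R) eta : R :=
  if n is m.+1 then gen eta (fun x i => disc m F (topple eta x i)) / (tot eta + th)
  else F eta.

(* [green n f] is the expectation of [\int exp (- th * t) * f (eta_t) dt] up to
   the [n]-th ring. *)
Fixpoint green (n : nat) (f : config d -> R) eta : R :=
  if n is m.+1 then
    (f eta + gen eta (fun x i => green m f (topple eta x i))) / (tot eta + th)
  else 0.

(* First and second moment of the sum, over the first [n] rings, of the rewards
   [rho], each discounted by [exp (- th * t)] at the time [t] of the ring. *)
Fixpoint mom1 (rho : config d -> site d -> instruction d -> R) (n : nat) eta : R :=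
  if n is m.+1 then
    gen eta (fun x i => rho eta x i + mom1 rho m (topple eta x i)) / (tot eta + th)
  else 0.

Lemma mom1E rho n eta : mom1 rho n eta = green n (fun e => gen e (rho e)) eta.
Proof.
elim: n eta => //= n IH eta; congr (_ / _); rewrite genD; congr (_ + _).
by apply: eq_gen => x i _; rewrite IH.
Qed.

(** Waiting for the next ring costs a factor [tot eta / (tot eta + th)], which increases with the
    rate, so it is at most its value at the maximal rate [(1 + lam) * M]. *)
Lemma disc_bound (M : R) n F (K : R) eta : admissible M eta -> 0 <= K ->
  (forall e, admissible M e -> `|F e| <= K) ->
  `|disc n F eta| <= K * ((1 + lam) * M / ((1 + lam) * M + th)) ^+ n.
Proof.
set kap := _ / _ => + K0 FK.
elim: n eta => [|n IH] eta aeta /=; first by rewrite mulr1 FK.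
have M0 : 0 <= M by apply: le_trans aeta.2; rewrite nsum_ge0.
have lM0 : 0 <= (1 + lam) * M by rewrite mulr_ge0// addr_ge0.
have kap0 : 0 <= kap by rewrite divr_ge0// addr_ge0// ltW.
rewrite normrM normfV (gtr0_norm (den_gt0 eta)) ler_pdivrMr ?den_gt0//.
set B := K * kap ^+ n.
have B0 : 0 <= B by rewrite mulr_ge0 ?exprn_ge0.
apply: (@le_trans _ _ (tot eta * B)).
  rewrite ler_norml -mulrN -!gen_cst; apply/andP; split; apply: ler_gen => x i ok.
    by have := IH _ (admissible_topple aeta ok); rewrite ler_norml => /andP[].
  by have := IH _ (admissible_topple aeta ok); rewrite ler_norml => /andP[].
have -> : K * kap ^+ n.+1 = B * kap by rewrite exprSr mulrA.
rewrite [tot eta * B]mulrC -[B * kap * _]mulrA ler_wpM2l//.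
have tM : tot eta <= (1 + lam) * M.
  apply: le_trans (tot_le_mass eta) _.
  by rewrite ler_wpM2l ?addr_ge0//; case: aeta.
rewrite /kap mulrAC ler_pdivlMr; last by rewrite ltr_wpDl.
rewrite !mulrDr [tot eta * _]mulrC lerD2l.
by rewrite ler_wpM2r// ltW.
Qed.

Lemma green_le M n f g eta : admissible M eta ->
  (forall e, admissible M e -> f e <= g e) -> green n f eta <= green n g eta.
Proof.
move=> + fg; elim: n eta => //= n IH eta aeta.
rewrite ler_wpM2r ?invr_ge0 ?(ltW (den_gt0 eta))// lerD ?fg//.
by apply: ler_gen => x i ok; apply: IH; apply: admissible_topple aeta ok.
Qed.

Lemma eq_green M n f g eta : admissible M eta ->
  (forall e, admissible M e -> f e = g e) -> green n f eta = green n g eta.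
Proof.
move=> aeta fg; apply/eqP; rewrite eq_le.
by rewrite !(green_le _ aeta)// => e /fg->.
Qed.

Lemma greenD n f g eta :
  green n (fun e => f e + g e) eta = green n f eta + green n g eta.
Proof.
elim: n eta => [|n IH] eta /=; first by rewrite addr0.
rewrite -mulrDl; congr (_ / _); rewrite addrACA -genD; congr (_ + _).
by apply: eq_gen => x i _; rewrite IH.
Qed.

Lemma greenZ n c f eta : green n (fun e => c * f e) eta = c * green n f eta.
Proof.
elim: n eta => [|n IH] eta /=; first by rewrite mulr0.
rewrite mulrA; congr (_ / _); rewrite mulrDr -genZ; congr (_ + _).
by apply: eq_gen => x i _; rewrite IH.
Qed.

Lemma green0 n eta : green n (fun=> 0) eta = 0.
Proof.
rewrite -[RHS](mul0r (green n (fun=> 0) eta)) -greenZ; congr green.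
by apply/funext => e; rewrite mulr0.
Qed.

Lemma greenN n f eta : green n (fun e => - f e) eta = - green n f eta.
Proof.
rewrite -mulN1r -greenZ; congr green; apply/funext => e.
by rewrite mulN1r.
Qed.

Lemma green_sum n (I : Type) (r : seq I) (F : I -> config d -> R) eta :
  green n (fun e => \sum_(k <- r) F k e) eta = \sum_(k <- r) green n (F k) eta.
Proof.
elim: r => [|k r IH].
  rewrite big_nil -[RHS](green0 n eta); congr green.
  by apply/funext => e; rewrite big_nil.
rewrite big_cons -IH -greenD; congr green.
by apply/funext => e; rewrite big_cons.
Qed.

Lemma green_ge0 M n f eta : admissible M eta ->
  (forall e, admissible M e -> 0 <= f e) -> 0 <= green n f eta.
Proof. by move=> aeta f0; rewrite -(green0 n eta); apply: (green_le _ aeta). Qed.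

(** Dynkin's formula for [exp (- th * t) * F (eta_t)] up to the [n]-th ring, by telescoping. The
    quantitative bounds on [green] come from choices of [F]: the constant 1, the mass weighted by
    [gfun], the number of particles at a site, and [theta]. *)
Lemma green_dynkin n (F : config d -> R) eta :
  green n (fun e => (tot e + th) * F e - gen e (fun x i => F (topple e x i))) eta
  = F eta - disc n F eta.
Proof.
elim: n eta => [|n IH] eta /=; first by rewrite subrr.
have -> : gen eta (fun x i => green n (fun e => (tot e + th) * F e -
      gen e (fun x0 i0 => F (topple e x0 i0))) (topple eta x i)) =
    gen eta (fun x i => F (topple eta x i)) -
    gen eta (fun x i => disc n F (topple eta x i)).
  rewrite -mulN1r -genZ -genD; apply: eq_gen => x i _.
  by rewrite IH mulN1r.
by rewrite addrA subrK mulrBl mulrAC divff ?den_neq0// mul1r.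
Qed.

Lemma green_cst n eta : green n (fun=> 1) eta <= th^-1.
Proof.
have := green_dynkin n (fun=> 1) eta.
have -> : (fun e => (tot e + th) * 1 - gen e (fun=> fun=> 1)) = (fun=> th * 1).
  by apply/funext => e; rewrite gen_cst !mulr1 addrAC subrr add0r.
rewrite greenZ => E.
rewrite -(ler_pM2l th_gt0) E mulfV ?gt_eqF// lerBlDr lerDl.
elim: n eta {E} => //= n IH eta.
by rewrite divr_ge0 ?(ltW (den_gt0 _))// gen_ge0// => x i _.
Qed.

End Discounted.

(** Squaring the discounted sum doubles the discount rate, hence [2 * th]; the middle term pairs the
    reward of this ring with the later ones. *)
Fixpoint mom2 (th : R) (rho : config d -> site d -> instruction d -> R) (n : nat)
    eta : R :=
  if n is m.+1 then
    gen eta (fun x i => rho eta x i ^+ 2 +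
      2 * rho eta x i * mom1 th rho m (topple eta x i) +
      mom2 th rho m (topple eta x i)) / (tot eta + 2 * th)
  else 0.

Lemma gen_nsum eta u : fin_config eta ->
  gen eta (fun x i => nsum (topple eta x i) u) =
  tot eta * nsum eta u + asum eta (fun y => \sum_i pd i * u (y + dir i) - u y).
Proof.
move=> feta; rewrite -gen_cst /gen -asumD; apply: eq_asum => x ax.
rewrite mix_cst /mix nsum_topple_sleep//.
rewrite (eq_bigr (fun i => pd i * (nsum eta u - u x) + pd i * u (x + dir i))).
  by rewrite big_split/= -mulr_suml pd_sum; ring.
by move=> i _; rewrite nsum_topple_jump//; ring.
Qed.

(* Truncated subtraction: an arrival at [x] counts as [0]. *)
Definition loss x eta y (i : instruction d) : R :=
  (occ_size (eta x) - occ_size (topple eta y i x))%N%:R.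

Definition jump_reward x (k : 'I_d) eta y (i : instruction d) : R :=
  ((y == x) && (if i is Jump z then z == dir k else false))%:R.

Definition gain x eta y (i : instruction d) : R :=
  num R (topple eta y i) x - num R eta x.

Lemma occ_size_sleep a : occ_size (occ_sleep a) = occ_size a.
Proof. by case: a => [[|[|n]]|]. Qed.

Lemma occ_size_incr a : occ_size (occ_incr a) = (occ_size a).+1.
Proof. by case: a. Qed.

Lemma loss_bound x eta y i : 0 <= loss x eta y i <= 1.
Proof.
rewrite /loss ler0n /= lern1; case: i => [|z] /=; rewrite !set_siteE.
  by case: (x =P y) => [->|_]; rewrite ?occ_size_sleep subnn.
case: (x =P y) => [->|xy]; case: (_ =P _) => [E|_]; rewrite ?subnn//.
- rewrite -E eqxx occ_size_incr leq_subLR.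
  by case: (eta y) => [[|n]|] //=; rewrite addn1 ltnW.
- by case: (eta y) => [[|n]|] //=; rewrite subSn// subnn.
- case: (_ =P _) => [E'|_]; first by case: xy; rewrite E.
  by rewrite E occ_size_incr leq_subLR addn1 ltnW.
Qed.

Lemma loss_active x eta y i : 0 < loss x eta y i -> (0 < occ_active (eta x))%N.
Proof.
rewrite /loss ltr0n subn_gt0; case: i => [|z] /=; rewrite !set_siteE.
  by case: (x =P y) => [->|_]; rewrite ?occ_size_sleep ltnn.
case: (x =P y) => [->|xy]; case: (_ =P _) => [E|_]; rewrite ?ltnn//.
- by rewrite -E eqxx occ_size_incr; case: (eta y) => [[|n]|] //=; rewrite ltnn.
- by case: (eta y) => [[|n]|] //=; rewrite ltnn.
- case: (_ =P _) => [E'|_]; first by case: xy; rewrite E.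
  by rewrite E occ_size_incr ltnNge leqnSn.
Qed.

Lemma loss_sleep x eta y : loss x eta y Sleep = 0.
Proof.
rewrite /loss /= set_siteE; case: (x =P y) => [->|_]; last by rewrite subnn.
by rewrite occ_size_sleep subnn.
Qed.

Lemma loss_jump x eta y z : z != 0 -> (0 < occ_active (eta y))%N ->
  loss x eta y (Jump z) = (y == x)%:R.
Proof.
move=> z0 ay; rewrite /loss /= !set_siteE [y == x]eq_sym.
have yz : (y + z == y) = false.
  by rewrite -[X in _ == X]addr0 (inj_eq (addrI y)) (negPf z0).
case: (x =P y) => [->|xy].
  rewrite [y == _]eq_sym yz; case: (eta y) ay => [[|n]|] //= _.
  by rewrite subSn// subnn.
case: (x =P y + z) => [->|_]; last by rewrite subnn.
rewrite yz occ_size_incr.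
by rewrite (_ : (_ - _)%N = 0%N)//; apply/eqP; rewrite subn_eq0 leqnSn.
Qed.

(** A jump from [x] in direction [k] adds one particle at [x + dir k], so the left side is then 0;
    otherwise it is the negated gain. Along the rings: what arrives from [x] leaves again, up to the
    net gain. *)
Lemma loss_ge_gain x k eta y i :
  jump_reward x k eta y i - gain (x + dir k) eta y i <= loss (x + dir k) eta y i.
Proof.
have [j0|j1] := eqVneq (jump_reward x k eta y i) 0.
  rewrite j0 sub0r /gain opprB /loss /num lerBlDr -natrD ler_nat.
  by rewrite addnC -leq_subLR.
have {j1} [-> ->] : y = x /\ i = Jump (dir k).
  move: j1; rewrite /jump_reward; case: (y =P x) => [->|] /=; last by rewrite eqxx.
  by case: i => [|z]; rewrite ?eqxx//; case: (z =P dir k) => [->|]; rewrite ?eqxx.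
rewrite /jump_reward !eqxx /gain /num /= !set_siteE eqxx.
have xz : (x + dir k == x) = false.
  by rewrite -[X in _ == X]addr0 (inj_eq (addrI x)) (negPf (dir_neq0 k)).
by rewrite xz occ_size_incr -[(occ_size _).+1%:R]natr1 [X in 1 - X]addrAC subrr add0r subrr ler0n.
Qed.

Lemma gain_bound x eta y i : `|gain x eta y i| <= 2.
Proof.
rewrite /gain /num; case: i => [|z] /=; rewrite !set_siteE.
  by case: (x =P y) => [->|_]; rewrite ?occ_size_sleep subrr normr0.
have decr a : `|(occ_size (occ_decr a))%:R - (occ_size a)%:R| <= 1 :> R.
  case: a => [[|n]|] /=; rewrite ?subrr ?normr0//.
  by rewrite -natr1 opprD addrA subrr sub0r normrN normr1.
case: (x =P y + z) => [xyz|_]; last first.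
  by case: (x =P y) => [->|_]; rewrite ?subrr ?normr0// (le_trans (decr _))// ler1n.
rewrite occ_size_incr -natr1 addrAC (le_trans (ler_normD _ _))// normr1.
rewrite -[leRHS]/(1 + 1) lerD2r -xyz; case: (x =P y) => [->//|_].
by rewrite subrr normr0.
Qed.

Lemma gen_loss x eta : fin_config eta -> gen eta (loss x eta) = act R eta x.
Proof.
move=> feta; rewrite -[RHS]mulr1 -(asum_point x (fun=> 1) feta).
apply: eq_asum => y ay; rewrite /mix loss_sleep mulr0 add0r mul1r.
rewrite (eq_bigr (fun i => pd i * (y == x)%:R)); last first.
  by move=> i _; rewrite loss_jump.
by rewrite -mulr_suml pd_sum mul1r.
Qed.

Lemma gen_gain x eta : fin_config eta ->
  gen eta (gain x eta) = \sum_i pd i * act R eta (x - dir i) - act R eta x.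
Proof.
move=> feta.
transitivity (asum eta (fun y =>
    \sum_i pd i * (y == x - dir i)%:R - (y == x)%:R)); last first.
  rewrite -mulN1r; under eq_asum do rewrite -mulN1r.
  rewrite asumD asumZ; congr (_ + _); last first.
    congr (_ * _); rewrite -[RHS]mulr1 -(asum_point x (fun=> 1) feta).
    by apply: eq_asum => y _; rewrite mul1r.
  rewrite /asum; under eq_bigr do rewrite mulr_sumr.
  rewrite exchange_big /=; apply: eq_bigr => i _.
  by rewrite mulrC -(asum_point _ (fun=> pd i) feta).
apply: eq_asum => y ay; rewrite /mix /gain num_topple_sleep subrr mulr0 add0r.
transitivity (\sum_i (pd i * (y == x - dir i)%:R - pd i * (y == x)%:R)).
  apply: eq_bigr => i _; rewrite num_topple_jump// -mulrBr; congr (_ * _).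
  by rewrite [x == y]eq_sym -(subr_eq x) [_ == y]eq_sym; ring.
by rewrite sumrB -mulr_suml pd_sum mul1r.
Qed.

Hypothesis dir_inj : injective dir.

Lemma gen_jump_reward x k eta : fin_config eta ->
  gen eta (jump_reward x k eta) = pd k * act R eta x.
Proof.
move=> feta; rewrite mulrC -(asum_point x (fun=> pd k) feta).
apply: eq_asum => y ay; rewrite /mix /jump_reward andbF mulr0 add0r.
rewrite (bigD1 k)//= eqxx andbT big1 ?addr0// => i ik.
by rewrite (inj_eq dir_inj) (negPf ik) andbF mulr0.
Qed.

(** * Green function of the directed walk *)

Variable h : site d -> int.
Hypothesis h_dir : forall y i, h (y + dir i) = h y + 1.

Fixpoint hit x (n : nat) y : R :=
  if n is m.+1 then \sum_i pd i * hit x m (y + dir i) else (y == x)%:R.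

Lemma hit_ge0 x n y : 0 <= hit x n y.
Proof.
elim: n y => [|n IH] y /=; first exact: ler0n.
by apply: sumr_ge0 => i _; rewrite mulr_ge0.
Qed.

(** A jump translates the starting points and keeps them distinct: counting measure is invariant for
    the walk. *)
Lemma sum_hit_le1 x n (S : seq (site d)) : uniq S -> \sum_(y <- S) hit x n y <= 1.
Proof.
elim: n S => [|n IH] S uS /=.
  have [xS|xS] := boolP (x \in S).
    rewrite (bigD1_seq x)//= eqxx big1 ?addr0// => y /negPf->//.
  rewrite big_seq big1 ?ler01// => y yS.
  by case: eqP => // yx; rewrite -yx yS in xS.
rewrite exchange_big /= -pd_sum; apply: ler_sum => i _.
rewrite -mulr_sumr -[leRHS]mulr1 ler_wpM2l//.
rewrite -(big_map (fun y => y + dir i) predT (hit x n)).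
by apply: IH; rewrite map_inj_uniq//; apply: addIr.
Qed.

Lemma hit_le1 x n y : hit x n y <= 1.
Proof. by have := @sum_hit_le1 x n [:: y] isT; rewrite big_seq1. Qed.

Section GreenFunction.
Variables (th : R) (x : site d).
Hypothesis th_gt0 : 0 < th.

Let r := (1 + th)^-1.

Let th1_gt0 : 0 < 1 + th. Proof. by rewrite addr_gt0. Qed.
Let r_gt0 : 0 < r. Proof. by rewrite invr_gt0. Qed.
Let r_le1 : r <= 1. Proof. by rewrite invf_le1// lerDl ltW. Qed.
Let th1r : (1 + th) * r = 1. Proof. by rewrite mulfV// gt_eqF. Qed.

(* Discounted probability that a particle started from [y] jumps from [x]: all
   paths from [y] to [x] have the same number [h x - h y] of jumps. *)
Definition gfun y : R :=
  if h y <= h x then r ^+ (`|h x - h y|).+1 * hit x `|h x - h y| y else 0.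

Lemma gfun_ge0 y : 0 <= gfun y.
Proof.
rewrite /gfun; case: ifP => // _.
by rewrite mulr_ge0 ?hit_ge0// exprn_ge0// ltW.
Qed.

Lemma gfun_le1 y : gfun y <= 1.
Proof.
rewrite /gfun; case: ifP => [_|_]; last exact: ler01.
by rewrite -(mulr1 1) ler_pM ?hit_ge0 ?hit_le1 ?exprn_ge0 ?exprn_ile1 ?(ltW r_gt0).
Qed.

(** One-step equation of a walker jumping at rate 1 and killed at rate [th]. Each jump, the one from
    [x] included, costs a factor [r], whence the exponent [.+1] in [gfun]; the test on heights
    discards the sites from which [x] is never reached. *)
Lemma gfunE y : (1 + th) * gfun y = \sum_i pd i * gfun (y + dir i) + (y == x)%:R.
Proof.
rewrite /gfun; under eq_bigr do rewrite h_dir.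
have [hxy|hyx|hE] := ltrgtP (h x) (h y).
- have -> : y == x = false by apply/eqP => E; rewrite E ltxx in hxy.
  rewrite mulr0 big1 ?addr0// => i _.
  by rewrite leNgt (lt_trans hxy) ?mulr0// ltrDl.
- have -> : y == x = false by apply/eqP => E; rewrite E ltxx in hyx.
  have le1 : h y + 1 <= h x by rewrite lezD1.
  rewrite le1 addr0.
  have [k kE] : exists k : nat, h x - (h y + 1) = k.
    by exists `|(h x - (h y + 1))%R|%N; rewrite gez0_abs// subr_ge0.
  have kE' : h x - h y = k.+1.
    by rewrite -addn1 PoszD -kE opprD addrA subrK.
  rewrite kE kE' /= [r ^+ k.+2]exprS -[r * _ * _]mulrA [LHS]mulrA th1r mul1r mulr_sumr.
  by apply: eq_bigr => i _; rewrite mulrCA.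
- rewrite hE subrr /= expr1 mulrA th1r mul1r big1 ?add0r// => i _.
  by rewrite leNgt ltrDl ltr01 mulr0.
Qed.

Lemma gfun_diag : (1 + th) * gfun x = 1.
Proof.
rewrite gfunE eqxx big1 ?add0r// => i _.
by rewrite /gfun h_dir leNgt ltrDl ltr01 mulr0.
Qed.

Lemma gfun_next i : gfun (x + dir i) = 0.
Proof. by rewrite /gfun h_dir leNgt ltrDl ltr01. Qed.

(** Each number [k] of jumps carries total hitting probability at most 1, and the series of
    [r ^+ k.+1] sums to [1 / th]. *)
Lemma sum_gfun_le (S : seq (site d)) : uniq S -> \sum_(y <- S) gfun y <= th^-1.
Proof.
move=> uS; pose K := (\max_(y <- S) `|(h x - h y)%R|%N).+1.
apply: (@le_trans _ _ (\sum_(y <- S) \sum_(k < K) r ^+ k.+1 * hit x k y)).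
  rewrite big_seq [leRHS]big_seq; apply: ler_sum => y yS; rewrite /gfun.
  have pos k : 0 <= r ^+ k.+1 * hit x k y.
    by rewrite mulr_ge0 ?hit_ge0 ?exprn_ge0// ltW.
  case: ifP => _; last by apply: sumr_ge0.
  have kK : (`|(h x - h y)%R|%N < K)%N.
    by rewrite ltnS (@leq_bigmax_seq _ S xpredT (fun z => `|(h x - h z)%R|%N)).
  rewrite (bigD1 (Ordinal kK))//= lerDl; exact: sumr_ge0.
rewrite exchange_big /=; apply: (@le_trans _ _ (\sum_(k < K) r ^+ k.+1)).
  apply: ler_sum => k _; rewrite -mulr_sumr -[leRHS]mulr1 ler_wpM2l//.
    by rewrite exprn_ge0 ?ltW.
  exact: sum_hit_le1.
rewrite -(ler_pM2l th_gt0) mulfV ?gt_eqF//.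
have -> : th * \sum_(k < K) r ^+ k.+1 = 1 - r ^+ K.
  have thr : th * r = 1 - r by rewrite -[X in X - r]th1r mulrDl mul1r addrAC subrr add0r.
  rewrite mulr_sumr -(big_mkord xpredT (fun k => th * r ^+ k.+1)).
  elim: K => [|K IH]; first by rewrite big_geq// expr0 subrr.
  rewrite big_nat_recr//= IH exprS mulrA thr; ring.
by rewrite lerBlDr lerDl exprn_ge0// ltW.
Qed.

Lemma gen_nsum_gfun eta : fin_config eta ->
  gen eta (fun y i => nsum (topple eta y i) gfun) =
  tot eta * nsum eta gfun + th * asum eta gfun - act R eta x.
Proof.
move=> feta; rewrite gen_nsum// -addrA; congr (_ + _).
have -> : - act R eta x = (-1) * (act R eta x * 1) by rewrite mulr1 mulN1r.
rewrite -(asum_point x (fun=> 1) feta) -!asumZ -asumD; apply: eq_asum => y _.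
rewrite (_ : \sum_i _ = (1 + th) * gfun y - (y == x)%:R); first by ring.
by rewrite gfunE addrK.
Qed.

(** Dynkin's formula for the mass weighted by [gfun]. Active particles contribute exactly the
    activity at [x], sleeping ones the nonnegative term [th * gfun], the discount lost while they
    wait. *)
Lemma green_act_le M n eta : admissible M eta ->
  green th n (fun e => act R e x) eta <= nsum eta gfun.
Proof.
move=> aeta.
have := green_dynkin th_gt0 n (fun e => nsum e gfun) eta.
set f := fun e => _ - _ => dE.
apply: (@le_trans _ _ (green th n f eta)).
  apply: (green_le th_gt0 n aeta) => e [fe _]; rewrite /f gen_nsum_gfun//.
  rewrite [leRHS](_ : _ = th * (nsum e gfun - asum e gfun) + act R e x).
    by rewrite lerDr mulr_ge0 ?(ltW th_gt0)// subr_ge0 asum_le_nsum// => y; apply: gfun_ge0.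
  by ring.
rewrite dE lerBlDr lerDl.
elim: n {aeta f dE} eta => [|n IH] eta /=; first exact/nsum_ge0/gfun_ge0.
by rewrite divr_ge0 ?(ltW (den_gt0 _ _))// gen_ge0.
Qed.

Lemma mom1_loss_le M n eta : admissible M eta ->
  mom1 th (loss x) n eta <= nsum eta gfun.
Proof.
move=> aeta; rewrite mom1E (eq_green th_gt0 (g := fun e => act R e x) n aeta).
  exact: green_act_le aeta.
by move=> e [fe _]; rewrite gen_loss.
Qed.

(* [nsum eta (gfun * (1 - gfun))] bounds the variance of the discounted number
   of jumps from [x] of independent walkers that are never asleep. *)
Lemma mom2_loss_le M n eta : admissible M eta ->
  mom2 th (loss x) n eta <=
  nsum eta gfun ^+ 2 + nsum eta (fun y => gfun y * (1 - gfun y)).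
Proof.
set w := fun y => gfun y * (1 - gfun y).
have w0 y : 0 <= w y by rewrite mulr_ge0 ?gfun_ge0 ?subr_ge0 ?gfun_le1.
elim: n eta => [|n IH] eta aeta /=.
  by rewrite addr_ge0 ?sqr_ge0 ?nsum_ge0.
have den : 0 < tot eta + 2 * th by rewrite ltr_wpDl ?tot_ge0 ?mulr_gt0.
rewrite ler_pdivrMr//.
set U := nsum eta gfun; set W := nsum eta w.
(* The claimed bound is a supersolution of the recursion: [G] dominates the integrand, by
   [mom1_loss_le] for the cross term and by induction for the last one. *)
pose G y i := (loss x eta y i + nsum (topple eta y i) gfun) ^+ 2 +
  nsum (topple eta y i) w.
apply: (@le_trans _ _ (gen eta G)).
  apply: ler_gen => y i ok; rewrite /G sqrrD -!addrA lerD2l.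
  have ao := admissible_topple aeta ok.
  have /andP[l0 _] := loss_bound x eta y i.
  rewrite addrA lerD ?IH// -[leRHS]mulr2n -[leRHS]mulr_natl -!mulrA.
  by rewrite ler_wpM2l// ler_wpM2l// (mom1_loss_le _ ao).
have feta := aeta.1.
have -> : gen eta G =
    tot eta * (U ^+ 2 + W) + asum eta (fun y => th * (2 * U * gfun y +
      gfun y - 2 * gfun y ^+ 2)).
  rewrite -gen_cst -asumD; apply: eq_asum => y ay.
  rewrite mix_cst /mix /G loss_sleep add0r !nsum_topple_sleep// -/U -/W.
  (* Change of the loss plus [nsum gfun] when a particle at [y] jumps in direction [i]; by [gfunE]
     its mean is [th * gfun y]. *)
  pose D i := (y == x)%:R + gfun (y + dir i) - gfun y.
  have -> : \sum_i pd i * ((loss x eta y (Jump (dir i)) +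
      nsum (topple eta y (Jump (dir i))) gfun) ^+ 2 +
      nsum (topple eta y (Jump (dir i))) w) =
      \sum_i (pd i * (U ^+ 2 + W) + 2 * U * (pd i * D i) +
        pd i * (D i ^+ 2 + w (y + dir i) - w y)).
    apply: eq_bigr => i _; rewrite loss_jump// !nsum_topple_jump// -/U -/W /D.
    by ring.
  rewrite !big_split /= -mulr_suml pd_sum -mulr_sumr.
  have D1 : \sum_i pd i * D i = th * gfun y.
    have -> : \sum_i pd i * D i = \sum_i pd i * gfun (y + dir i) +
        (\sum_i pd i) * ((y == x)%:R - gfun y).
      rewrite mulr_suml -big_split /=; apply: eq_bigr => i _; rewrite /D; ring.
    by rewrite pd_sum mul1r addrA -gfunE; ring.
  rewrite D1.
  have -> : \sum_i pd i * (D i ^+ 2 + w (y + dir i) - w y) =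
      th * (gfun y - 2 * gfun y ^+ 2).
    have [yx|yx] := eqVneq y x.
      have t : th * gfun x = 1 - gfun x.
        by rewrite -gfun_diag mulrDl mul1r addrAC subrr add0r.
      rewrite [LHS](_ : _ = (\sum_i pd i) * ((1 - gfun x) ^+ 2 - w x)).
        rewrite pd_sum mul1r yx /w.
        have -> : th * (gfun x - 2 * gfun x ^+ 2) = th * gfun x * (1 - 2 * gfun x).
          by ring.
        by rewrite t; ring.
      rewrite mulr_suml; apply: eq_bigr => i _; rewrite /D /w yx eqxx gfun_next.
      by rewrite mulr1n; ring.
    have E : \sum_i pd i * gfun (y + dir i) = (1 + th) * gfun y.
      by rewrite gfunE (negPf yx) addr0.
    rewrite [LHS](_ : _ = (1 - 2 * gfun y) * (\sum_i pd i * gfun (y + dir i)) +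
      (\sum_i pd i) * (gfun y ^+ 2 - w y)).
      by rewrite E pd_sum /w; ring.
    rewrite mulr_sumr mulr_suml -big_split /=; apply: eq_bigr => i _.
    by rewrite /D /w (negPf yx) mulr0n; ring.
  by ring.
rewrite mulrC -subr_ge0.
rewrite [leRHS](_ : _ = 2 * th * (U ^+ 2 + W) -
  th * asum eta (fun y => 2 * U * gfun y + gfun y - 2 * gfun y ^+ 2)); last first.
  by rewrite asumZ; ring.
rewrite subr_ge0 [2 * th]mulrC -mulrA ler_wpM2l ?(ltW th_gt0)//.
(* Adding [gfun] to [gfun - 2 * gfun ^+ 2] gives [2 * w]; sums over active particles are then
   bounded by sums over all particles. *)
apply: (@le_trans _ _ (asum eta (fun y => 2 * U * gfun y + 2 * w y))).
  apply: ler_asum => y _; rewrite -subr_ge0 [leRHS](_ : _ = gfun y) ?gfun_ge0//.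
  by rewrite /w; ring.
rewrite asumD !asumZ mulrDr lerD//; last first.
  by rewrite ler_wpM2l// asum_le_nsum.
rewrite -mulrA ler_wpM2l// expr2 ler_wpM2l ?nsum_ge0// ?asum_le_nsum//.
- exact: gfun_ge0.
- exact: gfun_ge0.
Qed.

End GreenFunction.

Lemma pd_le1 k : pd k <= 1.
Proof. by rewrite -pd_sum (bigD1 k)//= lerDl sumr_ge0. Qed.

Definition jump_dev x k eta y (i : instruction d) : R :=
  jump_reward x k eta y i - pd k * loss x eta y i.

Lemma mom1_jump_dev (th : R) x k M n eta : 0 < th -> admissible M eta ->
  mom1 th (jump_dev x k) n eta = 0.
Proof.
move=> th0 aeta; rewrite mom1E -[RHS](green0 th n eta).
apply: (eq_green th0 n aeta) => e [fe _]; rewrite /jump_dev.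
under [X in gen e X]eq_fun do under eq_fun do rewrite -mulNr.
by rewrite genD genZ gen_loss// gen_jump_reward// mulNr subrr.
Qed.

(** The deviations are centred, so the cross terms vanish; a square is at most 1 and nonzero only at
    a jump from [x]; and replacing the discount rate [2 * th] by [th] increases the sum. *)
Lemma mom2_jump_dev_le (th : R) x k M n eta : 0 < th -> admissible M eta ->
  mom2 th (jump_dev x k) n eta <= mom1 th (loss x) n eta.
Proof.
move=> th0; elim: n eta => //= n IH eta aeta.
set f := fun y i => _ + _ + _; set g := fun y i => _ + _.
have fg : gen eta f <= gen eta g.
  apply: ler_gen => y i ok; rewrite /f /g.
  have ao := admissible_topple aeta ok.
  rewrite (mom1_jump_dev _ _ _ th0 ao) mulr0 addr0 lerD ?IH//.
  rewrite /jump_dev; case: ok => ay [->|[j ->]].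
    by rewrite /jump_reward andbF loss_sleep mulr0 subr0 expr0n.
  rewrite loss_jump// /jump_reward; case: (y == x) => /=; last first.
    by rewrite mulr0 subr0 expr0n.
  rewrite mulr1 -real_normK ?num_real// exprn_ile1// ler_norml.
  have := pd_le1 k; have := pd_ge0 k; case: (_ == _) => /= p0 p1; lra.
have g0 : 0 <= gen eta g.
  rewrite gen_ge0// => y i ok; rewrite addr_ge0// mom1E.
  by rewrite (green_ge0 th0 n (admissible_topple aeta ok))// => e ae; rewrite gen_ge0.
have t0 := tot_ge0 eta.
apply: (@le_trans _ _ (gen eta g / (tot eta + 2 * th))).
  by rewrite ler_wpM2r// invr_ge0 addr_ge0// mulr_ge0// ltW.
rewrite ler_wpM2l// lef_pV2 ?posrE ?ltr_wpDl ?mulr_gt0//.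
by rewrite lerD2l mulr_natl mulr2n lerDl ltW.
Qed.

(** * Discounted time spent asleep at a site *)

Section Sleeping.
Variables (th : R) (x : site d).
Hypothesis th_gt0 : 0 < th.

(** Jumps raise [h] by one, so the sites strictly below [x] evolve autonomously; the time of the
    next arrival at [x] is a function of this part alone. *)
Definition up eta : config d := restrict_to [set y | h y < h x] eta.

Lemma upE eta y : up eta y = if h y < h x then eta y else Act 0.
Proof. by rewrite /up /restrict_to; congr (if _ then _ else _); rewrite mem_setE. Qed.

Lemma up_up eta : up (up eta) = up eta.
Proof. by apply/funext => y; rewrite !upE; case: (_ < _). Qed.

Definition avoids y (i : instruction d) : R :=
  (~~ (if i is Jump z then y + z == x else false))%:R.

(* [psi n eta] increases with [n] to [Psi eta], the expectation of
   [\int exp (- th * t) dt] up to the first time a particle enters [x]. *)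
Fixpoint psi (n : nat) eta : R :=
  if n is m.+1 then
    (1 + gen (up eta) (fun y i => avoids y i * psi m (topple (up eta) y i))) /
      (tot (up eta) + th)
  else 0.

Definition Psi eta : R := limn (psi ^~ eta).

Lemma psi_up n eta : psi n (up eta) = psi n eta.
Proof. by case: n => //= n; rewrite up_up. Qed.

Lemma Psi_up eta : Psi (up eta) = Psi eta.
Proof. by congr (lim (_ @ \oo)); apply/funext => n; rewrite psi_up. Qed.

Lemma avoids_bound y i : 0 <= avoids y i <= 1.
Proof. by rewrite /avoids; case: (~~ _); rewrite /= ?lexx ?ler01. Qed.

Lemma psi_bound n eta : 0 <= psi n eta <= th^-1.
Proof.
elim: n eta => [|n IH] eta /=; first by rewrite lexx invr_ge0 ltW.
have d0 := den_gt0 th_gt0 (up eta).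
have t0 y i : 0 <= avoids y i * psi n (topple (up eta) y i) <= th^-1.
  have /andP[a0 a1] := avoids_bound y i.
  have /andP[p0 p1] := IH (topple (up eta) y i).
  by rewrite mulr_ge0//= -[leRHS]mul1r ler_pM.
apply/andP; split.
  rewrite divr_ge0 ?(ltW d0)// addr_ge0// gen_ge0// => y i _.
  by have /andP[] := t0 y i.
rewrite ler_pdivrMr// mulrDr mulVf ?gt_eqF// addrC lerD2r.
rewrite mulrC -gen_cst ler_gen// => y i _; by have /andP[] := t0 y i.
Qed.

Lemma psi_nondecreasing eta : nondecreasing_seq (psi ^~ eta).
Proof.
apply/nondecreasing_seqP => n; elim: n eta => [|n IH] eta.
  by have /andP[] := psi_bound 1 eta.
rewrite /= ler_wpM2r ?invr_ge0 ?(ltW (den_gt0 th_gt0 _))// lerD2l.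
by apply: ler_gen => y i _; rewrite ler_wpM2l.
Qed.

Lemma psi_is_cvg eta : cvgn (psi ^~ eta).
Proof.
apply: nondecreasing_is_cvgn; first exact: psi_nondecreasing.
by exists th^-1 => _ [n _ <-]; have /andP[] := psi_bound n eta.
Qed.

Lemma Psi_bound eta : 0 <= Psi eta <= th^-1.
Proof.
apply/andP; split.
  apply: limr_ge; first exact: psi_is_cvg.
  by apply: nearW => n; have /andP[] := psi_bound n eta.
apply: limr_le; first exact: psi_is_cvg.
by apply: nearW => n; have /andP[] := psi_bound n eta.
Qed.

Lemma cvg_gen eta (f : nat -> site d -> instruction d -> R)
    (g : site d -> instruction d -> R) :
  (forall y i, f n y i @[n --> \oo] --> g y i) ->
  gen eta (f n) @[n --> \oo] --> gen eta g.
Proof.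
move=> fg; rewrite /gen /asum; apply: cvg_big => [|y _]; first exact: add_continuous.
apply: cvgM; first exact: cvg_cst.
apply: cvgD; first by apply: cvgM; [exact: cvg_cst|exact: fg].
apply: cvg_big => [|i _]; first exact: add_continuous.
by apply: cvgM; [exact: cvg_cst|exact: fg].
Qed.

(** A truncation [psi n] satisfies this equation only with a shift of [n]; [theta] needs an exact
    solution that is a function of the configuration alone, hence the passage to the limit. *)
Lemma PsiE eta : (tot (up eta) + th) * Psi eta =
  1 + gen (up eta) (fun y i => avoids y i * Psi (topple (up eta) y i)).
Proof.
set g := gen _ _; set D := _ + th.
have D0 : D != 0 by rewrite gt_eqF// den_gt0.
suff : Psi eta = (1 + g) / D by move=> ->; rewrite mulrC divfK.
have e1 : psi n.+1 eta @[n --> \oo] --> Psi eta.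
  by rewrite (@cvg_shiftS _ (psi ^~ eta)); apply: psi_is_cvg.
have e2 : psi n.+1 eta @[n --> \oo] --> (1 + g) / D.
  apply: cvgM; last exact: cvg_cst.
  apply: cvgD; first exact: cvg_cst.
  apply: cvg_gen => y i; apply: cvgM; first exact: cvg_cst.
  exact: psi_is_cvg.
by rewrite -(cvg_lim _ e1)// -(cvg_lim _ e2).
Qed.

(** The weights make the outcome of a lone active particle at [x] centred: it falls asleep at rate
    [lam], with value [- 1], and leaves at rate 1, with value [lam]. *)
Definition phi eta : R := lam * (eta x == Act 0)%:R - slp R eta x.

Lemma up_topple_lt eta y i : h y < h x ->
  up (topple (up eta) y i) = up (topple eta y i).
Proof.
move=> hy; apply/funext => w; rewrite !upE; case: ifP => // hw.
case: i => [|z] /=; rewrite !set_siteE !upE hy ?hw//.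
by case: (w =P y + z) => // <-; rewrite hw.
Qed.

Lemma up_topple_ge eta y i : fair_instr i -> h x <= h y ->
  up (topple eta y i) = up eta.
Proof.
move=> fi hy; apply/funext => w; rewrite !upE; case: ifP => // hw.
have wy : w == y = false by apply/eqP => E; rewrite E ltNge hy in hw.
case: fi => [->|[k ->]] /=; rewrite !set_siteE wy//.
case: (w =P _) => // E; move: hw; rewrite E h_dir ltNge (le_trans hy)// lerDl.
by [].
Qed.

Lemma gen_up eta f : fin_config eta ->
  gen eta f = gen (up eta) f + asum eta (fun y => (h x <= h y)%R%:R * mix (f y)).
Proof.
move=> feta; pose S := fset_set (supp eta) : seq (site d).
have sS y : eta y != Act 0 -> y \in S.
  by move=> ey; rewrite in_fset_set// mem_set.
have fup : fin_config (up eta).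
  apply: sub_finite_set feta => y; rewrite /supp /= upE; case: ifP => //.
  by rewrite eqxx.
have sS' y : up eta y != Act 0 -> y \in S.
  by rewrite upE; case: ifP => [_ /sS//|]; rewrite eqxx.
rewrite /gen (asumE _ feta (fset_uniq _) sS) (asumE _ fup (fset_uniq _) sS').
rewrite (asumE _ feta (fset_uniq _) sS) -big_split /=; apply: eq_bigr => y _.
rewrite /act upE leNgt; case: (h y < h x) => /=.
  by rewrite mul0r mulr0 addr0.
by rewrite mul0r add0r mul1r.
Qed.

(** If no particle at [x] is active, [phi] stays constant until the next arrival, and this is its
    expected discounted integral up to then; if some particle is active, both [phi] and [theta]
    vanish. *)
Definition theta eta : R := phi eta * Psi eta.

Lemma slp_act eta y : (0 < occ_active (eta y))%N -> slp R eta y = 0.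
Proof. by rewrite /slp; case: eqP => // ->. Qed.

(* Given the history of the sites upstream of [x], the last particle at [x]
   sleeps or jumps with odds [lam : 1], and nothing changes until the next
   arrival. *)
Lemma gen_theta eta : fin_config eta ->
  (tot eta + th) * theta eta - gen eta (fun y i => theta (topple eta y i))
  = phi eta.
Proof.
move=> feta; have [ax|ax] := posnP (occ_active (eta x)); last first.
  have phi0 e : (0 < occ_active (e x))%N -> phi e = 0.
    move=> a; rewrite /phi slp_act// subr0; case: (e x =P Act 0) => [E|_].
      by rewrite E in a.
    by rewrite mulr0.
  rewrite {1}/theta (phi0 _ ax) mul0r mulr0 sub0r.
  suff -> : gen eta (fun y i => theta (topple eta y i)) = 0 by rewrite oppr0.
  rewrite /gen -(mulr0 (asum eta (fun=> 1))) mulrC -asumZ.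
  apply: eq_asum => y ay; rewrite mul0r.
  have [yx|yx] := eqVneq x y; last first.
    rewrite -[RHS](mulr0 (1 + lam)) -mix_cst; apply: eq_mix => i fi.
    rewrite /theta phi0 ?mul0r//; case: i {fi} => [|z] /=; rewrite !set_siteE.
      by rewrite (negPf yx).
    rewrite (negPf yx); case: (x =P y + z) => [E|//].
    by rewrite -E (negPf yx); case: (eta x).
  rewrite -yx; have Pt i : fair_instr i -> Psi (topple eta x i) = Psi eta.
    by move=> fi; rewrite -Psi_up up_topple_ge// Psi_up.
  have xk k : x == x + dir k = false.
    by rewrite -[X in X == _]addr0 (inj_eq (addrI x)) eq_sym (negPf (dir_neq0 k)).
  (* Only a lone active particle can make [phi] nonzero: asleep it yields [- Psi] with weight [lam],
     gone it yields [lam * Psi] with weight 1, and these cancel. *)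
  case E : (eta x) ax => [[|[|n]]|] // _.
    rewrite /mix /theta Pt; last by left.
    rewrite (eq_bigr (fun i => pd i * (lam * Psi eta))); last first.
      move=> i _; rewrite Pt; last by right; exists i.
      rewrite /phi /slp /= !set_siteE xk eqxx E /= eqxx; case: eqP => // _.
      by rewrite mulr1 subr0.
    rewrite -mulr_suml pd_sum /phi /slp /= set_siteE eqxx E /= eqxx.
    by case: eqP => // _; rewrite mulr0n mulr1n; ring.
  rewrite -[RHS](mulr0 (1 + lam)) -mix_cst; apply: eq_mix => i fi.
  rewrite /theta phi0 ?mul0r//; case: fi => [->|[k ->]] /=.
    by rewrite set_siteE eqxx E.
  by rewrite !set_siteE xk eqxx E.
(* No active particle at [x]: an upstream ring either brings a particle to [x], which makes [phi]
   vanish, or acts on [Psi] alone; a ring at the height of [x] or above changes neither factor. *)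
have -> : gen eta (fun y i => theta (topple eta y i)) =
    phi eta * (gen (up eta) (fun y i => avoids y i * Psi (topple (up eta) y i)) +
      (tot eta - tot (up eta)) * Psi eta).
  rewrite gen_up// mulrDr -genZ; congr (_ + _).
    apply: eq_gen => y i [ay fi].
    have {ay} hy : h y < h x by move: ay; rewrite upE; case: ifP.
    rewrite /theta mulrA; congr (_ * _); last first.
      by rewrite -Psi_up -up_topple_lt// Psi_up.
    have yx : x == y = false by apply/eqP => E; rewrite E ltxx in hy.
    rewrite /phi /slp /avoids; case: i fi => [|z] _ /=; rewrite !set_siteE yx.
      by rewrite mulr1.
    rewrite [x == _]eq_sym; case: (y + z =P x) => [E|_] /=; last by rewrite mulr1.
    rewrite E yx mulr0; case: (eta x) => [n|] /=.
      by case: eqP => // _; case: eqP => // _; rewrite mulr0 subr0.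
    by case: eqP => // _; case: eqP => // _; rewrite mulr0 subr0.
  have -> : tot eta - tot (up eta) = asum eta (fun y => (h x <= h y)%R%:R * (1 + lam)).
    rewrite -[tot eta]mulr1 -[tot (up eta)]mulr1 -!gen_cst gen_up// addrAC subrr.
    rewrite add0r; apply: eq_asum => y _.
    by rewrite mix_cst mulr1.
  rewrite mulrCA mulrC [phi eta * _]mulrC -asumZ; apply: eq_asum => y ay.
  have [hxy|] := boolP (h x <= h y); last by rewrite !mul0r mulr0.
  have yx : x == y = false by apply/eqP => E; rewrite -E ax in ay.
  rewrite !mul1r [RHS]mulrC -mix_cst.
  apply: eq_mix => i fi; rewrite /theta mulrC; congr (_ * _); last first.
    by rewrite -Psi_up up_topple_ge// Psi_up.
  rewrite /phi /slp; case: fi => [->|[k ->]] /=; rewrite !set_siteE yx//.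
  case: (x =P _) => // E; move: hxy; rewrite E h_dir gerDl.
  by [].
have := PsiE eta; set g := gen _ _ => /(congr1 (fun t => t - 1)).
rewrite addrAC subrr add0r => <-.
by rewrite /theta; ring.
Qed.

Lemma phi_bound eta : `|phi eta| <= 1 + lam.
Proof.
rewrite /phi /slp; case: eqP => [->|_].
  by case: eqP => // _; rewrite mulr1 subr0 ger0_norm// lerDr.
rewrite mulr0 sub0r normrN ger0_norm ?ler0n//.
by case: (_ == _); rewrite /= ?lerDl// addr_ge0.
Qed.

Lemma theta_bound eta : `|theta eta| <= (1 + lam) / th.
Proof.
rewrite normrM ler_pM ?phi_bound//.
by have /andP[P0 P1] := Psi_bound eta; rewrite ger0_norm.
Qed.

(** Let [a] and [s] be the discounted times at which [x] is empty and asleep. Dynkin's formula for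
    [theta], nonnegative initially because no particle sleeps at [x], gives [s <= lam * a] up to the
    truncation error; combine with [a + s <= 1 / th]. *)
Lemma green_slp_le (M : R) n eta : admissible M eta -> slp R eta x = 0 ->
  th * green th n (fun e => slp R e x) eta <=
  lam / (1 + lam) + ((1 + lam) * M / ((1 + lam) * M + th)) ^+ n.
Proof.
move=> aeta sx; set kap := _ ^+ n.
have lam1 : 0 < 1 + lam by rewrite addr_gt0.
have D := green_dynkin th_gt0 n theta eta.
have {}D : green th n phi eta = theta eta - disc th n theta eta.
  by rewrite -D; apply: (eq_green th_gt0 n aeta) => e [fe _]; rewrite gen_theta.
have th0 : 0 <= theta eta.
  rewrite mulr_ge0//; last by have /andP[] := Psi_bound eta.
  by rewrite /phi sx subr0 mulr_ge0.
have dB : `|disc th n theta eta| <= (1 + lam) / th * kap.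
  apply: (disc_bound th_gt0 n aeta) => [|e _]; last exact: theta_bound.
  by rewrite divr_ge0// ltW.
have c1 := green_cst th_gt0 n eta.
pose e0 e : R := (e x == Act 0)%:R.
have c2 : green th n e0 eta + green th n (fun e => slp R e x) eta <= th^-1.
  apply: le_trans c1; rewrite -greenD; apply: (green_le th_gt0 n aeta) => e _.
  rewrite /e0 /slp; case: eqP => [->|_].
    by case: eqP => // _; rewrite addr0.
  by rewrite add0r; case: (_ == _).
have Ephi : green th n phi eta =
    lam * green th n e0 eta - green th n (fun e => slp R e x) eta.
  by rewrite -greenZ -greenN -greenD.
set s := green th n (fun e => slp R e x) eta in c2 Ephi *.
set a := green th n e0 eta in c2 Ephi *.
have {dB D Ephi th0} : - ((1 + lam) / th * kap) <= lam * a - s.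
  rewrite -Ephi D; move: dB; rewrite ler_norml => /andP[_ d1].
  by rewrite -sub0r lerB.
move=> H; have H2 : lam * (a + s) <= lam / th by rewrite ler_wpM2l.
have H3 : (1 + lam) * s <= lam / th + (1 + lam) / th * kap by lra.
rewrite -(ler_pM2l lam1) mulrCA.
apply: (le_trans (ler_wpM2l (ltW th_gt0) H3)).
rewrite !mulrDr !mulrA; have -> : th * lam / th = lam by field; rewrite gt_eqF.
have -> : th * (1 + lam) / th = 1 + lam by field; rewrite gt_eqF.
by have -> : (1 + lam) * lam / (1 + lam) = lam by field; rewrite gt_eqF.
Qed.

End Sleeping.

(** * Mass balance and the lower bound on activity *)

Lemma green_mass th x (M : R) n eta : 0 < th -> admissible M eta ->
  (1 + th) * green th n (fun e => act R e x) eta =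
  num R eta x - disc th n (fun e => num R e x) eta -
  th * green th n (fun e => slp R e x) eta +
  \sum_i pd i * green th n (fun e => act R e (x - dir i)) eta.
Proof.
move=> th0 aeta; have := green_dynkin th0 n (fun e => num R e x) eta.
rewrite (eq_green th0 (g := fun e => (1 + th) * act R e x +
    (th * slp R e x + - \sum_i pd i * act R e (x - dir i))) n aeta); last first.
  move=> e [fe _].
  have -> : gen e (fun y i => num R (topple e y i) x) =
      tot e * num R e x + gen e (gain x e).
    by rewrite -gen_cst -genD; apply: eq_gen => y i _; rewrite /gain addrC subrK.
  rewrite gen_gain// num_split; ring.
rewrite !greenD !greenZ greenN green_sum => H.
under eq_bigr do rewrite -greenZ.
rewrite -H; ring.
Qed.

(** The sites from which [x] is reached in fewer than [l] jumps: [l] upstream iterations of the mass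
    balance have to stay inside [V]. *)
Fixpoint ancestors (l : nat) x : set (site d) :=
  if l is l'.+1 then x |` \bigcup_(i in setT) ancestors l' (x - dir i) else set0.

Lemma finite_ancestors l x : finite_set (ancestors l x).
Proof.
elim: l x => [|l IH] x /=; first exact: finite_set0.
rewrite finite_setU; split; first exact: finite_set1.
by apply: bigcup_finite => // i _; apply: IH.
Qed.

(** With [c] half of the excess mass, the other half absorbing the truncation errors, the mass
    balance summed over [j] reads [(1 + th) * S x >= c + \sum_i pd i * S (x - dir i)]. Its constant
    solution is [c / th]; [l] iterations from the trivial bound 0 reach it up to the factor
    [1 - (1 + th)^-1 ^+ l]. *)
Lemma sum_green_act_ge (th : R) (m : nat) (xi : 'I_m -> config d)
    (V : set (site d)) (M k : R) n :
  0 < th -> 0 <= M -> (forall j, admissible M (xi j)) ->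
  (forall j x, slp R (xi j) x = 0) ->
  (forall x, V x -> \sum_j num R (xi j) x = k) ->
  m%:R * ((M + 1) * ((1 + lam) * M / ((1 + lam) * M + th)) ^+ n) <=
    (k - m%:R * (lam / (1 + lam))) / 2 ->
  forall l x, ancestors l x `<=` V ->
  (k - m%:R * (lam / (1 + lam))) / 2 / th * (1 - (1 + th)^-1 ^+ l) <=
  \sum_j green th n (fun e => act R e x) (xi j).
Proof.
move=> th0 M0 axi sxi Vk; set kap := _ ^+ n; set c := _ / 2 => small.
have kap0 : 0 <= kap.
  have lM : 0 <= (1 + lam) * M by rewrite mulr_ge0// addr_ge0.
  by rewrite exprn_ge0// divr_ge0// addr_ge0// ltW.
have c0 : 0 <= c.
  by apply: le_trans small; rewrite !mulr_ge0// addr_ge0.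
have th1 : 0 < 1 + th by rewrite addr_gt0.
elim=> [|l IH] x ancV /=.
  rewrite expr0 subrr mulr0; apply: sumr_ge0 => j _.
  exact: (green_ge0 th0 n (axi j)).
have Vx : V x by apply: ancV; left.
set r := (1 + th)^-1; set S := \sum_j _.
have key : c + \sum_i pd i * (c / th * (1 - r ^+ l)) <= (1 + th) * S.
  rewrite /S mulr_sumr.
  rewrite (eq_bigr _ (fun j _ => green_mass x n th0 (axi j))).
  rewrite !big_split /= Vk// [X in _ <= _ + X]exchange_big /=.
  apply: lerD; last first.
    apply: ler_sum => i _; rewrite -mulr_sumr ler_wpM2l// IH// => y ay.
    by apply: ancV; right; exists i.
  have dle : \sum_j - disc th n (fun e => num R e x) (xi j) >= - (m%:R * (M * kap)).
    rewrite -[m in m%:R]card_ord mulr_natl -sumr_const -sumrN; apply: ler_sum => j _.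
    rewrite lerN2; apply: le_trans (ler_norm _) _.
    apply: (disc_bound th0 n (axi j)) => // e [fe mass].
    by rewrite ger0_norm// (le_trans _ mass)// num_le_nsum.
  have sle : \sum_j - (th * green th n (fun e => slp R e x) (xi j)) >=
      - (m%:R * (lam / (1 + lam) + kap)).
    rewrite -[m in m%:R]card_ord mulr_natl -sumr_const -sumrN; apply: ler_sum => j _.
    by rewrite lerN2; apply: (green_slp_le th0 n (axi j)).
  move: small; rewrite /c => small.
  apply: le_trans (lerD (lerD (lexx k) dle) sle).
  set q := lam / _ in small *; lra.
have {key} : (c / th) * (1 + th) * (1 - r ^+ l.+1) <= (1 + th) * S.
  apply: le_trans key; rewrite -mulr_suml pd_sum mul1r.
  rewrite le_eqVlt; apply/orP; left; apply/eqP.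
  have thr : (1 + th) * r = 1 by rewrite mulfV// gt_eqF.
  have cE : c = c / th * th by rewrite divfK// gt_eqF.
  rewrite exprS; set b := c / th in cE *;
  transitivity (b * th + b * (1 - r ^+ l)); last by rewrite -cE.
  have -> : b * (1 + th) * (1 - r * r ^+ l) = b * (1 + th) - b * ((1 + th) * r) * r ^+ l.
    by ring.
  by rewrite thr; ring.
by rewrite -mulrA mulrCA ler_pM2l.
Qed.

Lemma nsum_gfun_le (th : R) x eta : 0 < th -> (forall y, num R eta y <= 1) ->
  nsum eta (gfun th x) <= th^-1.
Proof.
move=> th0 n1; apply: le_trans (sum_gfun_le x th0 (fset_uniq (fset_set (supp eta)))).
by apply: ler_sum => y _; rewrite -[leRHS]mul1r ler_wpM2r// gfun_ge0.
Qed.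

Lemma mom2_loss_le_sparse (th : R) x M n eta : 0 < th -> admissible M eta ->
  (forall y, num R eta y <= 1) -> mom2 th (loss x) n eta <= th^-1 ^+ 2 + th^-1.
Proof.
move=> th0 aeta n1; apply: le_trans (mom2_loss_le x th0 n aeta) _.
have le := nsum_gfun_le x th0 n1.
rewrite lerD//.
  rewrite ler_sqr ?nnegrE ?invr_ge0 ?(ltW th0)//.
  by apply: nsum_ge0 => y; apply: gfun_ge0.
apply: le_trans le; apply: ler_sum => y _.
rewrite ler_wpM2l ?num_ge0// -[leRHS]mulr1 ler_wpM2l ?gfun_ge0//.
by rewrite gerDl oppr_le0 gfun_ge0.
Qed.

(** The left side counts initial particles and arrivals not compensated by departures. By parts it
    is [th] times the discounted occupation of [x] plus the final term; the active, sleeping and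
    final parts are at most 1 each. *)
Lemma mom1_gain_le (th : R) x (M : R) n eta : 0 < th -> 0 <= M -> admissible M eta ->
  (forall y, num R eta y <= 1) ->
  M * ((1 + lam) * M / ((1 + lam) * M + th)) ^+ n <= 1 ->
  num R eta x + mom1 th (gain x) n eta <= 3.
Proof.
move=> th0 M0 aeta n1 small.
have D := green_dynkin th0 n (fun e => num R e x) eta.
have {D} : mom1 th (gain x) n eta =
    th * green th n (fun e => num R e x) eta - (num R eta x - disc th n (fun e => num R e x) eta).
  rewrite -D mom1E -greenZ -greenN -greenD; apply: (eq_green th0 n aeta) => e _.
  have -> : gen e (fun y i => num R (topple e y i) x) = tot e * num R e x + gen e (gain x e).
    by rewrite -gen_cst -genD; apply: eq_gen => y i _; rewrite /gain addrC subrK.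
  ring.
move=> ->.
have d1 : disc th n (fun e => num R e x) eta <= 1.
  apply: le_trans (ler_norm _) (le_trans _ small).
  apply: (disc_bound th0 n aeta) => // e [fe mass].
  by rewrite ger0_norm ?num_ge0// (le_trans _ mass)// num_le_nsum.
have a1 : th * green th n (fun e => act R e x) eta <= 1.
  rewrite mulrC -ler_pdivlMr// div1r.
  exact: le_trans (green_act_le x th0 n aeta) (nsum_gfun_le x th0 n1).
have s1 : th * green th n (fun e => slp R e x) eta <= 1.
  rewrite mulrC -ler_pdivlMr// div1r; apply: le_trans (green_cst th0 n eta).
  apply: (green_le th0 n aeta) => e _; rewrite /slp.
  by case: (_ == _); rewrite ?ler01.
have -> : green th n (fun e => num R e x) eta =
    green th n (fun e => act R e x) eta + green th n (fun e => slp R e x) eta.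
  by rewrite -greenD; apply: (eq_green th0 n aeta) => e _; rewrite num_split.
lra.
Qed.

End Generator.

(** * Discounted rewards along the jump chain *)

Lemma measurable_lt_fin {R : realType} {dT : measure_display}
    {T : measurableType dT} (f g : T -> \bar R) :
  measurable_fun setT f -> measurable_fun setT g ->
  measurable [set o | f o < g o < +oo]%E.
Proof.
move=> mf mg; rewrite (_ : mkset _ = (setT `&` [set o | f o < g o]%E) `&`
    (setT `&` [set o | g o < +oo]%E)).
  apply: measurableI; last exact: emeasurable_fun_infty_o.
  exact: measurable_lte.
by apply/seteqP; split => o /=; [case/andP|case=> -[_ ->] [_ ->]].
Qed.

(** * Bounded random variables and exponential delays *)

Section BoundedExpectation.
Context {R : realType} {dO : measure_display} {O : measurableType dO}.
Variable Pr : probability O R.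
Implicit Types f g H : O -> R.

Definition bounded_mfun f : Prop :=
  measurable_fun setT f /\ exists K : R, forall o, `|f o| <= K.

Definition mean f : R := \int[Pr]_o f o.

Lemma bmf_cst c : bounded_mfun (fun=> c).
Proof. by split; [exact: measurable_cst|exists `|c|]. Qed.

Lemma bmfD f g : bounded_mfun f -> bounded_mfun g ->
  bounded_mfun (fun o => f o + g o).
Proof.
move=> [mf [K fK]] [mg [L gL]]; split; first exact: measurable_funD.
by exists (K + L) => o; rewrite (le_trans (ler_normD _ _))// lerD.
Qed.

Lemma bmfM f g : bounded_mfun f -> bounded_mfun g ->
  bounded_mfun (fun o => f o * g o).
Proof.
move=> [mf [K fK]] [mg [L gL]]; split; first exact: measurable_funM.
by exists (K * L) => o; rewrite normrM ler_pM.
Qed.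

Lemma bmfN f : bounded_mfun f -> bounded_mfun (fun o => - f o).
Proof.
move=> [mf [K fK]]; split; first exact: measurableT_comp.
by exists K => o; rewrite normrN.
Qed.

Lemma bmfB f g : bounded_mfun f -> bounded_mfun g ->
  bounded_mfun (fun o => f o - g o).
Proof. by move=> bf bg; apply: bmfD => //; apply: bmfN. Qed.

Lemma bmfZ c f : bounded_mfun f -> bounded_mfun (fun o => c * f o).
Proof. by apply: bmfM; apply: bmf_cst. Qed.

Lemma bmfX f n : bounded_mfun f -> bounded_mfun (fun o => f o ^+ n).
Proof.
move=> bf; elim: n => [|n IH].
  by under eq_fun do rewrite expr0; apply: bmf_cst.
by under eq_fun do rewrite exprS; apply: bmfM.
Qed.

Lemma bmf_indic (A : set O) : measurable A -> bounded_mfun \1_A.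
Proof.
move=> mA; split; first exact: measurable_indic.
by exists 1 => o; rewrite indicE; case: (_ \in _); rewrite ?normr1 ?normr0.
Qed.

Lemma bmf_sum (I : Type) (r : seq I) (F : I -> O -> R) :
  (forall i, bounded_mfun (F i)) -> bounded_mfun (fun o => \sum_(i <- r) F i o).
Proof.
move=> bF; elim: r => [|i r IH].
  by under eq_fun do rewrite big_nil; apply: bmf_cst.
by under eq_fun do rewrite big_cons; apply: bmfD.
Qed.

Lemma bmf_integrable f : bounded_mfun f -> Pr.-integrable setT (EFin \o f).
Proof.
move=> [mf [K fK]]; apply: measurable_bounded_integrable => //.
  by rewrite (le_lt_trans (probability_le1 Pr measurableT))// ltry.
exists K; split; first exact: num_real.
by move=> L KL o _; apply: le_trans (fK o) (ltW KL).
Qed.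

Lemma meanD f g : bounded_mfun f -> bounded_mfun g ->
  mean (fun o => f o + g o) = mean f + mean g.
Proof. by move=> bf bg; rewrite /mean RintegralD//; apply: bmf_integrable. Qed.

Lemma meanB f g : bounded_mfun f -> bounded_mfun g ->
  mean (fun o => f o - g o) = mean f - mean g.
Proof. by move=> bf bg; rewrite /mean RintegralB//; apply: bmf_integrable. Qed.

Lemma meanZ c f : bounded_mfun f -> mean (fun o => c * f o) = c * mean f.
Proof. by move=> bf; rewrite /mean RintegralZl//; apply: bmf_integrable. Qed.

Lemma mean_sum (I : Type) (r : seq I) (F : I -> O -> R) :
  (forall i, bounded_mfun (F i)) ->
  mean (fun o => \sum_(i <- r) F i o) = \sum_(i <- r) mean (F i).
Proof.
move=> bF; elim: r => [|i r IH].
  rewrite big_nil; under [X in mean X]eq_fun do rewrite big_nil.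
  by rewrite /mean Rintegral_cst// mul0r.
rewrite big_cons -IH -meanD//; last exact: bmf_sum.
by congr mean; apply/funext => o; rewrite big_cons.
Qed.

Lemma ler_mean f g : bounded_mfun f -> bounded_mfun g ->
  (forall o, f o <= g o) -> mean f <= mean g.
Proof.
by move=> bf bg fg; apply: le_Rintegral => //; apply: bmf_integrable.
Qed.

Lemma mean_indic (A : set O) : measurable A -> mean \1_A = fine (Pr A).
Proof. by move=> mA; rewrite /mean /Rintegral integral_indic// setIT. Qed.

Lemma ae_mean0 (A : set O) f : bounded_mfun f -> measurable A -> Pr A = 0%E ->
  mean (fun o => f o * \1_A o) = 0.
Proof.
move=> [mf [K fK]] mA A0.
have bA := bmf_indic mA.
have bfA : bounded_mfun (fun o => f o * \1_A o) by apply: bmfM => //; split => //; exists K.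
have K0 : 0 <= K by apply: le_trans (fK point).
have EA : mean (fun o => K * \1_A o) = 0.
  by rewrite meanZ// mean_indic// A0 mulr0.
have i0 o : 0 <= \1_A o :> R by rewrite indicE.
apply/eqP; rewrite eq_le; apply/andP; split.
  rewrite -EA; apply: ler_mean => //; first exact: bmfZ.
  by move=> o; rewrite ler_wpM2r// (le_trans (ler_norm _)).
rewrite -[leLHS]oppr0 -EA -mulN1r -meanZ; last exact: bmfZ.
apply: ler_mean => //; first by do 2 apply: bmfZ.
move=> o; rewrite mulN1r -mulNr ler_wpM2r//.
by rewrite lerNl (le_trans (ler_norm _))// normrN.
Qed.

(* [exp (- c * D)], equal to [0] when [D = +oo]. *)
Definition edisc (c : R) (D : \bar R) : R :=
  if D is r%:E then expR (- c * r) else 0.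

Lemma edisc_bound c D : 0 < c -> (0 < D)%E -> 0 <= edisc c D <= 1.
Proof.
case: D => [r| |] c0 D0 //=; last by rewrite lexx ler01.
rewrite expR_ge0/= -expR0 ler_expR mulNr oppr_le0 mulr_ge0 ?ltW//.
Qed.

Lemma measurable_edisc c (D : O -> \bar R) : measurable_fun setT D ->
  measurable_fun setT (fun o => edisc c (D o)).
Proof.
move=> mD.
rewrite (_ : (fun o => edisc c (D o)) = fun o =>
    expR (- c * fine (D o)) * \1_[set o | D o \is a fin_num] o).
  apply: measurable_funM.
    apply: measurableT_comp; first exact: measurable_expR.
    apply: measurable_funM => //; apply: measurableT_comp => //.
  apply: measurable_indic; rewrite -[X in measurable X]setTI.
  exact: emeasurable_fin_num.
apply/funext => o; rewrite indicE /=.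
case E : (D o) => [r| |] /=.
- by rewrite mem_set ?mulr1//= E.
- by rewrite memNset ?mulr0//= E.
- by rewrite memNset ?mulr0//= E.
Qed.

Lemma bmf_edisc c (D : O -> \bar R) : 0 < c -> measurable_fun setT D ->
  (forall o, 0 < D o)%E -> bounded_mfun (fun o => edisc c (D o)).
Proof.
move=> c0 mD D0; split; first exact: measurable_edisc.
by exists 1 => o; have /andP[e0 e1] := edisc_bound c0 (D0 o); rewrite ger0_norm.
Qed.

Lemma meanE f : bounded_mfun f -> (\int[Pr]_o (f o)%:E = (mean f)%:E)%E.
Proof.
move=> bf; rewrite /mean /Rintegral fineK//.
exact/integrable_fin_num/bmf_integrable.
Qed.

Lemma exponential_tail (c r : R) : 0 < c -> 0 < r ->
  (\int[lebesgue_measure]_u (\1_[set u : R | u < r] u * exponential_pdf c u)%:E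
   = (1 - expR (- c * r))%:E)%E.
Proof.
move=> c0 r0.
have c0' := ltW c0.
transitivity (\int[lebesgue_measure]_(u in `[0%R, r[) (exponential_pdf c u)%:E)%E.
  rewrite [RHS]integral_mkcond; apply: eq_integral => u _.
  rewrite patchE indicE; have [u0|u0] := leP 0 u; last first.
    by rewrite lt0_exponential_pdf// mulr0; case: ifP.
  have [ur|ur] := ltP u r.
    by rewrite !mem_set ?mul1r//= in_itv/= u0 ur.
  rewrite !memNset ?mul0r//=; first by rewrite in_itv/= u0 /= ltNge ur.
  by rewrite ltNge ur.
rewrite integral_itv_bndo_bndc; last first.
  by apply/measurable_EFinP/measurable_funTS; apply: measurable_exponential_pdf.
by have := exponential_prob_itv0c c r0.
Qed.

(** Only the tails of [D] are known. Integrate them in [u] against the exponential density of rate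
    [c]: in one order of Fubini this gives [1 - exp (- c * D)] on [D < +oo], in the other a multiple
    of the exponential density of rate [r + c]. *)
Lemma mean_edisc_ge0 H (D : O -> \bar R) (C r c : R) :
  bounded_mfun H -> (forall o, 0 <= H o) -> measurable_fun setT D ->
  (forall o, 0 < D o)%E -> 0 < r -> 0 < c ->
  (forall u, 0 <= u ->
    mean (fun o => H o * \1_[set o | u%:E < D o < +oo]%E o) = C * expR (- r * u)) ->
  mean (fun o => H o * edisc c (D o)) = C * (r / (r + c)).
Proof.
move=> bH H0 mD D0 r0 c0 tail.
have mA u : measurable [set o | u%:E < D o < +oo]%E.
  exact: measurable_lt_fin.
pose g (z : O * R) : \bar R :=
  (H z.1 * \1_[set z : O * R | z.2%:E < D z.1 < +oo]%E z * exponential_pdf c z.2)%:E.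
have c0' := ltW c0.
have g0 z : (0 <= g z)%E.
  by rewrite lee_fin !mulr_ge0// ?exponential_pdf_ge0// indicE.
have mg : measurable_fun setT g.
  apply/measurable_EFinP; apply: measurable_funM; last first.
    apply: (measurableT_comp (measurable_exponential_pdf c)).
    exact: measurable_snd.
  apply: measurable_funM.
    by apply: (measurableT_comp bH.1); apply: measurable_fst.
  apply: measurable_indic.
  apply: (@measurable_lt_fin _ _ _ (fun z => z.2%:E) (fun z => D z.1)).
    by apply/measurable_EFinP; apply: measurable_snd.
  by apply: (measurableT_comp mD); apply: measurable_fst.
have := @fubini_tonelli _ _ _ _ _ Pr lebesgue_measure g mg g0.
have inner o : (\int[lebesgue_measure]_u g (o, u) =
    (H o * (\1_[set o | 0%:E < D o < +oo]%E o - edisc c (D o)))%:E)%E.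
  rewrite /g /=; case E : (D o) => [s| |] /=.
  - have s0 : 0 < s by have := D0 o; rewrite E.
    transitivity ((H o)%:E * \int[lebesgue_measure]_u
        (\1_[set u : R | u < s]%R u * exponential_pdf c u)%:E)%E.
      rewrite -ge0_integralZl//.
      + apply: eq_integral => u _; rewrite -EFinM mulrA; congr ((_ * _ * _)%:E).
        rewrite !indicE; congr (GRing.natmul 1 (nat_of_bool _)).
        by apply/idP/idP; rewrite !inE/= E ltry andbT lte_fin.
      + apply/measurable_EFinP; apply: measurable_funM.
          apply: measurable_indic.
          by rewrite -set_itvNyo; apply: measurable_itv.
        exact: measurable_exponential_pdf.
      + by move=> u _; rewrite lee_fin mulr_ge0// ?exponential_pdf_ge0// indicE.
      + by rewrite lee_fin.
    rewrite exponential_tail// -EFinM indicE mem_set//=.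
    by rewrite E lte_fin s0 ltry.
  - rewrite subr0 [in RHS]indicE memNset /= ?E ?ltxx ?andbF//.
    rewrite mulr0 integral0_eq// => u _; rewrite indicE memNset ?mulr0 ?mul0r//=.
    by rewrite E ltxx andbF.
  - by have := D0 o; rewrite E.
have outer u : (\int[Pr]_o g (o, u) =
    (C * (c / (r + c)) * exponential_pdf (r + c) u)%:E)%E.
  have [u0|u0] := ltP u 0.
    rewrite /g /= [in RHS]lt0_exponential_pdf// mulr0 integral0_eq// => o _.
    by rewrite lt0_exponential_pdf// mulr0.
  transitivity ((exponential_pdf c u)%:E * \int[Pr]_o
      (H o * \1_[set o | u%:E < D o < +oo]%E o)%:E)%E.
    rewrite -ge0_integralZl//.
    + by apply: eq_integral => o _; rewrite /g/= -EFinM mulrC.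
    + apply/measurable_EFinP; apply: measurable_funM; first exact: bH.1.
      exact: measurable_indic.
    + by move=> o _; rewrite lee_fin mulr_ge0// indicE.
    + by rewrite lee_fin exponential_pdf_ge0.
  rewrite meanE; last by apply: bmfM => //; apply: bmf_indic.
  rewrite tail// -EFinM; congr (_%:E).
  rewrite !exponential_pdfE//.
  have -> : expR (- (r + c) * u) = expR (- r * u) * expR (- c * u).
    by rewrite -expRD; congr expR; ring.
  by field; rewrite gt_eqF// addr_gt0.
under eq_integral do rewrite inner.
under [X in _ = X -> _]eq_integral do rewrite outer.
have b0 := bmf_indic (mA 0).
have be := bmf_edisc c0 mD D0.
rewrite meanE; last by apply: bmfM => //; apply: bmfB.
under [X in _ = X -> _]eq_integral do rewrite EFinM.
have rc : 0 < r + c by rewrite addr_gt0.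
rewrite integralZl//; last exact: integrable_exponential_pdf.
rewrite integral_exponential_pdf// mule1 => -[].
under [X in mean X]eq_fun do rewrite mulrBr.
rewrite meanB; [|exact: bmfM|exact: bmfM].
rewrite tail// mulr0 expR0 mulr1 => /eqP; rewrite subr_eq addrC -subr_eq => /eqP <-.
by field; rewrite gt_eqF.
Qed.

(** Adding a bound [K] of [H] reduces to a nonnegative variable; the tails on [A] alone account for
    the added constant. *)
Lemma mean_edisc H (A : set O) (D : O -> \bar R) (C0 C r c : R) :
  bounded_mfun H -> measurable A -> measurable_fun setT D ->
  (forall o, 0 < D o)%E -> 0 < r -> 0 < c ->
  (forall u, 0 <= u ->
    fine (Pr (A `&` [set o | u%:E < D o < +oo]%E)) = C0 * expR (- r * u)) ->
  (forall u, 0 <= u ->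
    mean (fun o => \1_(A `&` [set o | u%:E < D o < +oo]%E) o * H o)
    = C * expR (- r * u)) ->
  mean (fun o => \1_A o * edisc c (D o) * H o) = C * (r / (r + c)).
Proof.
move=> bH mA mD D0 r0 c0 tailA tail.
have [_ [K HK]] := bH.
have bA := bmf_indic mA.
have be := bmf_edisc c0 mD D0.
have mU u : measurable [set o | u%:E < D o < +oo]%E.
  exact: measurable_lt_fin.
have indI u o : \1_(A `&` [set o | u%:E < D o < +oo]%E) o =
    \1_A o * \1_[set o | u%:E < D o < +oo]%E o :> R by rewrite indicI.
have E1 : mean (fun o => \1_A o * edisc c (D o)) = C0 * (r / (r + c)).
  apply: (mean_edisc_ge0 bA) => //.
  move=> u u0.
  rewrite -tailA// -mean_indic; last exact: measurableI.
  by congr mean; apply/funext => o; rewrite indI.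
have bHK : bounded_mfun (fun o => \1_A o * (H o + K)).
  by apply: bmfM => //; apply: bmfD => //; apply: bmf_cst.
have E2 : mean (fun o => \1_A o * (H o + K) * edisc c (D o)) =
    (C + K * C0) * (r / (r + c)).
  apply: (mean_edisc_ge0 bHK) => //.
    move=> o; rewrite mulr_ge0// ?indicE// -lerBlDr sub0r.
    by have := HK o; rewrite ler_norml => /andP[].
  move=> u u0.
  have mAU : measurable (A `&` [set o | u%:E < D o < +oo]%E) by apply: measurableI.
  have bAU := bmf_indic mAU.
  transitivity (mean (fun o => \1_(A `&` [set o | u%:E < D o < +oo]%E) o * H o +
      K * \1_(A `&` [set o | u%:E < D o < +oo]%E) o)).
    by congr mean; apply/funext => o; rewrite indI; ring.
  rewrite meanD//; [|exact: bmfM|exact: bmfZ].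
  by rewrite meanZ// mean_indic// tail// tailA//; ring.
transitivity (mean (fun o => \1_A o * (H o + K) * edisc c (D o) -
    K * (\1_A o * edisc c (D o)))).
  by congr mean; apply/funext => o; ring.
rewrite meanB ?meanZ ?E1 ?E2//; last 3 first.
- exact: bmfM.
- exact: bmfM.
- by apply: bmfZ; apply: bmfM.
by ring.
Qed.

End BoundedExpectation.

(** * One-step analysis of the jump chain *)

Section JumpChain.
Variables (R : realType) (d : nat) (lam : R) (p : site d -> R).
Variables (dir : 'I_d -> site d).
Hypothesis lam_gt0 : 0 < lam.
Hypothesis p_dir_gt0 : forall k, 0 < p (dir k).
Hypothesis p_dir_sum : \sum_k p (dir k) = 1.
Hypothesis p_supp : forall z, p z != 0 -> exists k, z = dir k.
Hypothesis dir_neq0 : forall k, dir k != 0.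
Hypothesis dir_inj : injective dir.

Let pd k := p (dir k).
Let lam1_gt0 : 0 < 1 + lam. Proof. by rewrite addr_gt0. Qed.

Lemma total_rateE (eta : config d) : fin_config eta ->
  total_rate lam eta = tot lam eta.
Proof.
move=> feta; rewrite /total_rate /tot.
rewrite -(fsbig_widen (supp eta))//=; last first.
  move=> y [_ /= /negP]; rewrite negbK => /eqP ey.
  by rewrite /ring_rate ey /= mulr0.
rewrite fsbig_finite//= /asum mulr_sumr; apply: eq_bigr => y _.
by rewrite mulr1.
Qed.

Context {dO : measure_display} {O : measurableType dO}.
Variable Pr : probability O R.
Variables (A0 : set O) (w : R) (xi : config d).
Variables (dl : nat -> O -> \bar R) (rg : nat -> O -> site d)
  (ins : nat -> O -> instruction d).
Hypothesis fin_xi : fin_config xi.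
Hypothesis mA0 : measurable A0.
Hypothesis mdl : forall k, measurable_fun setT (dl k).
Hypothesis mrg : forall k x, measurable [set o | rg k o = x].
Hypothesis mins : forall k i, measurable [set o | ins k o = i].
Hypothesis dl_gt0 : forall k o, (0 < dl k o)%E.

(** The events on which the law of the marked chain is prescribed; they play the part of
    conditioning on the first [n] rings. *)
Definition cell (n : nat) (u : nat -> R) (x : nat -> site d)
    (i : nat -> instruction d) : set O :=
  [set o | A0 o /\ forall k, (k < n)%N ->
    [/\ (u k)%:E < dl k o < +oo, rg k o = x k & ins k o = i k]%E].

Hypothesis law : forall n (u : nat -> R) x i, (forall k, 0 <= u k) ->
  Pr (cell n u x i) = (w * \prod_(k < n)
    (expR (- (total_rate lam (topple_seq xi x i k) * u k)) *
    (ring_rate lam (topple_seq xi x i k) (x k) /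
       total_rate lam (topple_seq xi x i k)) *
    instruction_prob p lam (i k)))%:E.

Definition st (n : nat) (o : O) : config d :=
  topple_seq xi (rg^~ o) (ins^~ o) n.

Lemma fin_topple_seq x i n : fin_config (topple_seq xi x i n).
Proof. by elim: n => //= n IH; apply: fin_topple. Qed.

Lemma eq_topple_seq x i x' i' n :
  (forall k, (k < n)%N -> x k = x' k /\ i k = i' k) ->
  topple_seq xi x i n = topple_seq xi x' i' n.
Proof.
elim: n => //= n IH E; rewrite IH; last by move=> k kn; apply: E; apply: ltnW.
by have [-> ->] := E n (ltnSn n).
Qed.

Definition encode (j : instruction d) : option (site d) :=
  if j is Jump z then Some z else None.

Definition decode (t : option (site d)) : instruction d :=
  if t is Some z then Jump z else Sleep.

Lemma encodeK : cancel encode decode. Proof. by case. Qed.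

Definition ring_at (n : nat) y j : set O := [set o | rg n o = y /\ ins n o = j].

Lemma measurable_ring_at n y j : measurable (ring_at n y j).
Proof.
rewrite (_ : ring_at n y j = [set o | rg n o = y] `&` [set o | ins n o = j])//.
exact: measurableI.
Qed.

(* The marks [rg k] and [ins k] take values in countable types. *)
Lemma measurable_marks n (f : O -> R) :
  (forall o o', (forall k, (k < n)%N -> rg k o = rg k o' /\ ins k o = ins k o') ->
    f o = f o') -> measurable_fun setT f.
Proof.
move=> fE _ B _; rewrite setTI.
pose code o := [seq (rg k o, encode (ins k o)) | k <- iota 0 n].
have codeE o o' : code o = code o' ->
    forall k, (k < n)%N -> rg k o = rg k o' /\ ins k o = ins k o'.
  move=> E k kn; have := congr1 (fun s => nth (rg 0 o, None) s k) E.
  rewrite !(nth_map 0%N) ?size_iota// nth_iota// add0n => -[-> e2].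
  by split => //; rewrite -[LHS]encodeK e2 encodeK.
have mcode t : measurable [set o | code o = t].
  have [st'|st'] := eqVneq (size t) n; last first.
    rewrite (_ : [set o | _] = set0)//; apply/seteqP; split => // o /= E.
    by move: st'; rewrite -E size_map size_iota eqxx.
  rewrite (_ : [set o | _] = \bigcap_(k in [set k | (k < n)%N])
      (ring_at k (nth (0, None) t k).1 (decode (nth (0, None) t k).2))).
    apply: fin_bigcap_measurable => [|k _]; last exact: measurable_ring_at.
    exact: finite_II.
  apply/seteqP; split => o /=.
    move=> <- k /= kn; rewrite /ring_at /= !(nth_map 0%N) ?size_iota//.
    by rewrite nth_iota// add0n /= encodeK.
  move=> H; apply: (@eq_from_nth _ (0, None)).
    by rewrite size_map size_iota.
  move=> k; rewrite size_map size_iota => kn.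
  rewrite (nth_map 0%N) ?size_iota// nth_iota// add0n.
  have [-> ->] := H k kn; move: (nth _ t k) => [y [z|]] //.
rewrite (_ : f @^-1` B = \bigcup_(t in setT)
    ([set o | code o = t] `&` [set o | exists2 o', code o' = t & B (f o')])).
  apply: countable_bigcupT_measurable => [|t]; first exact: countableP.
  have [ [z zt Bz]|no] := pselect (exists2 o', code o' = t & B (f o')).
    rewrite (_ : _ `&` _ = [set o | code o = t])//.
    by apply/seteqP; split => o /=; [case|move=> ot; split => //; exists z].
  rewrite (_ : _ `&` _ = set0)//.
  by apply/seteqP; split => o //= [].
apply/seteqP; split => o /=.
  by move=> Bo; exists (code o) => //; split => //; exists o.
by move=> [t _ /= [<- [z /codeE/fE ->]]].
Qed.

Lemma measurable_cell n u x i : measurable (cell n u x i).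
Proof.
rewrite (_ : cell n u x i = A0 `&` \bigcap_(k in [set k | (k < n)%N])
   ([set o | (u k)%:E < dl k o < +oo]%E `&` ring_at k (x k) (i k))).
  apply: measurableI => //; apply: fin_bigcap_measurable => [|k _].
    exact: finite_II.
  apply: measurableI; last exact: measurable_ring_at.
  exact: measurable_lt_fin.
apply/seteqP; split => o /=.
  by move=> [Ao H]; split => // k /= /H[].
by move=> [Ao H]; split => // k kn; have [? []] := H k kn.
Qed.

Definition upd T (f : nat -> T) n v : nat -> T := fun k => if k == n then v else f k.

Lemma updE T (f : nat -> T) n v : upd f n v n = v.
Proof. by rewrite /upd eqxx. Qed.

Lemma upd_lt T (f : nat -> T) n v k : (k < n)%N -> upd f n v k = f k.
Proof. by move=> kn; rewrite /upd ltn_eqF. Qed.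

Lemma topple_seq_upd x i n y j :
  topple_seq xi (upd x n y) (upd i n j) n = topple_seq xi x i n.
Proof. by apply: eq_topple_seq => k kn; rewrite !upd_lt. Qed.

Lemma cellS n u x i v y j :
  cell n.+1 (upd u n v) (upd x n y) (upd i n j) =
  (cell n u x i `&` ring_at n y j) `&` [set o | v%:E < dl n o < +oo]%E.
Proof.
apply/seteqP; split => o /=.
  move=> [Ao H]; have := H n (ltnSn n); rewrite !updE => -[? ? ?].
  split => //; split => //; split => // k kn.
  by have := H k (ltnW kn); rewrite !upd_lt.
move=> [[[Ao H] [? ?]] ?]; split => // k; rewrite ltnS leq_eqVlt.
by case/predU1P => [->|kn]; rewrite ?updE// !upd_lt//; apply: H.
Qed.

Lemma pr_cellS n u x i v y j : (forall k, 0 <= u k) -> 0 <= v ->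
  let eta := topple_seq xi x i n in
  fine (Pr (cell n.+1 (upd u n v) (upd x n y) (upd i n j))) =
  fine (Pr (cell n u x i)) * (ring_rate lam eta y / total_rate lam eta *
    instruction_prob p lam j) * expR (- total_rate lam eta * v).
Proof.
move=> u0 v0 eta; rewrite !law//; last first.
  by move=> k; rewrite /upd; case: ifP.
rewrite /= big_ord_recr /= !updE topple_seq_upd -/eta mulNr.
under eq_bigr => k _ do rewrite !upd_lt//.
have E (k : 'I_n) : topple_seq xi (upd x n y) (upd i n j) k = topple_seq xi x i k.
  apply: eq_topple_seq => l lk.
  by rewrite !upd_lt// (ltn_trans lk).
under eq_bigr => k _ do rewrite E.
by ring.
Qed.

Lemma ring_null n (u : nat -> R) x i y j : (forall k, 0 <= u k) ->
  let eta := topple_seq xi x i n in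
  ring_rate lam eta y * instruction_prob p lam j = 0 ->
  Pr ((cell n u x i `&` ring_at n y j) `&` [set o | 0%:E < dl n o < +oo]%E) = 0%E.
Proof.
move=> u0 eta z; have := pr_cellS n x i y j u0 (lexx 0).
rewrite -cellS /= -/eta [ring_rate _ _ _ / _ * _]mulrAC z !(mul0r, mulr0) => H.
rewrite -[LHS]fineK ?H//.
by apply: fin_num_measure; apply: measurable_cell.
Qed.

Definition unfair_ring n (eta : config d) : set O :=
  [set o | ~ (supp eta (rg n o) /\ fair_instr dir (ins n o))].

Lemma measurable_unfair_ring n eta : measurable (unfair_ring n eta).
Proof.
apply/(@measurable_indicP _ _ R); apply: (@measurable_marks n.+1) => o o' E.
rewrite !indicE; congr (GRing.natmul 1 (nat_of_bool _)).
by apply/idP/idP; rewrite !inE /unfair_ring /=; have [-> ->] := E n (ltnSn n).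
Qed.

Lemma ring_partition n eta o : fin_config eta ->
  \sum_(y <- fset_set (supp eta)) (\1_(ring_at n y Sleep) o +
    \sum_k \1_(ring_at n y (Jump (dir k))) o) + \1_(unfair_ring n eta) o = 1 :> R.
Proof.
move=> feta.
have zero y j : y <> rg n o \/ j <> ins n o -> \1_(ring_at n y j) o = 0 :> R.
  by rewrite indicE => yj; rewrite memNset// => -[/= E1 E2]; case: yj; rewrite ?E1 ?E2.
have one y j : y = rg n o -> j = ins n o -> \1_(ring_at n y j) o = 1 :> R.
  by move=> -> ->; rewrite indicE mem_set.
have [[sy fj]|bad] := pselect (supp eta (rg n o) /\ fair_instr dir (ins n o)).
  rewrite [X in _ + X]indicE memNset; last by apply.
  rewrite addr0 (bigD1_seq (rg n o)) ?fset_uniq//=; last first.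
    by rewrite in_fset_set// mem_set.
  rewrite [X in _ + X]big1 ?addr0; last first.
    move=> y yn; rewrite zero ?big1 ?addr0// => [k _|].
      by rewrite zero//; left; apply/eqP.
    by left; apply/eqP.
  case: fj => [E|[k E]].
    rewrite (one _ Sleep)// big1 ?addr0// => k _.
    by rewrite zero//; right; rewrite E.
  rewrite (zero _ Sleep); last by right; rewrite E.
  rewrite add0r (bigD1 k)//= one// big1 ?addr0// => l lk.
  rewrite zero//; right; rewrite E => -[/dir_inj lk'].
  by rewrite lk' eqxx in lk.
rewrite [X in _ + X]indicE mem_set//= big1_seq ?add0r// => y /= yS.
have sy : supp eta y by move: yS; rewrite in_fset_set// inE.
rewrite zero ?add0r; last first.
  have [E|] := pselect (y = rg n o); last by left.
  right => E'; apply: bad; rewrite -E -E'; split => //; by left.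
rewrite big1// => k _; rewrite zero//.
have [E|] := pselect (y = rg n o); last by left.
by right => E'; apply: bad; rewrite -E -E'; split => //; right; exists k.
Qed.

Lemma ring_rate_instr0 (eta : config d) y j :
  ~ (supp eta y /\ fair_instr dir j) ->
  ring_rate lam eta y * instruction_prob p lam j = 0.
Proof.
move=> bad; have [sy|/negP nsy] := pselect (supp eta y); last first.
  by rewrite /ring_rate; move: nsy; rewrite negbK => /eqP->/=; rewrite mulr0 mul0r.
case: j bad => [|z] bad; first by case: bad; split => //; left.
rewrite /instruction_prob; have [->|/p_supp[k zk]] := eqVneq (p z) 0.
  by rewrite mul0r mulr0.
by case: bad; split => //; right; exists k; rewrite zk.
Qed.

(** Each forbidden mark is null by the product formula, and there are countably many marks. *)
Lemma unfair_ring_null n (u : nat -> R) x i : (forall k, 0 <= u k) ->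
  let eta := topple_seq xi x i n in
  Pr ((cell n u x i `&` unfair_ring n eta) `&`
    [set o | 0%:E < dl n o < +oo]%E) = 0%E.
Proof.
move=> u0 eta.
have mfin : measurable [set o | 0%:E < dl n o < +oo]%E by apply: measurable_lt_fin.
have mc := measurable_cell n u x i.
apply: measure_negligible.
  by apply: measurableI => //; apply: measurableI => //; apply: measurable_unfair_ring.
pose N (t : site d * option (site d)) : set O :=
  if pselect (supp eta t.1 /\ fair_instr dir (decode t.2)) then set0
  else (cell n u x i `&` ring_at n t.1 (decode t.2)) `&`
    [set o | 0%:E < dl n o < +oo]%E.
pose F (k : nat) := if choice.unpickle k is Some t then N t else set0.
apply: (@negligibleS _ _ _ Pr (\bigcup_k F k)).
  move=> o [[co bo] fo]; exists (choice.pickle (rg n o, encode (ins n o))) => //.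
  rewrite /F choice.pickleK /N /= encodeK; case: pselect => //.
apply: negligible_bigcup => k; rewrite /F; case: choice.unpickle => [t|]; last first.
  exact: negligible_set0.
rewrite /N; case: pselect => [good|bad] /=; first exact: negligible_set0.
apply/negligibleP; last by apply: ring_null => //; apply: ring_rate_instr0.
by apply: measurableI => //; apply: measurableI => //; apply: measurable_ring_at.
Qed.

(** The Markov property at the next ring: the cell is split according to the next mark; on each
    piece the delay has exponential tails, which [mean_edisc] integrates, and the rates of the marks
    add up to [gen]. *)
Lemma mean_ring n (u : nat -> R) x i c (f : site d -> instruction d -> R) H :
  (forall k, 0 <= u k) -> 0 < c -> bounded_mfun H ->
  let eta := topple_seq xi x i n in
  (forall y j v, step_ok dir eta y j -> 0 <= v ->
    let C := cell n.+1 (upd u n v) (upd x n y) (upd i n j) in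
    mean Pr (fun o => \1_C o * H o) = fine (Pr C) * f y j) ->
  mean Pr (fun o => \1_(cell n u x i) o * edisc c (dl n o) * H o) =
  fine (Pr (cell n u x i)) * (gen lam dir pd eta f / (tot lam eta + c)).
Proof.
move=> u0 c0 bH eta Hf.
have feta : fin_config eta := fin_topple_seq x i n.
set A := cell n u x i; set q := fine (Pr A).
have mA : measurable A := measurable_cell n u x i.
have bA := bmf_indic (R := R) mA.
have be := bmf_edisc c0 (mdl n) (dl_gt0 n).
have bI y j := bmf_indic (R := R) (measurable_ring_at n y j).
have bU := bmf_indic (R := R) (measurable_unfair_ring n eta).
have mfin : measurable [set o | 0%:E < dl n o < +oo]%E by apply: measurable_lt_fin.
have bF := bmf_indic (R := R) mfin.
have den0 : tot lam eta + c != 0.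
  by rewrite gt_eqF// ltr_wpDl// tot_ge0.
have eF o : edisc c (dl n o) = edisc c (dl n o) * \1_[set o | 0%:E < dl n o < +oo]%E o.
  rewrite indicE; have := dl_gt0 n o; case E : (dl n o) => [r| |] //= r0; last by rewrite mul0r.
  by rewrite mem_set ?mulr1//= E r0 ltry.
have one y j : mean Pr (fun o => \1_A o * edisc c (dl n o) * H o * \1_(ring_at n y j) o) =
    q * (ring_rate lam eta y * instruction_prob p lam j * f y j / (tot lam eta + c)).
  have mAy : measurable (A `&` ring_at n y j).
    by apply: measurableI => //; apply: measurable_ring_at.
  transitivity (mean Pr (fun o => \1_(A `&` ring_at n y j) o * edisc c (dl n o) * H o)).
    by congr mean; apply/funext => o; rewrite indicI /= ; ring.
  have [z|nz] := eqVneq (ring_rate lam eta y * instruction_prob p lam j) 0.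
    rewrite z !mul0r mulr0.
    transitivity (mean Pr (fun o => edisc c (dl n o) * H o *
        \1_((A `&` ring_at n y j) `&` [set o | 0%:E < dl n o < +oo]%E) o)).
      by congr mean; apply/funext => o; rewrite [in LHS]eF [in RHS]indicI /=; ring.
    apply: ae_mean0; [exact: bmfM|exact: measurableI|exact: ring_null].
  have ok : step_ok dir eta y j.
    have [[sy fj]|bad] := pselect (supp eta y /\ fair_instr dir j); last first.
      by move: nz; rewrite ring_rate_instr0// eqxx.
    split => //; rewrite lt0n; apply: contra_neq nz => ay.
    by rewrite /ring_rate ay mulr0 mul0r.
  have t0 : 0 < tot lam eta.
    rewrite /tot mulr_gt0//; apply: (@lt_le_trans _ _ (act R eta y)).
      by rewrite /act ltr0n; case: ok.
    rewrite -[leLHS]mulr1 -(asum_point y (fun=> 1) feta); apply: ler_asum => z _.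
    by rewrite mul1r; case: (_ == _); rewrite ?ler01.
  pose C0 := q * (ring_rate lam eta y / tot lam eta * instruction_prob p lam j).
  have prC v : 0 <= v ->
      fine (Pr (A `&` ring_at n y j `&` [set o | v%:E < dl n o < +oo]%E)) =
      C0 * expR (- tot lam eta * v).
    by move=> v0; rewrite -cellS pr_cellS// -/A -/q -/eta total_rateE.
  rewrite (@mean_edisc _ _ _ Pr H (A `&` ring_at n y j) (dl n) C0 (C0 * f y j)
      (tot lam eta) c)//.
    by rewrite /C0; field; rewrite den0 gt_eqF.
  move=> v v0; rewrite -cellS Hf// cellS prC//; ring.
transitivity (mean Pr (fun o =>
    \sum_(y <- fset_set (supp eta)) (
      \1_A o * edisc c (dl n o) * H o * \1_(ring_at n y Sleep) o +
      \sum_k \1_A o * edisc c (dl n o) * H o * \1_(ring_at n y (Jump (dir k))) o) +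
    edisc c (dl n o) * H o *
      \1_((A `&` unfair_ring n eta) `&` [set o | 0%:E < dl n o < +oo]%E) o)).
  congr mean; apply/funext => o.
  rewrite -[LHS]mulr1 -(ring_partition n o feta) mulrDr; congr (_ + _).
    by rewrite mulr_sumr; apply: eq_bigr => y _; rewrite mulrDr mulr_sumr.
  by rewrite [in LHS]eF [in RHS]indicI /= indicI /=; ring.
have bAeH : bounded_mfun (fun o => \1_A o * edisc c (dl n o) * H o).
  by apply: bmfM => //; apply: bmfM.
have b1 y : bounded_mfun (fun o =>
    \1_A o * edisc c (dl n o) * H o * \1_(ring_at n y Sleep) o) by apply: bmfM.
have b2 y k : bounded_mfun (fun o =>
    \1_A o * edisc c (dl n o) * H o * \1_(ring_at n y (Jump (dir k))) o).
  exact: bmfM.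
have mN : measurable ((A `&` unfair_ring n eta) `&` [set o | 0%:E < dl n o < +oo]%E).
  by do 2 (apply: measurableI => //); apply: measurable_unfair_ring.
rewrite meanD; last 2 first.
- by apply: bmf_sum => y; apply: bmfD => //; apply: bmf_sum => k.
- by apply: bmfM; [exact: bmfM|exact: bmf_indic].
rewrite ae_mean0//; last 2 first.
- exact: bmfM.
- exact: unfair_ring_null.
rewrite addr0 mean_sum; last by move=> y; apply: bmfD => //; apply: bmf_sum => k.
rewrite /gen /asum mulr_suml mulr_sumr; apply: eq_bigr => y _.
rewrite meanD//; last by apply: bmf_sum => k.
rewrite mean_sum// one; under eq_bigr do rewrite one.
rewrite -mulr_sumr -mulrDr; congr (q * _).
rewrite /mix /ring_rate /act /=.
rewrite mulrDr [in RHS]mulrDl mulr_sumr [in RHS]mulr_suml; congr (_ + _).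
  by field; rewrite den0 gt_eqF.
by apply: eq_bigr => k _; rewrite /pd; field; rewrite den0 gt_eqF.
Qed.

Section DiscountedRewards.
Variable rho : config d -> site d -> instruction d -> R.
Hypothesis rho_bounded : exists K : R, forall eta y j, `|rho eta y j| <= K.

(** Discounted from the end of the first [n] delays rather than from time 0, so that the recursion
    matches [mom1] and [mom2] on cells. *)
Fixpoint reward (th : R) (N n : nat) (o : O) : R :=
  if N is N'.+1 then
    edisc th (dl n o) * (rho (st n o) (rg n o) (ins n o) + reward th N' n.+1 o)
  else 0.

Lemma bmf_rho n : bounded_mfun (fun o => rho (st n o) (rg n o) (ins n o)).
Proof.
split; last by have [K rK] := rho_bounded; exists K.
apply: (@measurable_marks n.+1) => o o' E.
have [-> ->] := E n (ltnSn n); congr rho; apply: eq_topple_seq => k kn.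
by apply: E; rewrite ltnS ltnW.
Qed.

Lemma bmf_reward th N n : 0 < th -> bounded_mfun (reward th N n).
Proof.
move=> th0; elim: N n => [|N IH] n /=; first exact: bmf_cst.
by apply: bmfM; [exact: bmf_edisc|apply: bmfD; [exact: bmf_rho|exact: IH]].
Qed.

Lemma rho_cell n u x i v y j o : let C := cell n.+1 (upd u n v) (upd x n y) (upd i n j) in
  \1_C o * rho (st n o) (rg n o) (ins n o) =
  \1_C o * rho (topple_seq xi x i n) y j.
Proof.
move=> C; rewrite indicE; have [oC|] := boolP (o \in C); last by rewrite !mul0r.
move: oC; rewrite inE /C cellS => -[[[_ H] [-> ->]] _].
by congr (_ * rho _ _ _); apply: eq_topple_seq => k /H[].
Qed.

Lemma topple_seq_updS x i n y j :
  topple_seq xi (upd x n y) (upd i n j) n.+1 = topple (topple_seq xi x i n) y j.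
Proof. by rewrite /= !updE topple_seq_upd. Qed.

Lemma upd_ge0 (u : nat -> R) n v : (forall k, 0 <= u k) -> 0 <= v ->
  forall k, 0 <= upd u n v k.
Proof. by move=> u0 v0 k; rewrite /upd; case: ifP. Qed.

Lemma mean_reward_cell (th : R) N n (u : nat -> R) x i : 0 < th ->
  (forall k, 0 <= u k) ->
  mean Pr (fun o => \1_(cell n u x i) o * reward th N n o) =
  fine (Pr (cell n u x i)) * mom1 lam dir pd th rho N (topple_seq xi x i n).
Proof.
move=> th0; elim: N n u x i => [|N IH] n u x i u0.
  by rewrite /= mulr0 (_ : (fun o => _) = fun=> 0) ?mean_cst0//;
     [rewrite /mean Rintegral_cst// mul0r|apply/funext => o; rewrite mulr0].
under [X in mean _ X]eq_fun do rewrite /= mulrA.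
rewrite (@mean_ring n u x i th (fun y j => rho (topple_seq xi x i n) y j +
  mom1 lam dir pd th rho N (topple (topple_seq xi x i n) y j)))//.
  by apply: bmfD; [exact: bmf_rho|exact: bmf_reward].
move=> y j v ok v0 C.
have bC : bounded_mfun (\1_C : O -> R) by apply: bmf_indic; apply: measurable_cell.
under [X in mean _ X]eq_fun do rewrite mulrDr rho_cell.
rewrite meanD; [|by apply: bmfM => //; apply: bmf_cst|by apply: bmfM => //; apply: bmf_reward].
rewrite IH; last exact: upd_ge0.
rewrite topple_seq_updS -/C mulrDr; congr (_ + _).
under [X in mean _ X]eq_fun do rewrite mulrC.
rewrite [RHS]mulrC meanZ// mean_indic//; exact: measurable_cell.
Qed.

Lemma edisc_sqr (th : R) (D : \bar R) : edisc th D ^+ 2 = edisc (2 * th) D.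
Proof.
case: D => [r| |] /=; rewrite ?expr0n//.
by rewrite expr2 -expRD; congr expR; ring.
Qed.

Lemma mean_reward2_cell (th : R) N n (u : nat -> R) x i : 0 < th ->
  (forall k, 0 <= u k) ->
  mean Pr (fun o => \1_(cell n u x i) o * reward th N n o ^+ 2) =
  fine (Pr (cell n u x i)) * mom2 lam dir pd th rho N (topple_seq xi x i n).
Proof.
move=> th0; elim: N n u x i => [|N IH] n u x i u0.
  by rewrite /= mulr0 (_ : (fun o => _) = fun=> 0);
     [rewrite /mean Rintegral_cst// mul0r|apply/funext => o; rewrite expr0n mulr0].
under [X in mean _ X]eq_fun do rewrite /= exprMn edisc_sqr mulrA.
have th2 : 0 < 2 * th by rewrite mulr_gt0.
have b1 := bmf_rho n; have b2 := bmf_reward N n.+1 th0.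
set eta := topple_seq xi x i n.
rewrite (@mean_ring n u x i (2 * th) (fun y j => rho eta y j ^+ 2 +
  2 * rho eta y j * mom1 lam dir pd th rho N (topple eta y j) +
  mom2 lam dir pd th rho N (topple eta y j)))//.
  by apply: bmfX; apply: bmfD.
move=> y j v ok v0 C.
have bC : bounded_mfun (\1_C : O -> R) by apply: bmf_indic; apply: measurable_cell.
transitivity (mean Pr (fun o => rho eta y j ^+ 2 * \1_C o +
    2 * rho eta y j * (\1_C o * reward th N n.+1 o) +
    \1_C o * reward th N n.+1 o ^+ 2)).
  congr mean; apply/funext => o.
  have : \1_C o * rho (st n o) (rg n o) (ins n o) = \1_C o * rho eta y j.
    exact: rho_cell.
  set r := rho (st n o) _ _; set m := reward _ _ _ _ => E.
  have C2 : \1_C o * r ^+ 2 = \1_C o * rho eta y j ^+ 2.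
    by rewrite !expr2 !mulrA E mulrAC E; ring.
  transitivity (\1_C o * r ^+ 2 + 2 * (\1_C o * r) * m + \1_C o * m ^+ 2).
    by ring.
  by rewrite C2 E; ring.
have bCr : bounded_mfun (fun o => \1_C o * reward th N n.+1 o) by apply: bmfM.
have bCr2 : bounded_mfun (fun o => \1_C o * reward th N n.+1 o ^+ 2).
  by apply: bmfM => //; apply: bmfX.
rewrite meanD//; last by apply: bmfD; apply: bmfZ.
rewrite meanD; [|exact: bmfZ|exact: bmfZ].
have u0' := upd_ge0 n u0 v0.
rewrite !meanZ// IH// mean_reward_cell// topple_seq_updS -/C -/eta.
rewrite mean_indic; last exact: measurable_cell.
by ring.
Qed.

Lemma cell0 : cell 0 (fun=> 0) (fun=> 0) (fun=> Sleep) = A0.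
Proof. by apply/seteqP; split => o /=; [case|split]. Qed.

Lemma pr_A0 : fine (Pr A0) = w.
Proof. by rewrite -cell0 law// big_ord0 mulr1. Qed.

Lemma mean_reward th N : 0 < th ->
  mean Pr (fun o => \1_A0 o * reward th N 0 o) = w * mom1 lam dir pd th rho N xi.
Proof. by move=> th0; rewrite -[in LHS]cell0 mean_reward_cell// cell0 pr_A0. Qed.

Lemma mean_reward2 th N : 0 < th ->
  mean Pr (fun o => \1_A0 o * reward th N 0 o ^+ 2) =
  w * mom2 lam dir pd th rho N xi.
Proof. by move=> th0; rewrite -[in LHS]cell0 mean_reward2_cell// cell0 pr_A0. Qed.

End DiscountedRewards.

(** * Pathwise inequalities for discounted rewards *)

Section PathwiseRewards.
Implicit Types (rho : config d -> site d -> instruction d -> R) (th : R).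

Lemma edisc_ge0 th D : 0 <= edisc th D.
Proof. by case: D => [r| |] //=; rewrite expR_ge0. Qed.

Lemma reward_le rho rho' th N n o :
  (forall eta y j, rho eta y j <= rho' eta y j) ->
  reward rho th N n o <= reward rho' th N n o.
Proof.
move=> le; elim: N n => //= N IH n.
by rewrite ler_wpM2l ?edisc_ge0// lerD.
Qed.

Lemma reward_ge0 rho th N n o : (forall eta y j, 0 <= rho eta y j) ->
  0 <= reward rho th N n o.
Proof. by move=> r0; elim: N n => //= N IH n; rewrite mulr_ge0 ?edisc_ge0// addr_ge0. Qed.

Lemma rewardD rho rho' th N n o :
  reward (fun e y j => rho e y j + rho' e y j) th N n o =
  reward rho th N n o + reward rho' th N n o.
Proof. by elim: N n => /= [|N IH] n; [rewrite addr0|rewrite IH; ring]. Qed.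

Lemma rewardZ c rho th N n o :
  reward (fun e y j => c * rho e y j) th N n o = c * reward rho th N n o.
Proof. by elim: N n => /= [|N IH] n; [rewrite mulr0|rewrite IH; ring]. Qed.

(* Summation by parts. *)
Lemma reward_gain_ge0 x th N n o : 0 < th ->
  0 <= num R (st n o) x + reward (gain R x) th N n o.
Proof.
move=> th0; elim: N n => /= [|N IH] n; first by rewrite addr0 num_ge0.
have /andP[e0 e1] := edisc_bound th0 (dl_gt0 n o); set e := edisc _ _ in e0 e1 *.
have -> : num R (st n o) x +
    e * (gain R x (st n o) (rg n o) (ins n o) + reward (gain R x) th N n.+1 o) =
    (1 - e) * num R (st n o) x +
    e * (num R (st n.+1 o) x + reward (gain R x) th N n.+1 o).
  by rewrite /gain /=; ring.
by rewrite addr_ge0// mulr_ge0 ?num_ge0// subr_ge0.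
Qed.

Definition ring_time n o : \bar R := (\sum_(k < n) dl k o)%E.

Lemma ring_timeS n o : ring_time n.+1 o = (ring_time n o + dl n o)%E.
Proof. by rewrite /ring_time big_ord_recr. Qed.

Lemma ring_time_ge0 n o : (0 <= ring_time n o)%E.
Proof. by apply: sume_ge0 => k _; apply: ltW. Qed.

Lemma ediscD th (D D' : \bar R) : (0 <= D)%E -> (0 <= D')%E ->
  edisc th (D + D') = edisc th D * edisc th D'.
Proof.
case: D => [r| |] //; case: D' => [s| |] //= _ _; rewrite ?mulr0 ?mul0r//.
by rewrite -expRD; congr expR; ring.
Qed.

(** The ring marked [rg n] ends the delay [dl n]: it occurs at [ring_time n.+1] and acts on
    [st n]. *)
Definition in_window (T T' : R) rho n o : Prop :=
  [/\ (T%:E < ring_time n.+1 o)%E, (ring_time n.+1 o <= T'%:E)%E &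
    0 < rho (st n o) (rg n o) (ins n o)].

(** Up to [T] the discount is at most 1, hence at most [exp (1 - s / T)]; after [T'], half of the
    exponent is at most [- (th * T' / 2)]. Both terms are discounts at other rates, to which the
    moment bounds apply. *)
Lemma edisc_split th T T' (s : \bar R) : 0 < th -> 0 < T -> (0 <= s)%E ->
  ~ (T%:E < s <= T'%:E)%E ->
  edisc th s <= expR 1 * edisc T^-1 s + expR (- (th * T' / 2)) * edisc (th / 2) s.
Proof.
move=> th0 T0; case: s => [r| |] s0 nw; last 2 first.
- by rewrite /edisc !mulr0 addr0.
- by rewrite /edisc !mulr0 addr0.
rewrite /=.
rewrite -!expRD; have [rT|Tr] := leP r T.
  apply: (@le_trans _ _ (expR 0)).
    by rewrite ler_expR mulNr oppr_le0 mulr_ge0// ltW.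
  rewrite -[leLHS]addr0 lerD ?expR_ge0// ler_expR mulNr subr_ge0 mulrC.
  by rewrite ler_pdivrMr// mul1r.
rewrite -[leLHS]add0r lerD ?expR_ge0// ler_expR.
have T'r : T' < r.
  by rewrite ltNge; apply/negP => rT'; apply: nw; rewrite lte_fin lee_fin Tr rT'.
have : th * T' <= th * r by rewrite ler_wpM2l// ltW.
lra.
Qed.

Lemma reward_no_window rho th (T T' : R) N n o : 0 < th -> 0 < T ->
  (forall eta y j, 0 <= rho eta y j) ->
  (forall m, (n <= m)%N -> (m < n + N)%N -> ~ in_window T T' rho m o) ->
  edisc th (ring_time n o) * reward rho th N n o <=
  expR 1 * (edisc T^-1 (ring_time n o) * reward rho T^-1 N n o) +
  expR (- (th * T' / 2)) *
    (edisc (th / 2) (ring_time n o) * reward rho (th / 2) N n o).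
Proof.
move=> th0 T0 r0; elim: N n => /= [|N IH] n nw; first by rewrite !mulr0 addr0.
have E c : edisc c (ring_time n o) * (edisc c (dl n o) *
    (rho (st n o) (rg n o) (ins n o) + reward rho c N n.+1 o)) =
    edisc c (ring_time n.+1 o) * rho (st n o) (rg n o) (ins n o) +
    edisc c (ring_time n.+1 o) * reward rho c N n.+1 o.
  by rewrite ring_timeS ediscD ?ring_time_ge0 ?ltW//; ring.
rewrite !E !mulrDr [leRHS]addrACA lerD//; last first.
  by apply: IH => m nm mN; apply: nw; [exact: ltnW|rewrite -addSnnS].
set q := rho _ _ _; have : 0 <= q by apply: r0.
rewrite le_eqVlt => /predU1P[<-|q0]; first by rewrite !mulr0 addr0.
rewrite !mulrA -mulrDl ler_wpM2r ?(ltW q0)// edisc_split ?ring_time_ge0//.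
move=> /andP[tT tT']; apply: (nw n) => //; first by rewrite addnS ltnS leq_addr.
Qed.

End PathwiseRewards.

(** * Propagation along paths and the second moment method *)

Section WindowEstimate.
Implicit Types (x y z : site d) (s : seq 'I_d).
Variable h : site d -> int.
Hypothesis h_dir : forall y k, h (y + dir k) = h y + 1.
Variables (M th : R) (N : nat).
Hypothesis th_gt0 : 0 < th.
Hypothesis M_ge0 : 0 <= M.
Hypothesis xi_adm : admissible M xi.
Hypothesis xi_le1 : forall y, num R xi y <= 1.
Hypothesis N_large : M * ((1 + lam) * M / ((1 + lam) * M + th)) ^+ N <= 1.

Fixpoint walk (x : site d) (s : seq 'I_d) : site d :=
  if s is k :: s' then walk (x + dir k) s' else x.

Lemma loss_bounded x : exists K : R, forall eta y j, `|loss R x eta y j| <= K.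
Proof.
by exists 1 => eta y j; have /andP[? ?] := loss_bound R x eta y j; rewrite ger0_norm.
Qed.

Lemma gain_bounded x : exists K : R, forall eta y j, `|gain R x eta y j| <= K.
Proof. by exists 2 => eta y j; apply: gain_bound. Qed.

Lemma jump_dev_bounded x k :
  exists K : R, forall eta y j, `|jump_dev dir pd x k eta y j| <= K.
Proof.
exists (1 + `|pd k|) => eta y j; rewrite /jump_dev (le_trans (ler_normB _ _))//.
apply: lerD; first by rewrite /jump_reward; case: (_ && _); rewrite ?normr1 ?normr0.
rewrite normrM -[leRHS]mulr1 ler_wpM2l//.
by have /andP[? ?] := loss_bound R x eta y j; rewrite ger0_norm.
Qed.

Let Y x o := reward (loss R x) th N 0 o.
Let dev x k o := reward (jump_dev dir pd x k) th N 0 o.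
Let Z x o := num R xi x + reward (gain R x) th N 0 o.

Let w_ge0 : 0 <= w.
Proof. by rewrite -pr_A0 fine_ge0. Qed.

Let bA0 : bounded_mfun (\1_A0 : O -> R) := bmf_indic mA0.

(** Each edge pays by Chebyshev for a deviation above [tau] in the jumps along it, and by Markov for
    more than [tau] uncompensated arrivals; a total below 1 excludes both on the whole path. *)
Fixpoint path_cost (tau : R) s x o : R :=
  if s is k :: s' then
    dev x k o ^+ 2 / tau ^+ 2 + Z (x + dir k) o / tau + path_cost tau s' (x + dir k) o
  else 0.

Let Z_ge0 x o : 0 <= Z x o.
Proof. by have := reward_gain_ge0 x N 0 o th_gt0. Qed.

Let Y_ge0 x o : 0 <= Y x o.
Proof. by apply: reward_ge0 => eta y j; have /andP[] := loss_bound R x eta y j. Qed.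

Lemma path_cost_ge0 tau s x o : 0 < tau -> 0 <= path_cost tau s x o.
Proof.
move=> t0; elim: s x => //= k s IH x.
by rewrite !addr_ge0 ?IH// divr_ge0 ?sqr_ge0 ?Z_ge0 ?exprn_ge0// ltW.
Qed.

(** Without such an excess the next site has at least [pmin * alpha - 2 * tau] losses, and [2 * tau]
    is at most half of [pmin * alpha], so an edge keeps a proportion [pmin / 2]. Smallness is
    required at the end of the path, where it is most demanding. *)
Lemma path_transfer pmin tau s x alpha o :
  0 < pmin -> (forall k, pmin <= pd k) -> 0 < tau ->
  2 * tau <= alpha * (pmin / 2) ^+ size s -> alpha <= Y x o ->
  alpha * (pmin / 2) ^+ size s <= Y (walk x s) o \/ 1 <= path_cost tau s x o.
Proof.
move=> p0 pmin_le t0; elim: s x alpha => [|k s IH] x alpha /=.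
  by rewrite expr0 mulr1 => _ ->; left.
move=> small aY; set y := x + dir k; set alpha' := alpha * (pmin / 2).
have p1 : pmin / 2 <= 1.
  have le1 : pd k <= 1 by rewrite -p_dir_sum (bigD1 k)//= lerDl sumr_ge0// => l _; apply: ltW.
  have := le_trans (pmin_le k) le1; lra.
have p20 : 0 <= pmin / 2 by rewrite divr_ge0// ltW.
have a0 : 0 <= alpha.
  rewrite leNgt; apply/negP => a0.
  have : alpha * (pmin / 2) ^+ (size s).+1 <= 0.
    by rewrite mulr_le0_ge0 ?exprn_ge0// ltW.
  by move=> /(le_trans small); rewrite leNgt mulr_gt0.
have cs := path_cost_ge0 s y o t0.
have cd : 0 <= dev x k o ^+ 2 / tau ^+ 2 by rewrite divr_ge0 ?sqr_ge0.
have cZ : 0 <= Z y o / tau by rewrite divr_ge0// ltW.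
have [dt|td] := leP `|dev x k o| tau; last first.
  right; rewrite -addrA ler_wpDr//; first by rewrite addr_ge0.
  rewrite ler_pdivlMr ?exprn_gt0// mul1r -[leRHS]real_normK ?num_real//.
  by rewrite ler_sqr ?nnegrE ?normr_ge0 ?(ltW t0) ?(ltW td).
have [Zt|tZ] := leP (Z y o) tau; last first.
  right; rewrite -addrA ler_wpDl// ler_wpDr//.
  by rewrite ler_pdivlMr// mul1r ltW.
have small' : 2 * tau <= alpha' * (pmin / 2) ^+ size s.
  by rewrite /alpha' -mulrA -exprS.
have Yy : alpha' <= Y y o.
  have J : dev x k o + pd k * Y x o - Z y o <= Y y o.
    apply: (@le_trans _ _ (reward (fun e z j => jump_reward R dir x k e z j +
        (-1) * gain R y e z j) th N 0 o)).
      rewrite rewardD rewardZ /Z mulN1r opprD addrA.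
      have -> : reward (jump_reward R dir x k) th N 0 o = dev x k o + pd k * Y x o.
        rewrite /dev /Y -rewardZ -rewardD; congr reward.
        by apply/funext => e; apply/funext => z; apply/funext => j; rewrite /jump_dev addrNK.
      by rewrite lerD2r gerDl oppr_le0 num_ge0.
    by apply: reward_le => e z j; rewrite mulN1r; apply: loss_ge_gain.
  have d1 : - tau <= dev x k o by move: dt; rewrite ler_norml => /andP[].
  have d2 : pmin * alpha <= pd k * Y x o by rewrite ler_pM// ltW.
  have d3 : 2 * tau <= alpha'.
    apply: (le_trans small'); rewrite -[leRHS]mulr1 ler_wpM2l//.
      by rewrite /alpha' mulr_ge0.
    exact: exprn_ile1.
  rewrite /alpha' in d3 *; lra.
have [H|H] := IH y alpha' small' Yy; [left|right].
  by rewrite exprS mulrA.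
by rewrite -addrA ler_wpDl// ler_wpDl.
Qed.

Lemma bmf_path_cost tau s x : bounded_mfun (path_cost tau s x).
Proof.
elim: s x => [|k s IH] x /=; first exact: bmf_cst.
apply: bmfD => //; apply: bmfD.
  apply: bmfM; last exact: bmf_cst.
  by apply: bmfX; apply: bmf_reward => //; apply: jump_dev_bounded.
apply: bmfM; last exact: bmf_cst.
by apply: bmfD; [exact: bmf_cst|apply: bmf_reward => //; apply: gain_bounded].
Qed.

Lemma mean_Y_le x th' N' : 0 < th' ->
  mean Pr (fun o => \1_A0 o * reward (loss R x) th' N' 0 o) <= w / th'.
Proof.
move=> th0; rewrite mean_reward//; last exact: loss_bounded.
rewrite ler_wpM2l//.
apply: le_trans (mom1_loss_le _ _ _ _ h_dir x th0 N' xi_adm) _ => //.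
exact: nsum_gfun_le.
Qed.

(** Per edge, [1 / th] bounds the second moment of the deviation and 3 the mean of the uncompensated
    arrivals. *)
Lemma mean_path_cost tau s x : 0 < tau ->
  mean Pr (fun o => \1_A0 o * path_cost tau s x o) <=
  w * (size s)%:R * ((th * tau ^+ 2)^-1 + 3 / tau).
Proof.
move=> t0; elim: s x => [|k s IH] x /=.
  rewrite mulr0 mul0r (_ : (fun o => _) = fun=> 0).
    by rewrite /mean Rintegral_cst// mul0r.
  by apply/funext => o; rewrite mulr0.
set y := x + dir k.
have bd2 : bounded_mfun (fun o => \1_A0 o * dev x k o ^+ 2).
  apply: bmfM => //; apply: bmfX.
  by apply: bmf_reward => //; apply: jump_dev_bounded.
have bg : bounded_mfun (fun o => \1_A0 o * reward (gain R y) th N 0 o).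
  by apply: bmfM => //; apply: bmf_reward => //; apply: gain_bounded.
have bc : bounded_mfun (fun o => \1_A0 o * path_cost tau s y o).
  by apply: bmfM => //; apply: bmf_path_cost.
apply: (@le_trans _ _ (mean Pr (fun o => tau ^- 2 * (\1_A0 o * dev x k o ^+ 2) +
    tau^-1 * (num R xi y * \1_A0 o + \1_A0 o * reward (gain R y) th N 0 o) +
    \1_A0 o * path_cost tau s y o))).
  rewrite le_eqVlt; apply/orP; left; apply/eqP; congr mean; apply/funext => o.
  by rewrite /Z -/y; ring.
have bgn : bounded_mfun (fun o => num R xi y * \1_A0 o +
    \1_A0 o * reward (gain R y) th N 0 o) by apply: bmfD => //; apply: bmfZ.
rewrite meanD//; last by apply: bmfD; apply: bmfZ.
rewrite meanD; [|exact: bmfZ|exact: bmfZ].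
rewrite !meanZ// meanD//; last exact: bmfZ.
rewrite meanZ// mean_indic// pr_A0.
rewrite mean_reward//; last exact: gain_bounded.
rewrite mean_reward2//; last exact: jump_dev_bounded.
have m2 : mom2 lam dir pd th (jump_dev dir pd x k) N xi <= th^-1.
  apply: le_trans (mom2_jump_dev_le _ _ _ _ _ x k N th_gt0 xi_adm) _ => //.
  apply: le_trans (mom1_loss_le _ _ _ _ h_dir x th_gt0 N xi_adm) _ => //.
  exact: nsum_gfun_le.
have m1 : num R xi y + mom1 lam dir pd th (gain R y) N xi <= 3.
  exact: (mom1_gain_le lam_gt0 p_dir_gt0 p_dir_sum dir_neq0 h_dir y th_gt0 M_ge0 xi_adm).
set X := _ + 3 / tau.
have -> : w * (size s).+1%:R * X = w * X + w * (size s)%:R * X.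
  by rewrite -[(size s).+1%:R]natr1; ring.
rewrite lerD ?IH// /X [w * (_ + _)]mulrDr lerD//.
  have -> : w / (th * tau ^+ 2) = tau ^- 2 * (w * th^-1) by rewrite invfM; ring.
  by rewrite ler_wpM2l ?invr_ge0 ?sqr_ge0// ler_wpM2l.
rewrite [num _ _ _ * w]mulrC -mulrDr mulrC -mulrA ler_wpM2l// ler_wpM2r//.
by rewrite invr_ge0 ltW.
Qed.

Lemma measurable_in_window (T T' : R) x n :
  measurable [set o | in_window T T' (loss R x) n o].
Proof.
have mS : measurable_fun setT (ring_time n.+1).
  by apply: emeasurable_sum => k; apply: mdl.
rewrite (_ : mkset _ = (setT `&` [set o | T%:E < ring_time n.+1 o]%E) `&`
    (setT `&` [set o | ring_time n.+1 o <= T'%:E]%E) `&`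
    (setT `&` (fun o => loss R x (st n o) (rg n o) (ins n o)) @^-1` `]0, +oo[%classic)).
  apply: measurableI.
    by apply: measurableI; [exact: emeasurable_fun_o_infty|exact: emeasurable_fun_infty_c].
  by apply: (bmf_rho (loss_bounded x) n).1 => //; apply: measurable_itv.
apply/seteqP; split => o /=.
  by move=> [? ? ?]; rewrite in_itv/= andbT.
by rewrite in_itv/= andbT => -[[[_ ?] [_ ?]] [_ ?]].
Qed.

Definition all_lose (T T' : R) z (B : seq (seq 'I_d)) : set O :=
  [set o | forall s, s \in B ->
    exists2 n, (n < N)%N & in_window T T' (loss R (walk z s)) n o].

Lemma measurable_all_lose T T' z B : measurable (all_lose T T' z B).
Proof.
elim: B => [|s B IH].
  by rewrite (_ : all_lose _ _ _ _ = setT)//; apply/seteqP; split.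
rewrite (_ : all_lose _ _ _ _ =
    \bigcup_(n in [set n | (n < N)%N]) [set o | in_window T T' (loss R (walk z s)) n o]
    `&` all_lose T T' z B).
  apply: measurableI => //; apply: fin_bigcup_measurable => [|n _].
    exact: finite_II.
  exact: measurable_in_window.
apply/seteqP; split => o /=.
  move=> H; split; last by move=> s' sB; apply: H; rewrite inE sB orbT.
  by have [n nN Hn] := H s (mem_head _ _); exists n.
move=> [[n nN Hn] H] s'; rewrite inE => /predU1P[->|]; last exact: H.
by exists n.
Qed.

Lemma bmf_loss_reward x (th' : R) : 0 < th' ->
  bounded_mfun (reward (loss R x) th' N 0).
Proof. by move=> th0; apply: bmf_reward => //; apply: loss_bounded. Qed.

(* By AM-GM, [Y z <= a + be * Y z ^+ 2 + 1 / (4 * be)], where the last term is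
   needed only if [a <= Y z]; then either all targets [walk z s] lose a particle
   in the window or some [cost s] is at least [1]. *)
Lemma window_estimate (T T' b pmin tau : R) K z (B : seq (seq 'I_d)) :
  th <= 1 -> 0 < T -> 0 < b -> 0 < pmin -> pmin <= 1 -> (forall k, pmin <= pd k) -> 0 < tau ->
  (forall s, s \in B -> (size s <= K)%N) ->
  2 * tau <= b / (2 * th) * (pmin / 2) ^+ K ->
  expR (- (th * T' / 2)) * (2 / th) <= 1 ->
  (size B)%:R * (K%:R * ((th * tau ^+ 2)^-1 + 3 / tau) + (expR 1 * T + 1) / tau)
    <= b ^+ 2 / 16 ->
  b / th <= mom1 lam dir pd th (loss R z) N xi ->
  w * (b ^+ 2 / 16) <= fine (Pr (A0 `&` all_lose T T' z B)).
Proof.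
move=> th1 T0 b0 p0 p1 pmin_le t0 BK small T'large Bsmall b_le.
have mH := measurable_all_lose T T' z B.
(* [a] is half of [b / th], and [be] makes the second-moment term [be * (2 / th ^+ 2)] a quarter of
   it. The quarter left, times [4 * be = b * th / 2], is [b ^+ 2 / 8], of which the costs take
   half. *)
pose a := b / (2 * th); pose be := b * th / 8.
have a0 : 0 < a by rewrite divr_gt0// mulr_gt0.
have be0 : 0 < be by rewrite divr_gt0// mulr_gt0.
pose ex := expR (- (th * T' / 2)).
pose Q x o := expR 1 * reward (loss R x) T^-1 N 0 o + ex * reward (loss R x) (th / 2) N 0 o.
have loss0 x eta y j : 0 <= loss R x eta y j by have /andP[] := loss_bound R x eta y j.
have Q0 x o : 0 <= Q x o.
  by rewrite addr_ge0// mulr_ge0 ?expR_ge0// reward_ge0.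
pose cost s o := path_cost tau s z o + tau^-1 * Q (walk z s) o.
have cost0 s o : 0 <= cost s o.
  by rewrite addr_ge0 ?path_cost_ge0// mulr_ge0 ?invr_ge0// ltW.
have sumcost0 o : 0 <= \sum_(s <- B) cost s o by apply: sumr_ge0.
have dich o : a <= Y z o -> 1 <= \1_(all_lose T T' z B) o + \sum_(s <- B) cost s o.
  move=> aY; rewrite indicE.
  have [_|] := boolP (o \in _); first by rewrite ler_wpDr.
  rewrite notin_setE /= => noH; rewrite add0r.
  have [s sB nw] : exists2 s, s \in B &
      forall n, (n < N)%N -> ~ in_window T T' (loss R (walk z s)) n o.
    apply: contrapT => H; apply: noH => s sB; apply: contrapT => H'.
    by apply: H; exists s => // n nN nw; apply: H'; exists n.
  apply: (@le_trans _ _ (cost s o)); last first.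
    by rewrite (big_rem s)//= lerDl sumr_ge0.
  have p2 : (pmin / 2) ^+ K <= (pmin / 2) ^+ size s.
    by rewrite ler_wiXn2l ?BK ?divr_ge0 ?(ltW p0)//; lra.
  have small_s : 2 * tau <= a * (pmin / 2) ^+ size s.
    by apply: le_trans small _; rewrite ler_wpM2l// ltW.
  have [Ys|c1] := path_transfer p0 pmin_le t0 small_s aY; last first.
    by rewrite ler_wpDr// mulr_ge0 ?invr_ge0 ?Q0// ltW.
  rewrite ler_wpDl ?path_cost_ge0// mulrC ler_pdivlMr// mul1r.
  (* The end of the path has at least [2 * tau] discounted losses, none of them in the window: then
     [Q], which bounds losses outside it, exceeds [tau]. *)
  have YQ : Y (walk z s) o <= Q (walk z s) o.
    have := @reward_no_window (loss R (walk z s)) th T T' N 0 o th_gt0 T0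
      (loss0 _) (fun m _ mN => nw m mN).
    by rewrite /ring_time big_ord0 /= !mulr0 expR0 !mul1r.
  apply: le_trans YQ; apply: le_trans Ys; apply: le_trans small_s.
  by rewrite mulr_natl mulr2n lerDl ltW.
have ptw o : Y z o <= a + be * Y z o ^+ 2 +
    (4 * be)^-1 * (\1_(all_lose T T' z B) o + \sum_(s <- B) cost s o).
  have i0 : 0 <= (4 * be)^-1 by rewrite invr_ge0 mulr_ge0// ltW.
  have ind0 : 0 <= \1_(all_lose T T' z B) o :> R by rewrite indicE.
  have sq : 0 <= be * Y z o ^+ 2 by rewrite mulr_ge0 ?sqr_ge0// ltW.
  have [aY|Ya] := leP a (Y z o); last first.
    by rewrite -addrA (le_trans (ltW Ya))// lerDl addr_ge0// mulr_ge0// addr_ge0.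
  have amgm : Y z o <= be * Y z o ^+ 2 + (4 * be)^-1.
    rewrite -subr_ge0; set t := Y z o.
    have -> : be * t ^+ 2 + (4 * be)^-1 - t = (2 * be * t - 1) ^+ 2 / (4 * be).
      by field; rewrite gt_eqF.
    by rewrite divr_ge0 ?sqr_ge0// mulr_ge0// ltW.
  apply: (le_trans amgm); rewrite -addrA ler_wpDl ?(ltW a0)// lerD2l.
  by rewrite -[leLHS]mulr1 ler_wpM2l// dich.
have bY := bmf_loss_reward z th_gt0.
have bAY : bounded_mfun (fun o => \1_A0 o * Y z o) by apply: bmfM.
have bAY2 : bounded_mfun (fun o => \1_A0 o * Y z o ^+ 2).
  by apply: bmfM => //; apply: bmfX.
have bH : bounded_mfun (\1_(A0 `&` all_lose T T' z B) : O -> R).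
  by apply: bmf_indic; apply: measurableI.
have T'0 : 0 < T^-1 by rewrite invr_gt0.
have th2 : 0 < th / 2 by rewrite divr_gt0.
have bQ x : bounded_mfun (fun o => \1_A0 o * Q x o).
  by apply: bmfM => //; apply: bmfD; apply: bmfZ; apply: bmf_loss_reward.
have bC s : bounded_mfun (fun o => \1_A0 o * cost s o).
  apply: bmfM => //; apply: bmfD; first exact: bmf_path_cost.
  by apply: bmfZ; apply: bmfD; apply: bmfZ; apply: bmf_loss_reward.
pose P := fine (Pr (A0 `&` all_lose T T' z B)).
have costle s : s \in B -> mean Pr (fun o => \1_A0 o * cost s o) <=
    w * (K%:R * ((th * tau ^+ 2)^-1 + 3 / tau) + (expR 1 * T + 1) / tau).
  move=> sB.
  have bp : bounded_mfun (fun o => \1_A0 o * path_cost tau s z o).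
    by apply: bmfM => //; apply: bmf_path_cost.
  have -> : mean Pr (fun o => \1_A0 o * cost s o) =
      mean Pr (fun o => \1_A0 o * path_cost tau s z o) +
      tau^-1 * mean Pr (fun o => \1_A0 o * Q (walk z s) o).
    rewrite -meanZ// -meanD//; last exact: bmfZ.
    by congr mean; apply/funext => o; rewrite /cost; ring.
  rewrite mulrDr lerD//.
    apply: le_trans (mean_path_cost s z t0) _.
    rewrite -mulrA ler_wpM2l// ler_wpM2r ?ler_nat ?BK//.
    by rewrite addr_ge0// ?invr_ge0 ?divr_ge0 ?mulr_ge0 ?sqr_ge0// ltW.
  rewrite [leLHS]mulrC [leRHS]mulrA ler_wpM2r ?invr_ge0 ?(ltW t0)//.
  have -> : mean Pr (fun o => \1_A0 o * Q (walk z s) o) =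
      expR 1 * mean Pr (fun o => \1_A0 o * reward (loss R (walk z s)) T^-1 N 0 o) +
      ex * mean Pr (fun o => \1_A0 o * reward (loss R (walk z s)) (th / 2) N 0 o).
    rewrite -!meanZ; last 2 first.
    - by apply: bmfM => //; apply: bmf_loss_reward.
    - by apply: bmfM => //; apply: bmf_loss_reward.
    rewrite -meanD.
    - by congr mean; apply/funext => o; rewrite /Q; ring.
    - by apply: bmfZ; apply: bmfM => //; apply: bmf_loss_reward.
    - by apply: bmfZ; apply: bmfM => //; apply: bmf_loss_reward.
  rewrite mulrDr lerD//.
    rewrite [w * _]mulrCA ler_wpM2l ?expR_ge0//.
    by apply: le_trans (mean_Y_le _ _ T'0) _; rewrite invrK.
  apply: (@le_trans _ _ (ex * (w / (th / 2)))).
    by rewrite ler_wpM2l ?expR_ge0// mean_Y_le.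
  rewrite mulrCA ler_wpM2l//; apply: le_trans T'large.
  by rewrite le_eqVlt; apply/orP; left; rewrite invfM invrK /ex [_^-1 * 2]mulrC.
have main : w * (b / th) <= w * a + be * (w * (th^-1 ^+ 2 + th^-1)) +
    (4 * be)^-1 * (P + w * (b ^+ 2 / 16)).
  apply: (@le_trans _ _ (mean Pr (fun o => \1_A0 o * Y z o))).
    by rewrite /Y mean_reward ?ler_wpM2l//; apply: loss_bounded.
  apply: (@le_trans _ _ (mean Pr (fun o => a * \1_A0 o + be * (\1_A0 o * Y z o ^+ 2) +
      (4 * be)^-1 * (\1_(A0 `&` all_lose T T' z B) o +
        \sum_(s <- B) \1_A0 o * cost s o)))).
    apply: ler_mean => //.
      apply: bmfD; first by apply: bmfD; apply: bmfZ.
      by apply: bmfZ; apply: bmfD => //; apply: bmf_sum.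
    move=> o; rewrite indicI /= -mulr_sumr -mulrDr.
    have -> : a * \1_A0 o + be * (\1_A0 o * Y z o ^+ 2) + (4 * be)^-1 *
        (\1_A0 o * (\1_(all_lose T T' z B) o + \sum_(s <- B) cost s o)) =
        \1_A0 o * (a + be * Y z o ^+ 2 + (4 * be)^-1 *
          (\1_(all_lose T T' z B) o + \sum_(s <- B) cost s o)) by ring.
    by rewrite ler_wpM2l// indicE.
  rewrite meanD; last 2 first.
  - by apply: bmfD; apply: bmfZ.
  - by apply: bmfZ; apply: bmfD => //; apply: bmf_sum.
  rewrite meanD; [|exact: bmfZ|exact: bmfZ].
  rewrite !meanZ//; last by apply: bmfD => //; apply: bmf_sum.
  rewrite meanD//; last exact: bmf_sum.
  rewrite mean_sum// !mean_indic//; last exact: measurableI.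
  rewrite pr_A0 -/P mean_reward2//; last exact: loss_bounded.
  rewrite lerD//.
    rewrite [a * w]mulrC lerD2l ler_wpM2l ?(ltW be0)// ler_wpM2l//.
    exact: (mom2_loss_le_sparse lam_gt0 p_dir_gt0 p_dir_sum dir_neq0 h_dir z N th_gt0 xi_adm).
  have ibe : 0 <= (4 * be)^-1 by rewrite invr_ge0 mulr_ge0// ltW.
  rewrite ler_wpM2l// lerD2l.
  apply: (@le_trans _ _ (\sum_(s <- B) w *
     (K%:R * ((th * tau ^+ 2)^-1 + 3 / tau) + (expR 1 * T + 1) / tau))).
    by rewrite big_seq [leRHS]big_seq; apply: ler_sum.
  rewrite -mulr_sumr ler_wpM2l//; apply: le_trans Bsmall.
  by move: (K%:R * _ + _) => X; rewrite big_const_seq count_predT iter_addr_0 mulr_natl.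
have th_le : th^-1 <= th^-1 ^+ 2.
  by rewrite expr2 ler_pMr ?invr_gt0// invf_ge1.
have main2 : w * (b / th) <= w * a + be * (w * (2 * th^-1 ^+ 2)) +
    (4 * be)^-1 * (P + w * (b ^+ 2 / 16)).
  apply: (le_trans main); rewrite lerD2r lerD2l ler_wpM2l ?(ltW be0)// ler_wpM2l//.
  by rewrite mulr_natl mulr2n lerD2l.
have E : w * (b / th) - w * a - be * (w * (2 * th^-1 ^+ 2)) = w * b / (4 * th).
  by rewrite /a /be; field; rewrite gt_eqF.
have {main main2} : w * b / (4 * th) <= (4 * be)^-1 * (P + w * (b ^+ 2 / 16)).
  by rewrite -E; lra.
rewrite [X in _ <= X -> _]mulrC ler_pdivlMr ?mulr_gt0// => H.
have E2 : w * b / (4 * th) * (4 * be) = w * (b ^+ 2 / 8).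
  by rewrite /be; field; rewrite gt_eqF.
rewrite -/P; move: H; rewrite E2; lra.
Qed.

End WindowEstimate.

End JumpChain.

(** * Activity of a finite set of sites *)

Section Directions.
Variables (R : realType) (d : nat) (p : site d -> R).
Hypothesis p_jump : jump_distribution p.
Hypothesis p_directed : directed p.

Definition unit_site (k : 'I_d) : site d := delta_mx 0 k.

Definition sgn (k : 'I_d) : int := if p (unit_site k) != 0 then 1 else -1.

(* The one of the two sites [unit_site k] and [- unit_site k] to which the
   walkers can jump. *)
Definition dir (k : 'I_d) : site d := sgn k *: unit_site k.

Definition height (y : site d) : int := \sum_k sgn k * y 0 k.

Lemma sgn_sqr k : sgn k * sgn k = 1.
Proof. by rewrite /sgn; case: ifP. Qed.

Lemma dirE k l : dir k 0 l = sgn k * (l == k)%:R.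
Proof. by rewrite /dir !mxE eqxx. Qed.

Lemma sgn_neq0 k : sgn k != 0.
Proof. by rewrite /sgn; case: ifP. Qed.

Lemma dir_neq0 k : dir k != 0.
Proof.
apply/eqP => /matrixP/(_ 0 k); rewrite dirE mxE eqxx mulr1 => /eqP.
by rewrite (negPf (sgn_neq0 k)).
Qed.

Lemma dir_inj : injective dir.
Proof.
move=> k l /matrixP/(_ 0 k); rewrite !dirE eqxx mulr1.
case: (k =P l) => // _ /eqP; rewrite mulr0.
by rewrite (negPf (sgn_neq0 k)).
Qed.

Lemma height_dir y k : height (y + dir k) = height y + 1.
Proof.
rewrite /height; under eq_bigr do rewrite mxE mulrDr.
rewrite big_split /=; congr (_ + _).
rewrite (bigD1 k)//= dirE eqxx mulr1 sgn_sqr big1 ?addr0// => l lk.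
by rewrite dirE (negPf lk) !mulr0.
Qed.

(** Directedness forbids two opposite jumps, so a possible jump along axis [k] is the one selected
    by [sgn]. *)
Lemma p_supp z : p z != 0 -> exists k, z = dir k.
Proof.
move=> pz; have [p0 _ p_unit _] := p_jump; have [v pv] := p_directed.
have [k [zE|zE]] := p_unit z pz; exists k; rewrite /dir /sgn.
  by rewrite /unit_site -zE pz scale1r.
suff -> : p (unit_site k) = 0 by rewrite eqxx/= scaleN1r.
apply: (pv); have : 0 < \sum_(i < d) v 0 i * (z 0 i)%:~R.
  by rewrite ltNge; apply: contra_neqN pz => /pv.
rewrite -oppr_lt0 -sumrN => /ltW; apply: le_trans.
by apply: ler_sum => i _; rewrite zE !mxE mulrNz mulrN opprK.
Qed.

(** Otherwise every jump stays in the proper subgroup [x 0 k = 0], and the support does not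
    generate. *)
Lemma p_dir_gt0 k : 0 < p (dir k).
Proof.
have [p0 _ p_unit gen] := p_jump.
rewrite lt_neqAle p0 andbT eq_sym; apply/eqP => pk.
pose H : set (site d) := [set x | x 0 k = 0].
have : H = setT.
  apply: gen => [|x y Hx Hy|y py].
  - by rewrite /H /= mxE.
  - by rewrite /H /= !mxE Hx Hy subrr.
  - have [l yl] := p_supp py; rewrite /H /= yl dirE.
    case: (k =P l) => [kl|]; last by rewrite mulr0.
    by case/negP: py; rewrite yl -kl; apply/eqP.
move/seteqP => [_ /(_ (dir k) I)]; rewrite /H /= dirE eqxx mulr1 => /eqP.
by rewrite (negPf (sgn_neq0 k)).
Qed.

Lemma p_dir_sum : \sum_k p (dir k) = 1.
Proof.
have [p0 p1 _ _] := p_jump.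
apply: EFin_inj; rewrite -sumEFin -[RHS]p1.
have -> : (\esum_(y in [set: site d]) (p y)%:E = \esum_(y in range dir) (p y)%:E)%E.
  rewrite [RHS]esum_mkcond; apply: eq_esum => y _.
  case: ifP => // /negP ny; congr (_%:E); apply/eqP; apply: contraT => py.
  by case: ny; rewrite inE; have [k ->] := p_supp py; exists k.
rewrite esum_fset; last 2 first.
- by apply: finite_image; apply: finite_finset.
- by move=> y _; rewrite lee_fin.
rewrite fsbig_image; last by move=> ? ? _ _; apply: dir_inj.
rewrite -big_enum /= fsbig_seq ?enum_uniq//; apply: eq_fsbigl.
by apply/seteqP; split => // k _ /=; rewrite mem_enum.
Qed.

Lemma walkE z s : walk dir z s = z + \sum_(k <- s) dir k.
Proof.
by elim: s z => [|k s IH] z /=; rewrite ?big_nil ?addr0// IH big_cons addrA.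
Qed.

(** [n] steps backwards in every direction lead upstream of all targets, since [n] dominates all
    their coordinates. *)
Lemma walk_reaches (S : seq (site d)) : exists z, forall x : site d, x \in S ->
  exists s, walk dir z s = x.
Proof.
pose n := (\sum_(x <- S) \sum_(k < d) absz (x ord0 k))%N.
exists (- (\sum_k dir k *+ n)) => x xS.
have le k : 0 <= sgn k * x 0 k + n%:Z.
  have : (absz (x 0%R k) <= n)%N.
    rewrite /n (big_rem x)//= (bigD1 k)//= -addnA.
    exact: leq_addr.
  rewrite -lez_nat => H; rewrite -lerBlDr sub0r lerNl; apply: le_trans H.
  rewrite abszE (le_trans (ler_norm _))// normrN normrM.
  by rewrite /sgn; case: ifP; rewrite ?normrN normr1 mul1r.
pose a k := absz (sgn k * x 0 k + n%:Z).
exists (flatten [seq nseq (a k) k | k <- enum 'I_d]).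
rewrite walkE big_flatten big_map /= big_enum /=.
rewrite [X in _ + X](eq_bigr (fun k => dir k *+ a k)); last first.
  move=> k _; elim: (a k) => [|t IH] /=; first by rewrite big_nil.
  by rewrite big_cons IH mulrS.
rewrite addrC -sumrB; apply/rowP => l; rewrite summxE (bigD1 l)//=.
have E k : (dir k *+ a k - dir k *+ n) 0 l = (l == k)%:R * x 0 l.
  have mulmxn (B : site d) t : (B *+ t) 0 l = B 0 l *+ t.
    by elim: t => [|t IH]; rewrite ?mulr0n ?mxE// !mulrS mxE IH.
  rewrite mxE [X in _ + X]mxE !mulmxn dirE; case: (l =P k) => [->|_]; last first.
    by rewrite mulr0 !mul0rn subr0 mul0r.
  rewrite mulr1 mul1r -[sgn k *+ a k]mulr_natr -[sgn k *+ n]mulr_natr -mulrBr.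
  have -> : (a k)%:R = sgn k * x ord0 k + n%:Z :> int.
    by rewrite /a natz gez0_abs.
  by rewrite -natz addrK mulrA sgn_sqr mul1r.
rewrite E eqxx mul1r big1 ?addr0// => k kl.
by rewrite E eq_sym (negPf kl) mul0r.
Qed.

End Directions.

(** * Measurability of activity events *)

Section PathEvents.
Variables (R : realType) (d : nat).
Implicit Types (B : set (site d)) (T : R).

(** Rational times make the event a countable combination of cylinders; [stays_activeE] passes from
    real to rational times by right-continuity. *)
Definition active_in B T T' : set (Defs.path R d) :=
  [set v | forall x, B x -> exists q : rat,
    [/\ T <= ratr q, ratr q <= T' & (0 < occ_active (v (ratr q : R) x))%N]].

(** The class [G] is left free to cover both the local events, for the limit in volume, and the
    whole sigma-algebra. *)
Lemma measurable_active_in B T T' (G : set (set (Defs.path R d))) : finite_set B ->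
  (forall x s a, B x -> T <= s <= T' -> G [set v : Defs.path R d | v s x = a]) ->
  <<s G >> (active_in B T T').
Proof.
move=> finB GB; pose X := g_sigma_algebraType G.
have mG A : G A -> measurable (A : set X) by move=> GA; apply: sub_gen_smallest.
suff : measurable (active_in B T T' : set X) by [].
rewrite (_ : active_in B T T' = \bigcap_(x in B) \bigcup_(q : rat)
    \bigcup_(k : nat) [set v : Defs.path R d |
      T <= (ratr q : R) <= T' /\ v (ratr q : R) x = Act k.+1]).
  apply: fin_bigcap_measurable => // x Bx.
  apply: bigcupT_measurable_rat => q; apply: bigcupT_measurable => k.
  have [qT|qT] := boolP (T <= (ratr q : R) <= T').
    rewrite (_ : [set v | _] = [set v : Defs.path R d | v (ratr q : R) x = Act k.+1]).
      by apply: mG; apply: GB.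
    by apply/seteqP; split => v /=; [case|].
  rewrite (_ : [set v | _] = set0)//.
  by apply/seteqP; split => v //= -[].
apply/seteqP; split => v /=.
  move=> H x Bx; have [q [Tq qT aq]] := H x Bx; exists q => //.
  case E : (v (ratr q : R) x) aq => [[|k]|] //= _; exists k => //=.
  by rewrite Tq qT.
move=> H x Bx; have [q _ [k _ /= [/andP[Tq qT] E]]] := H x Bx.
by exists q; rewrite E.
Qed.

Definition active_after B T : set (Defs.path R d) :=
  [set v | forall x, B x -> exists q : rat,
    T <= (ratr q : R) /\ (0 < occ_active (v (ratr q : R) x))%N].

Lemma measurable_active_after B T : finite_set B -> 0 <= T ->
  measurable (active_after B T : set (path_space R d)).
Proof.
move=> finB T0.
(* Finitely many sites need finitely many times, and these fit in one bounded window. *)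
have -> : active_after B T = \bigcup_(n : nat) active_in B T (T + n%:R).
  apply/seteqP; split => v; last first.
    by move=> [n _ H] x Bx; have [q [? ? ?]] := H x Bx; exists q.
  move=> H.
  have bnd (A : set (site d)) : finite_set A -> A `<=` B ->
      exists n, active_in A T (T + n%:R) v.
    move=> /finite_fsetP[F ->] {A}; elim/finSet_rect: F => F IH FB.
    have [->|[x xF]] := fset_0Vmem F; first by exists 0%N.
    have [n Hn] : exists n, active_in [set` (F `\ x)%fset] T (T + n%:R) v.
      apply: IH; first exact: fproperD1.
      by move=> y /= yF; apply: FB; move: yF; rewrite !inE => /andP[].
    have [q [Tq aq]] := H x (FB x xF).
    exists (maxn n (Num.bound (ratr q - T))) => y /= yF.
    have [->|yx] := eqVneq y x.
      exists q; split => //; rewrite -lerBlDl (le_trans (ltW (archi_boundP _)))//.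
        by rewrite subr_ge0.
      by rewrite ler_nat leq_maxr.
    have [|q' [? q'T ?]] := Hn y; first by rewrite /= !inE yx.
    exists q'; split => //; apply: (le_trans q'T).
    by rewrite lerD2l ler_nat leq_maxl.
  by have [n] := bnd B finB (@subset_refl _ B); exists n.
apply: bigcupT_measurable => n; apply: measurable_active_in => // x s a Bx /andP[Ts sT].
by exists x, s, a; split => //; rewrite /= (le_trans T0).
Qed.

(** One index bounds both the enumerated sites and the time, so that the events decrease with
    [n]. *)
Lemma stays_activeE : @stays_active R d =
  \bigcap_(n : nat) active_after [set x | (choice.pickle x < n)%N] n%:R.
Proof.
apply/seteqP; split => v /=.
  move=> H n _ x _; have [t [t0 nt at_]] := H x n%:R.
  have [/(_ t t0)[e e0 He] _] := traj_cadlag v x.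
  have te : t < t + e by rewrite ltrDl.
  have [q] := rat_in_itvoo te.
  rewrite in_itv/= => /andP[tq qe]; exists q; split.
    by rewrite (le_trans nt)// ltW.
  by rewrite He ?(ltW tq) ?qe.
move=> H x T; pose n := maxn (choice.pickle x).+1 (Num.bound `|T|).
have [|q [nq aq]] := H n I x; first by rewrite /= /n leq_max ltnSn.
exists (ratr q); split => //; first by rewrite (le_trans _ nq).
rewrite (le_trans (ler_norm T))// (le_trans _ nq)//.
rewrite (le_trans (ltW (archi_boundP (normr_ge0 T))))// ler_nat /n.
by rewrite leq_maxr.
Qed.

End PathEvents.

(** * From losses at rings to activity of the trajectory *)

Section FiniteSystem.
Variables (R : realType) (d : nat) (p : site d -> R) (lam : R).
Hypothesis p_jump : jump_distribution p.
Hypothesis p_directed : directed p.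
Hypothesis lam_gt0 : 0 < lam.

Lemma measurable_config1 (xi : config d) :
  measurable ([set xi] : set (config_space d)).
Proof.
rewrite (_ : [set xi] = \bigcap_(x in [set: site d]) [set eta : config d | eta x = xi x]).
  rewrite -[X in measurable X]setCK setC_bigcap; apply: measurableC.
  apply: countable_bigcupT_measurable => [|x]; first exact: countableP.
  by apply: measurableC; apply: sub_gen_smallest; exists x, (xi x).
apply/seteqP; split => eta /=; first by move=> -> x _.
by move=> H; apply/funext => x; apply: H.
Qed.

Lemma finite_system_active (nu : probability (config_space d) R) (V : set (site d))
    (P : probability (path_space R d) R) (xi : config d) (w M th : R) (N : nat)
    (T T' b pmin tau : R) (K : nat) (z : site d) (B : seq (seq 'I_d))
    (C : set (site d)) :
  finite_ARW_law p lam nu V P ->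
  nu [set zeta | restrict_to V zeta = xi] = w%:E ->
  0 < th -> 0 <= M -> admissible M xi -> (forall y, num R xi y <= 1) ->
  M * ((1 + lam) * M / ((1 + lam) * M + th)) ^+ N <= 1 ->
  th <= 1 -> 0 < T -> 0 < b -> 0 < pmin -> pmin <= 1 ->
  (forall k, pmin <= p (dir p k)) -> 0 < tau ->
  (forall s, s \in B -> (size s <= K)%N) ->
  2 * tau <= b / (2 * th) * (pmin / 2) ^+ K ->
  expR (- (th * T' / 2)) * (2 / th) <= 1 ->
  (size B)%:R * (K%:R * ((th * tau ^+ 2)^-1 + 3 / tau) + (expR 1 * T + 1) / tau)
    <= b ^+ 2 / 16 ->
  b / th <= mom1 lam (dir p) (fun k => p (dir p k)) th (loss R z) N xi ->
  finite_set C -> (forall x, C x -> exists2 s, s \in B & x = walk (dir p) z s) ->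
  ((w * (b ^+ 2 / 16))%:E <= P (active_in C T T'))%E.
Proof.
move=> [dO [Sp [Pr [init [delay [ringer [instr [eta]]]]]]]].
move=> [[minit mdelay mringer minstr meta] delay0 law aetraj PE] nuxi.
move=> th0 M0 admxi xi1 Nlarge th1 T0 b0 p0 p1 pmin_le tau0 BK small T'large Bsmall ble finC CB.
pose A0 : set Sp := [set o | init o = xi].
have mA0 : measurable A0.
  rewrite (_ : A0 = setT `&` init @^-1` [set xi]); last by rewrite setTI.
  by apply: minit => //; apply: measurable_config1.
have lawE n (u : nat -> R) x i : (forall k, 0 <= u k) ->
    Pr (cell A0 delay ringer instr n u x i) = (w * \prod_(k < n)
    (expR (- (total_rate lam (topple_seq xi x i k) * u k)) *
    (ring_rate lam (topple_seq xi x i k) (x k) /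
       total_rate lam (topple_seq xi x i k)) *
    instruction_prob p lam (i k)))%:E.
  by move=> u0; rewrite EFinM -nuxi -law.
have est := window_estimate lam_gt0 (p_dir_gt0 p_jump p_directed)
  (p_dir_sum p_jump p_directed) (p_supp p_jump p_directed) (@dir_neq0 _ _ p)
  (@dir_inj _ _ p) admxi.1 mA0 mdelay mringer minstr delay0 lawE
  (@height_dir _ _ p) th0 M0 admxi xi1 Nlarge th1 T0 b0 p0 p1 pmin_le tau0 BK
  small T'large Bsmall ble.
set L := all_lose _ _ _ _ _ _ _ _ _ _ in est.
have mL : measurable L.
  exact: measurable_all_lose.
have mAL : measurable (A0 `&` L) by apply: measurableI.
have mF : measurable (active_in C T T' : set (path_space R d)).
  apply: measurable_active_in => // x s a Cx /andP[Ts _].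
  by exists x, s, a; split => //; rewrite /= (le_trans (ltW T0)).
rewrite PE//; move: aetraj => [Nl [mNl Nl0 Nlsub]].
have mE : measurable (eta @^-1` active_in C T T').
  by rewrite -[X in measurable X]setTI; apply: meta.
apply: (@le_trans _ _ (Pr (A0 `&` L))).
  by rewrite -[leRHS]fineK ?lee_fin// fin_num_measure.
apply: (@le_trans _ _ (Pr (eta @^-1` active_in C T T' `|` Nl))); last first.
  rewrite (le_trans (measureU2 _ _ _))//.
  by rewrite [X in (_ + X <= _)%E]Nl0 adde0.
apply: le_measure; rewrite ?inE//; first exact: measurableU.
move=> o [Ao Lo]; have [Nlo|nNlo] := pselect (Nl o); [by right|left].
have good : forall n t, 0 <= t ->
    (\sum_(k < n) delay k o <= t%:E < \sum_(k < n.+1) delay k o)%E ->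
    traj (eta o) t = topple_seq (init o) (ringer^~ o) (instr^~ o) n.
  by apply: contrapT => H; apply: nNlo; apply: Nlsub.
move=> x Cx; have [s sB ->] := CB x Cx.
have [n nN [TS ST' lossn]] := Lo s sB.
set S' := ring_time delay n.+1 o in TS ST'.
have S0 : (0 <= ring_time delay n o)%E by apply: ring_time_ge0.
have SS' : (ring_time delay n o < S')%E.
  rewrite /S' ring_timeS -[X in (X < _)%E]adde0.
  rewrite lteD2lE ?delay0//.
  rewrite ge0_fin_numE//; apply: le_lt_trans (ltry T'); apply: le_trans ST'.
  by rewrite /S' ring_timeS leeDl// ltW.
have [r1 r1E] : exists r, ring_time delay n o = r%:E.
  exists (fine (ring_time delay n o)); rewrite fineK// ge0_fin_numE//.
  by apply: lt_le_trans SS' _; rewrite leey.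
have [r2 r2E] : exists r, S' = r%:E.
  exists (fine S'); rewrite fineK// ge0_fin_numE; last by rewrite (le_trans S0)// ltW.
  by apply: le_lt_trans ST' _; rewrite ltry.
rewrite r1E lee_fin in S0; rewrite r1E r2E lte_fin in SS'.
rewrite r2E lte_fin in TS; rewrite r2E lee_fin in ST'.
(* The trajectory is constant between the two rings, and a site losing a particle at the second ring
   has an active one just before; any rational time in between and after [T] is a witness. *)
have mx : Num.max T r1 < r2 by rewrite gt_max TS SS'.
have [q] := rat_in_itvoo mx; rewrite in_itv/= gt_max => /andP[/andP[Tq rq] qr].
exists q; split; [exact: ltW|exact: le_trans (ltW qr) ST'|].
rewrite (good n); last 2 first.
- by rewrite (le_trans S0)// ltW.
- move: r1E r2E; rewrite /S' /ring_time => -> ->.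
  by rewrite lee_fin lte_fin qr ltW.
by rewrite Ao; apply: loss_active lossn.
Qed.

End FiniteSystem.

(** * Periodic initial configurations *)

Section PhaseLaw.
Variables (R : realType) (d m k : nat) (i0 : 'I_d).
Hypothesis k_le : (k <= m.+1)%N.

(* The [m.+1] phases of a configuration of period [m.+1] and density
   [k / m.+1]. *)
Definition phase (j : 'I_m.+1) : config_space d :=
  fun x : site d => if ((x ord0 i0 + j%:Z)%R %% m.+1 < k%:Z)%Z then Act 1 else Act 0.

Definition phase_law : set (config_space d) -> \bar R :=
  mscale (m.+1%:R^-1)%:nng (msum (fun n => dirac (phase (inord n))) m.+1).

HB.instance Definition _ := Measure.on phase_law.

Lemma phase_lawE (A : set (config_space d)) :
  phase_law A = (m.+1%:R^-1 * \sum_(j < m.+1) \1_A (phase j))%:E.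
Proof.
rewrite /phase_law /mscale /= /msum EFinM -sumEFin; congr (_ * _)%E.
by apply: eq_bigr => j _; rewrite inord_val.
Qed.

Lemma phase_law_setT : phase_law setT = 1%E.
Proof.
rewrite phase_lawE; under eq_bigr do rewrite indicE in_setT.
by rewrite sumr_const card_ord mulVf.
Qed.

HB.instance Definition _ :=
  @Measure_isProbability.Build _ _ R phase_law phase_law_setT.

Definition phase_prob : probability (config_space d) R := phase_law.

Lemma phase_probE (A : set (config_space d)) :
  phase_prob A = (m.+1%:R^-1 * \sum_(j < m.+1) \1_A (phase j))%:E.
Proof. exact: phase_lawE. Qed.

Lemma shift_phase z : exists c : 'I_m.+1, forall j, Defs.shift z (phase j) = phase (c + j).
Proof.
have mod_lt : (absz (z ord0 i0 %% m.+1)%Z < m.+1)%N.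
  rewrite -ltz_nat gez0_abs ?modz_ge0// ltz_pmod//.
exists (Ordinal mod_lt) => j; apply/funext => x; rewrite /Defs.shift /phase mxE.
congr (if (_ < _) then _ else _).
rewrite /= -modz_nat PoszD gez0_abs ?modz_ge0// modzDmr.
by rewrite -addrA -modzDmr modzDml modzDmr.
Qed.

Lemma phase_shift (c j : 'I_m.+1) : exists z, Defs.shift z (phase j) = phase (c + j).
Proof.
exists (c%:Z *: delta_mx 0 i0); apply/funext => x; rewrite /Defs.shift /phase !mxE eqxx mulr1.
congr (if (_ < _) then _ else _).
by rewrite /= -modz_nat PoszD modzDmr addrA.
Qed.

Lemma sum_phase (F : config_space d -> R) z :
  \sum_j F (Defs.shift z (phase j)) = \sum_j F (phase j).
Proof.
have [c cE] := shift_phase z; under eq_bigr do rewrite cE.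
by rewrite [RHS](reindex_inj (addrI c)).
Qed.

(** Translations rotate the phases, which preserves the uniform law, and act transitively on them,
    so an invariant event contains all phases or none. *)
Lemma phase_prob_ergodic : translation_ergodic phase_prob.
Proof.
split=> [z A mA|A mA invA].
  rewrite !phase_probE; congr ((_ * _)%:E); rewrite -[RHS](sum_phase _ z).
  by apply: eq_bigr => j _; rewrite !indicE.
have E j : \1_A (phase j) = \1_A (phase 0) :> R.
  have [z] := phase_shift j 0; rewrite addr0 => <-.
  by rewrite -[in RHS](invA z) !indicE.
rewrite phase_probE; under eq_bigr do rewrite E.
rewrite sumr_const card_ord -[X in _ * X]mulr_natl mulrA mulVf// mul1r indicE.
by case: (_ \in _); [right|left].
Qed.

Lemma phase_prob_all_active : all_active phase_prob.
Proof.
rewrite /all_active phase_probE -(@probability_setT _ _ _ phase_prob) phase_probE.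
congr ((_ * _)%:E).
apply: eq_bigr => j _; rewrite !indicE in_setT mem_set// => x /=.
by rewrite /phase; case: ifP.
Qed.

Lemma sum_num_phase x : \sum_j num R (phase j : config d) x = k%:R.
Proof.
transitivity (\sum_(j < m.+1) num R (phase j : config d) 0).
  rewrite -(sum_phase (fun eta => num R (eta : config d) 0) x).
  by apply: eq_bigr => j _; rewrite /num /Defs.shift /= add0r.
transitivity (\sum_(j < m.+1) (j < k)%N%:R : R).
  apply: eq_bigr => j _; rewrite /num /phase mxE add0r modz_nat modn_small//.
  by rewrite ltz_nat; case: (_ < _)%N.
rewrite -natr_sum -(big_mkord xpredT (fun j => nat_of_bool (j < k)%N)) /=.
suff E n : (\sum_(0 <= i < n) (i < k))%N = minn n k by rewrite E (minn_idPr k_le).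
elim: n => [|n IH]; first by rewrite big_geq// min0n.
rewrite big_nat_recr//= IH; case: (ltnP n k) => nk /=.
  by rewrite addn1 (minn_idPl nk).
by rewrite addn0 (minn_idPr (leqW nk)).
Qed.

Lemma measurable_occ_size x :
  measurable_fun setT (fun eta : config_space d => (occ_size (eta x))%:R : R).
Proof.
move=> _ B _; rewrite setTI.
rewrite (_ : _ @^-1` B = \bigcup_(n : nat) (
    [set eta : config_space d | eta x = Act n /\ B n%:R]) `|`
    [set eta : config_space d | eta x = Slp /\ B 1]).
  have m1 a : measurable [set eta : config_space d | eta x = a].
    by apply: sub_gen_smallest; exists x, a.
  have m2 a (Q : Prop) : measurable [set eta : config_space d | eta x = a /\ Q].
    have [q|nq] := pselect Q.
      rewrite (_ : [set _ | _] = [set eta : config_space d | eta x = a])//.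
      by apply/seteqP; split => eta /=; [case|].
    rewrite (_ : [set _ | _] = set0)//.
    by apply/seteqP; split => eta //= -[].
  by apply: measurableU => //; apply: bigcupT_measurable.
apply/seteqP; split => eta /=.
  by case E : (eta x) => [n|] BE; [left; exists n|right].
by case=> [[n _ /= [-> //]]|[-> //]].
Qed.

Lemma phase_prob_density : density phase_prob = (k%:R / m.+1%:R)%:E.
Proof.
rewrite /density.
have mf : measurable_fun setT (fun eta : config_space d => ((occ_size (eta 0))%:R : R)%:E).
  by apply/measurable_EFinP; apply: measurable_occ_size.
rewrite /phase_prob /phase_law ge0_integral_mscale//= ge0_integral_measure_sum//=.
under eq_bigr => n _ do rewrite integral_dirac// diracT mul1e.
rewrite sumEFin -EFinM mulrC; congr ((_ / _)%:E).
rewrite -(sum_num_phase 0); apply: eq_bigr => j _.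
by rewrite inord_val.
Qed.

Lemma phase_prob_ge j (A : set (config_space d)) : A (phase j) ->
  ((m.+1%:R^-1)%:E <= phase_prob A)%E.
Proof.
move=> Aj; rewrite phase_probE lee_fin -[leLHS]mulr1 ler_wpM2l// (bigD1 j)//=.
rewrite [\1_A (phase j)]indicE mem_set// lerDl; apply: sumr_ge0 => i _.
by rewrite indicE.
Qed.

End PhaseLaw.

(** * Choice of the constants *)

Section FixedDensity.
Variables (R : realType) (d m k : nat) (i0 : 'I_d) (p : site d -> R) (lam : R).
Hypothesis p_jump : jump_distribution p.
Hypothesis p_directed : directed p.
Hypothesis lam_gt0 : 0 < lam.
Hypothesis k_le : (k <= m.+1)%N.

Let nu : probability (config_space d) R := phase_prob R m k i0.

Lemma exprn_small (r e : R) : 0 <= r -> r < 1 -> 0 < e -> exists n, r ^+ n <= e.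
Proof.
move=> r0 r1 e0.
have r1' : `|r| < 1 by rewrite ger0_norm.
have /cvgrPdist_le/(_ e e0)[n _ /(_ n (leqnn n))] := cvg_expr r1'.
by rewrite /= sub0r normrN ger0_norm ?exprn_ge0// => ?; exists n.
Qed.

Let xi (V : set (site d)) (j : 'I_m.+1) : config d := restrict_to V (phase k i0 j).

Lemma xiE V j x : xi V j x = if x \in V then phase k i0 j x else Act 0.
Proof. by []. Qed.

Lemma fin_xi V j : finite_set V -> fin_config (xi V j).
Proof.
apply: sub_finite_set => x; rewrite /supp /= xiE.
by case: (boolP (x \in V)); rewrite ?inE// eqxx.
Qed.

Lemma num_xi_le1 V j x : num R (xi V j) x <= 1.
Proof. by rewrite /num xiE /phase; do 2 case: ifP => // _; rewrite ler01. Qed.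

Lemma slp_xi V j x : slp R (xi V j) x = 0.
Proof.
rewrite /slp xiE /phase; case: (xi V j x =P Slp) => [|//]; rewrite xiE /phase.
by do 2 case: ifP => // _.
Qed.

(** Once [(1 + th)^-1 ^+ l <= 1 / 2], the bound of [sum_green_act_ge] is at least a quarter of the
    total excess, divided by [th]; some phase gets at least the average over the [m.+1] phases,
    which is [b / th]. *)
Let b : R := (k%:R / m.+1%:R - lam / (1 + lam)) / 4.

(** Uniformity in [V] rests on the order of the choices: [kap], [th], [tau], [T'] and [l] precede
    [V]; only [M], [N] and the phase [j] follow it, and the bound involves none of these three. *)
Lemma finite_volume_active (C : set (site d)) (T : R) :
  lam / (1 + lam) < k%:R / m.+1%:R -> finite_set C -> 0 < T ->
  exists T' V0, finite_set V0 /\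
    forall V P, finite_set V -> V0 `<=` V -> finite_ARW_law p lam nu V P ->
    ((m.+1%:R^-1 * (b ^+ 2 / 16))%:E <= P (active_in C T T'))%E.
Proof.
move=> dens finC T0.
have b0 : 0 < b by rewrite divr_gt0// subr_gt0.
have pg := p_dir_gt0 p_jump p_directed.
have ps := p_dir_sum p_jump p_directed.
have [F CF] : exists F : {fset site d}, C = [set` F] by apply/finite_fsetP.
have [z zF] := walk_reaches p (F : seq (site d)).
pose path_to x := if pselect (x \in F) is left xF then projT1 (cid (zF x xF)) else [::].
pose B := [seq path_to x | x <- (F : seq (site d))].
have BP x : C x -> exists2 s, s \in B & x = walk (dir p) z s.
  rewrite CF /= => xF; exists (path_to x); first exact: map_f.
  rewrite /path_to; case: pselect => // xF'.
  by case: (cid _).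
pose K := (\max_(s <- B) size s)%N.
have BK s : s \in B -> (size s <= K)%N.
  by move=> sB; apply: (@leq_bigmax_seq _ B xpredT (fun s => size s)).
(* A product of positive factors at most 1 is a common lower bound of them. *)
pose pmin := \prod_i p (dir p i).
have ple1 i : p (dir p i) <= 1.
  by rewrite -ps (bigD1 i)//= lerDl sumr_ge0// => j _; apply: ltW.
have pmin0 : 0 < pmin by apply: prodr_gt0.
have pminle i : pmin <= p (dir p i).
  rewrite /pmin (bigD1 i)//= -[leRHS]mulr1 ler_wpM2l ?(ltW (pg i))//.
  by apply: prodr_ile1 => j _; rewrite (ltW (pg j)) ple1.
have pmin1 : pmin <= 1 by apply: prodr_ile1 => j _; rewrite (ltW (pg j)) ple1.
(* With [tau = kap / th], the requirement [2 * tau <= b / (2 * th) * (pmin / 2) ^+ K] becomes an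
   equality. *)
pose kap := b * (pmin / 2) ^+ K / 4.
have kap0 : 0 < kap by rewrite divr_gt0// mulr_gt0// exprn_gt0// divr_gt0.
(* At [tau = kap / th] the cost of one target is exactly [th * D], which [th0] makes small. *)
pose D := K%:R * ((kap ^+ 2)^-1 + 3 / kap) + (expR 1 * T + 1) / kap.
have D0 : 0 <= D.
  have e0 : 0 <= expR 1 * T by rewrite mulr_ge0 ?expR_ge0// ltW.
  rewrite addr_ge0//.
    by rewrite mulr_ge0// addr_ge0 ?invr_ge0 ?sqr_ge0// divr_ge0// ltW.
  by rewrite divr_ge0 ?(ltW kap0)// addr_ge0.
pose th0 := b ^+ 2 / 16 / ((size B)%:R * D + 1).
have SD : 0 < (size B)%:R * D + 1 by rewrite ltr_wpDl// mulr_ge0.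
have th0_gt0 : 0 < th0 by rewrite divr_gt0// divr_gt0// exprn_gt0.
pose th := Num.min 1 th0.
have th_gt0 : 0 < th by rewrite lt_min ltr01.
have th_le1 : th <= 1 by rewrite ge_min lexx.
have th_le0 : th <= th0 by rewrite ge_min lexx orbT.
pose tau := kap / th.
have tau0 : 0 < tau by rewrite divr_gt0.
have th_neq0 : th != 0 by rewrite gt_eqF.
have kap_neq0 : kap != 0 by rewrite gt_eqF.
have Dth : K%:R * ((th * tau ^+ 2)^-1 + 3 / tau) + (expR 1 * T + 1) / tau = th * D.
  by rewrite /D /tau; field; rewrite kap_neq0.
pose T' := 4 / th ^+ 2.
have T'large : expR (- (th * T' / 2)) * (2 / th) <= 1.
  have -> : th * T' / 2 = 2 / th by rewrite /T'; field.
  rewrite expRN -ler_pdivlMl ?invr_gt0 ?expR_gt0// invrK mulr1.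
  by apply: le_trans (expR_ge1Dx _); rewrite lerDr.
have r0 : 0 <= (1 + th)^-1 by rewrite invr_ge0 addr_ge0// ltW.
have r1 : (1 + th)^-1 < 1 by rewrite invf_lt1 ?ltrDl// addr_gt0.
have half0 : 0 < 2^-1 :> R by rewrite invr_gt0.
have [l lE] := exprn_small r0 r1 half0.
exists T', (ancestors (dir p) l z); split; first exact: finite_ancestors.
move=> V P finV ancV lawV.
pose M := \sum_j nsum (xi V j) (fun=> 1 : R).
have adm j : admissible M (xi V j).
  split; first exact: fin_xi.
  rewrite /M (bigD1 j)//= lerDl; apply: sumr_ge0 => i _.
  exact: nsum_ge0.
have M0 : 0 <= M by apply: sumr_ge0 => j _; apply: nsum_ge0.
pose q := lam / (1 + lam).
(* Serves both truncation conditions: [N1] for the gains, [N2] for the mass balance. *)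
pose ee := Num.min 1 ((k%:R - m.+1%:R * q) / 2 / m.+1%:R) / (M + 1).
have mk : 0 < (k%:R - m.+1%:R * q) / 2.
  by rewrite divr_gt0// subr_gt0 mulrC -ltr_pdivlMr.
have ee0 : 0 < ee.
  by rewrite divr_gt0 ?ltr_wpDl// lt_min ltr01 divr_gt0.
have lM : 0 <= (1 + lam) * M by rewrite mulr_ge0// addr_ge0// ltW.
have dn : 0 < (1 + lam) * M + th by rewrite ltr_wpDl.
have rho0 : 0 <= (1 + lam) * M / ((1 + lam) * M + th) by rewrite divr_ge0// ltW.
have rho1 : (1 + lam) * M / ((1 + lam) * M + th) < 1.
  by rewrite ltr_pdivrMr// mul1r ltrDl.
have [N NE] := exprn_small rho0 rho1 ee0.
set rN := _ ^+ N in NE.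
have M1 : (M + 1) * rN <= Num.min 1 ((k%:R - m.+1%:R * q) / 2 / m.+1%:R).
  by rewrite mulrC -ler_pdivlMr// ltr_wpDl.
have rN0 : 0 <= rN by apply: exprn_ge0.
have N1 : M * rN <= 1.
  apply: (@le_trans _ _ ((M + 1) * rN)); first by rewrite mulrDl mul1r lerDl.
  by apply: le_trans M1 _; rewrite ge_min lexx.
have N2 : m.+1%:R * ((M + 1) * rN) <= (k%:R - m.+1%:R * q) / 2.
  rewrite mulrC -ler_pdivlMr//; apply: le_trans M1 _.
  by rewrite ge_min lexx orbT.
have sumk x : V x -> \sum_j num R (xi V j) x = k%:R.
  move=> Vx; rewrite -(sum_num_phase R i0 k_le x); apply: eq_bigr => j _.
  by rewrite /num xiE mem_set.
have low := sum_green_act_ge lam_gt0 pg ps (@dir_neq0 _ _ p) (@height_dir _ _ p)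
  th_gt0 M0 adm (slp_xi V) sumk N2 ancV.
have [j bj] : exists j, b / th <= green lam (dir p) (fun k => p (dir p k)) th N
    (fun e => act R e z) (xi V j).
  apply: contrapT => noj.
  have : \sum_(j < m.+1) green lam (dir p) (fun k => p (dir p k)) th N
      (fun e => act R e z) (xi V j) < \sum_(j < m.+1) b / th.
    apply: ltr_sum => [|j _]; first by apply/hasP; exists ord0; rewrite // mem_index_enum.
    by rewrite ltNge; apply/negP => bj; apply: noj; exists j.
  rewrite sumr_const card_ord ltNge => /negP; apply; apply: le_trans low.
  rewrite -[leLHS]mulr_natl.
  have -> : m.+1%:R * (b / th) = (k%:R - m.+1%:R * q) / 2 / th * 2^-1.
    by rewrite /b /q; field; rewrite th_neq0/= !gt_eqF// addr_gt0.
  rewrite ler_wpM2l//; first by rewrite divr_ge0 ?ltW.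
  by lra.
have [w wE] : exists w, nu [set zeta | restrict_to V zeta = xi V j] = w%:E.
  by eexists; apply: phase_probE.
have wge : m.+1%:R^-1 <= w.
  by rewrite -lee_fin -wE; apply: phase_prob_ge.
have bm : b / th <= mom1 lam (dir p) (fun k => p (dir p k)) th (loss R z) N (xi V j).
  rewrite mom1E; apply: le_trans bj _.
  apply: (green_le lam_gt0 pg (@dir_neq0 _ _ p) th_gt0 N (adm j)).
  by move=> e [fe _]; rewrite (gen_loss lam ps (@dir_neq0 _ _ p) z fe).
have kapE : 2 * tau <= b / (2 * th) * (pmin / 2) ^+ K.
  rewrite /tau /kap; set y := _ ^+ K; clearbody y.
  suff -> : 2 * (b * y / 4 / th) = b / (2 * th) * y by [].
  by clear -th_neq0; field.
have DE : (size B)%:R * (K%:R * ((th * tau ^+ 2)^-1 + 3 / tau) + (expR 1 * T + 1) / tau)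
    <= b ^+ 2 / 16.
  rewrite Dth mulrCA; apply: (@le_trans _ _ (th0 * ((size B)%:R * D + 1))).
    by rewrite ler_pM ?(ltW th_gt0) ?mulr_ge0// lerDl.
  by rewrite /th0 divfK// gt_eqF.
clearbody D th0 T'.
have H1 := finite_system_active p_jump p_directed lam_gt0 lawV wE th_gt0 M0
  (adm j).
have H2 := H1 N T T' b pmin tau K z B C (num_xi_le1 V j) N1.
have H3 := H2 th_le1 T0 b0 pmin0 pmin1 pminle tau0 BK kapE.
have H4 := H3 T'large DE bm finC BP.
apply: le_trans H4.
by rewrite lee_fin ler_wpM2r// divr_ge0 ?sqr_ge0.
Qed.

End FixedDensity.

(** * The infinite system *)

Section InfiniteVolume.
Variables (R : realType) (d : nat) (p : site d -> R) (lam : R).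
Variables (nu : probability (config_space d) R) (P : probability (path_space R d) R).
Hypothesis lawP : ARW_law p lam nu P.
Variable c : R.
Hypothesis finite_volume : forall (C : set (site d)) (T : R), finite_set C -> 0 < T ->
  exists T' V0, finite_set V0 /\
    forall V P, finite_set V -> V0 `<=` V -> finite_ARW_law p lam nu V P ->
    (c%:E <= P (active_in C T T'))%E.

Definition first_sites n : set (site d) := [set x | (choice.pickle x < n)%N].

Lemma finite_first_sites n : finite_set (first_sites n).
Proof.
apply: (@finite_preimage _ _ `I_n choice.pickle); last exact: finite_II.
by move=> x y _ _; apply: (pcan_inj choice.pickleK).
Qed.

Lemma first_sites_sub m n : (m <= n)%N -> first_sites m `<=` first_sites n.
Proof. by move=> mn x /= /leq_trans; apply. Qed.

Lemma finite_sub_first_sites (V : set (site d)) : finite_set V ->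
  exists n, V `<=` first_sites n.
Proof.
move=> finV; have [F VF] : exists F : {fset site d}, V = [set` F] by apply/finite_fsetP.
exists (\max_(x <- (F : seq (site d))) choice.pickle x).+1 => x; rewrite VF /= => xF.
rewrite /first_sites /= ltnS.
exact: (@leq_bigmax_seq _ (F : seq (site d)) xpredT choice.pickle).
Qed.

(** Activity after [T] is not a local event; activity in the bounded window is, so the finite-volume
    bound passes to the limit for it. *)
Lemma active_after_ge (C : set (site d)) (T : R) : finite_set C -> 0 < T ->
  (c%:E <= P (active_after C T))%E.
Proof.
move=> finC T0; have [T' [V0 [finV0 low]]] := finite_volume finC T0.
have [PV [lawPV limPV]] := lawP.
have loc : local_event C T' (active_in C T T').
  apply: measurable_active_in => // x s a Cx /andP[Ts sT'].
  by exists x, s, a; split => //=; rewrite sT' (le_trans (ltW T0)).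
have cvP := limPV C T' _ finC loc first_sites finite_first_sites first_sites_sub.
have cv : PV (first_sites n) (active_in C T T') @[n --> \oo] --> P (active_in C T T').
  apply: cvP; apply/seteqP; split => // x _.
  by exists (choice.pickle x).+1 => //; rewrite /first_sites /= ltnSn.
have mA : measurable (active_in C T T' : set (path_space R d)).
  apply: measurable_active_in => // x s a Cx /andP[Ts _].
  by exists x, s, a; split => //; rewrite /= (le_trans (ltW T0)).
apply: (@le_trans _ _ (P (active_in C T T'))); last first.
  apply: le_measure; rewrite ?inE//; first exact: measurable_active_after (ltW T0).
  by move=> v H x /H [q [? _ ?]]; exists q.
rewrite -(cvg_lim _ cv)//; apply: lime_ge; first by apply/cvg_ex; eexists; exact: cv.
have [n0 V0n] := finite_sub_first_sites finV0.
exists n0 => // n /= n0n; apply: low; first exact: finite_first_sites.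
  by apply: subset_trans V0n _; apply: first_sites_sub.
exact/lawPV/finite_first_sites.
Qed.

Lemma stays_active_ge : (c%:E <= P (@stays_active R d))%E.
Proof.
rewrite stays_activeE.
pose F n := active_after (first_sites n) (n%:R : R) : set (path_space R d).
have mF n : measurable (F n).
  by apply: measurable_active_after; [exact: finite_first_sites|exact: ler0n].
have subF m n : (m <= n)%N -> F n `<=` F m.
  move=> mn v H x /(first_sites_sub mn)/H[q [nq ?]]; exists q; split => //.
  by apply: le_trans nq; rewrite ler_nat.
have cv : P (F n) @[n --> \oo] --> P (\bigcap_n F n).
  apply: nonincreasing_cvg_mu => //.
  - by rewrite (le_lt_trans (probability_le1 P (mF 0%N)))// ltry.
  - exact: bigcapT_measurable.
  - by move=> m n mn; apply/subsetPset; apply: subF.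
rewrite -(cvg_lim _ cv)//; apply: lime_ge; first by apply/cvg_ex; eexists; exact: cv.
(* The index [n.+1] provides the positive time that the bound requires. *)
apply: nearW => n; apply: (@le_trans _ _ (P (F n.+1))).
  by apply: active_after_ge; [exact: finite_first_sites|rewrite ltr0n].
by apply: le_measure; rewrite ?inE//; apply: subF.
Qed.

End InfiniteVolume.

(** The rational is taken below 1 as well, which gives [k <= m.+1]: a period has room for [k] sites
    with one particle each. *)
Lemma fraction_between (R : realType) (x y : R) : 0 <= x -> x < y -> x < 1 ->
  exists m k : nat, [/\ (k <= m.+1)%N, x < k%:R / m.+1%:R & k%:R / m.+1%:R < y].
Proof.
move=> x0 xy x1; have /rat_in_itvoo[r] : x < Num.min y 1 by rewrite lt_min xy.
rewrite in_itv/= lt_min => /andP[xr /andP[ry r1]].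
have r0 : 0 <= r by rewrite -(ler0q R) (le_trans x0)// ltW.
have rE : ratr r = (absz (numq r))%:R / ((absz (denq r)).-1.+1)%:R :> R.
  have dE : (absz (denq r)).-1.+1 = absz (denq r) by rewrite prednK// absz_gt0 denq_neq0.
  rewrite dE /ratr !pmulrn !abszE !ger0_norm ?numq_ge0//.
exists (absz (denq r)).-1, (absz (numq r)); rewrite -rE; split => //.
by rewrite -(@ler_nat R) -[leRHS]mul1r -ler_pdivrMr ?ltr0n// -rE ltW.
Qed.

Theorem corollary3p4 (R : realType) (d : nat) (p : site d -> R) (lam zc : R)
  (d_ge1 : (1 <= d)%N)
  (lam_gt0 : 0 < lam)
  (p_jump : jump_distribution p)
  (p_directed : directed p)
  (zc_critical : critical_density p lam zc) :
  zc <= lam / (1 + lam).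
Proof.
rewrite leNgt; apply/negP => qzc.
have q0 : 0 <= lam / (1 + lam) by rewrite divr_ge0 ?addr_ge0 ?(ltW lam_gt0).
have q1 : lam / (1 + lam) < 1 by rewrite ltr_pdivrMr ?mul1r ?ltrDr ?addr_gt0.
have [m [k [km qk kz]]] := fraction_between q0 qzc q1.
pose i0 : 'I_d := Ordinal d_ge1.
have [P lawP [P0 _]] := zc_critical (phase_prob R m k i0) (k%:R / m.+1%:R)
  (@phase_prob_ergodic _ _ _ _ _) (@phase_prob_all_active _ _ _ _ _)
  (phase_prob_density R i0 km).
have := stays_active_ge lawP (fun C T finC T0 =>
  finite_volume_active i0 p_jump p_directed lam_gt0 km qk finC T0).
rewrite P0// lee_fin leNgt => /negP; apply.
by rewrite mulr_gt0 ?invr_gt0// divr_gt0// exprn_gt0// divr_gt0// subr_gt0.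
Qed.
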